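(* Let $k$ be a field. Let the cogenerators $x_i$ be of even nonnegative degree and let the cogenerators $y_i$ be of odd nonnegative degree, with only finitely many cogenerators in any given degree. Then there are isomorphisms of bigraded coalgebras $$\mathrm{coHH}_*(\Gamma_k[x_1,x_2,\dots])\cong\Gamma_k[x_1,x_2,\dots]\otimes\Lambda_k(z_1,z_2,\dots),$$ where $\deg(z_i)=(1,\deg(x_i))$, and $$\mathrm{coHH}_*(\Lambda_k(y_1,y_2,\dots))\cong\Lambda_k(y_1,y_2,\dots)\otimes k[w_1,w_2,\dots],$$ where $\deg(w_i)=(1,\deg(y_i))$.
   Context: For a counital graded $k$-coalgebra $(C,\triangle,\epsilon)$, $\mathrm{coHH}_*(C)$ is the cohomology of the (normalized) cochain complex of the cosimplicial graded $k$-module $\mathrm{coTHH}^\bullet(C)$ with $\mathrm{coTHH}^n(C)=C^{\otimes n+1}$, cofaces $\delta_i=\mathrm{id}^{\otimes i}\otimes\triangle\otimes\mathrm{id}^{\otimes n-i}$ ($0\le i\le n$), $\delta_{n+1}=\tau_{C,C^{\otimes n+1}}\circ(\triangle\otimes\mathrm{id}^{\otimes n})$ ($\tau$ the graded symmetry), codegeneracies $\sigma_i=\mathrm{id}^{\otimes i+1}\otimes\epsilon\otimes\mathrm{id}^{\otimes n-i}$; bidegrees are (cosimplicial degree, internal degree), and elements of $C$ have bidegree $(0,* )$. If $C$ is cocommutative, $X^\bullet=\mathrm{coTHH}^\bullet(C)$ is a cosimplicial coalgebra and $\mathrm{coHH}_*(C)$ is a coalgebra via the map induced by $X^\bullet\to\mathrm{diag}(X^\bullet\otimes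 X^\bullet)$ followed by the inverse of the Alexander--Whitney/K\''unneth isomorphism $H^*(X^\bullet)\otimes H^*(X^\bullet)\cong H^*(\mathrm{diag}(X^\bullet\otimes X^\bullet))$. $\Gamma_k[x_1,x_2,\dots]$ is the divided power Hopf algebra on even-degree generators, with coproduct determined multiplicatively by $\triangle(\gamma_j(x_i))=\sum_{a+b=j}\gamma_a(x_i)\otimes\gamma_b(x_i)$. $\Lambda_k(y_1,y_2,\dots)$ is the exterior Hopf algebra on odd-degree generators (squares zero), with the $y_i$ primitive. $k[w_1,w_2,\dots]$ is the polynomial Hopf algebra on generators of even (total) degree, with $\triangle(w_i^j)=\sum_l\binom{j}{l}w_i^l\otimes w_i^{j-l}$ (so the $w_i$ are primitive). *)

(* Defs.v *)
From HB Require Import structures.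
From mathcomp Require Import all_boot all_order all_algebra.
From mathcomp Require Import finmap multiset monalg.
From mathcomp Require Import boolp classical_sets functions cardinality fsbigop.

Set Implicit Arguments.
Unset Strict Implicit.
Unset Printing Implicit Defensive.

Import GRing.Theory.
Local Open Scope quotient_scope.
Local Open Scope ring_scope.

(* A graded vector space with a chosen homogeneous basis T is represented by
   {malg k[T]} (finitely supported functions T -> k); the tensor product of
   {malg k[S]} and {malg k[T]} is then {malg k[(S * T)%type]}. *)

Section LinearExtension.
Variable k : fieldType.

Definition lext (T : choiceType) (V : lmodType k) (f : T -> V)
  (x : {malg k[T]}) : V := \sum_(t <- msupp x) x@_t *: f t.

Lemma lextEw (T : choiceType) (V : lmodType k) (f : T -> V)
    (x : {malg k[T]}) (D : {fset T}) :
  (msupp x `<=` D)%fset -> lext f x = \sum_(t <- D) x@_t *: f t.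
Proof.
move=> sxD; rewrite /lext; apply: (big_fset_incl _ sxD) => t _ tNx.
by rewrite mcoeff_outdom // scale0r.
Qed.

Lemma lext_is_linear (T : choiceType) (V : lmodType k) (f : T -> V) :
  linear (lext f).
Proof.
move=> a x y; pose D := (msupp x `|` msupp y `|` msupp (a *: x + y)%R)%fset.
rewrite !(@lextEw _ _ f _ D).
- rewrite scaler_sumr -big_split /=; apply: eq_bigr => t _.
  by rewrite mcoeffD mcoeffZ scalerDl scalerA.
all: by apply/fsubsetP => t tz; rewrite /D !in_fsetE tz ?orbT.
Qed.

HB.instance Definition _ (T : choiceType) (V : lmodType k) (f : T -> V) :=
  GRing.isLinear.Build k {malg k[T]} V *:%R (lext f) (lext_is_linear f).

Definition mtens (S T : choiceType) (x : {malg k[S]}) (y : {malg k[T]}) :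
  {malg k[(S * T)%type]} := lext (fun s => lext (fun t => << (s, t) >>) y) x.

End LinearExtension.

Section QuotientModule.
Variables (k : fieldType) (V : lmodType k) (S : submodClosed V).

(* A copy of S carrying the structure required by Quotient.quot. *)
Definition submod_pred : {pred V} := fun x => x \in S.

Lemma submod_predB : zmod_closed submod_pred.
Proof.
split=> [|x y]; first exact: (rpred0 S).
move=> Sx Sy; rewrite -[_ \in _]/(x - y \in S) -scaleN1r.
by apply: rpredD => //; apply: rpredZ.
Qed.

HB.instance Definition _ := GRing.isZmodClosed.Build V submod_pred submod_predB.

Definition quotm : Type := Quotient.quot submod_pred.
HB.instance Definition _ := GRing.Zmodule.on quotm.
HB.instance Definition _ := EqQuotient.on quotm.

Definition qscale (a : k) (q : quotm) : quotm := \pi_quotm (a *: repr q).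

Lemma qclassP (x y : V) : \pi_quotm x = \pi_quotm y <-> x - y \in S.
Proof.
have E : (x - y \in S) = (x == y %[mod quotm])%qT.
  exact: (@Quotient.idealrBE V submod_pred x y).
by rewrite E; split=> /eqP.
Qed.

Lemma qclassD (x y : V) : \pi_quotm (x + y) = \pi_quotm x + \pi_quotm y.
Proof. exact: (raddfD (\pi_(Quotient.quot submod_pred))). Qed.

Lemma qscale_pi a (x : V) : qscale a (\pi_quotm x) = \pi_quotm (a *: x).
Proof. by apply/qclassP; rewrite -scalerBr rpredZ //; apply/qclassP/reprK. Qed.

Lemma qscaleA a b q : qscale a (qscale b q) = qscale (a * b) q.
Proof. by rewrite -[q]reprK (qscale_pi b) (qscale_pi a) qscale_pi scalerA. Qed.
Lemma qscale1 : left_id 1 qscale.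
Proof. by move=> q; rewrite -[q]reprK qscale_pi scale1r. Qed.
Lemma qscaleDr : right_distributive qscale +%R.
Proof.
move=> a q r; rewrite -[q]reprK -[r]reprK.
by rewrite -qclassD qscale_pi scalerDr qclassD -!qscale_pi.
Qed.
Lemma qscaleDl q : {morph qscale^~ q : a b / a + b}.
Proof.
by move=> a b /=; rewrite -[q]reprK qscale_pi scalerDl qclassD -!qscale_pi.
Qed.

HB.instance Definition _ := GRing.Zmodule_isLmodule.Build k quotm
  qscaleA qscale1 qscaleDr qscaleDl.

Definition qclass (x : V) : quotm := \pi_quotm x.

Lemma qclass_is_linear : linear qclass.
Proof. by move=> a x y; rewrite /qclass qclassD -qscale_pi. Qed.

HB.instance Definition _ := GRing.isLinear.Build k V quotm *:%R qclass
  qclass_is_linear.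

End QuotientModule.

Section Tensor.
Variable k : fieldType.
Implicit Types U V W : lmodType k.

Inductive bilinear_rel V W : {malg k[(V * W)%type]} -> Prop :=
| BRel0 : bilinear_rel 0
| BRelD a x y : bilinear_rel x -> bilinear_rel y -> bilinear_rel (a *: x + y)
| BRelL a v v' w : bilinear_rel
    (<< (a *: v + v', w) >> - (a *: << (v, w) >> + << (v', w) >>))
| BRelR a v w w' : bilinear_rel
    (<< (v, a *: w + w') >> - (a *: << (v, w) >> + << (v, w') >>)).

Definition bilinear_pred V W : {pred {malg k[(V * W)%type]}} :=
  fun x => `[< bilinear_rel x >].

Lemma bilinear_pred_closed V W : submod_closed (@bilinear_pred V W).
Proof.
split=> [|a x y]; first exact/asboolP/BRel0.
by move=> /asboolP hx /asboolP hy; apply/asboolP/BRelD.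
Qed.

HB.instance Definition _ V W := GRing.isSubmodClosed.Build k {malg k[(V * W)%type]}
  (@bilinear_pred V W) (GRing.submod_closed_semi (@bilinear_pred_closed V W)).

Definition tens V W : lmodType k := quotm (@bilinear_pred V W).

Definition tensor V W (v : V) (w : W) : tens V W := qclass _ << (v, w) >>.

(* The linear map induced by f; for bilinear f it does not depend on the
   representative. *)
Definition tlift V W U (f : V -> W -> U) (t : tens V W) : U :=
  lext (fun vw => f vw.1 vw.2) (repr t).

Definition tmap V W V' W' (f : V -> V') (g : W -> W') : tens V W -> tens V' W' :=
  tlift (fun v w => tensor (f v) (g w)).

End Tensor.

Section Coalgebras.
Variable k : fieldType.

(* Structure maps of a counital coalgebra with a homogeneous basis, graded
   over G. *)
Record coalg (G : Type) := Coalg {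
  cbas : choiceType;
  cdeg : cbas -> G;
  comult : cbas -> {malg k[(cbas * cbas)%type]};
  counit : cbas -> k }.

(* Structure maps of a counital bigraded coalgebra on an arbitrary vector
   space; bhomog p s is the component of bidegree (p, s). *)
Record bgcoalg := BgCoalg {
  bcar :> lmodType k;
  bhomog : nat -> nat -> bcar -> Prop;
  bcomult : bcar -> tens bcar bcar;
  bcounit : bcar -> k }.

Definition bgcoalg_iso (A B : bgcoalg) : Prop :=
  exists f : {linear bcar A -> bcar B},
    [/\ bijective f,
        forall p s x, bhomog p s (f x) <-> bhomog p s x,
        forall x, bcomult (f x) = tmap f f (bcomult x) &
        forall x, bcounit (f x) = bcounit x].

Definition bgcoalg_of (A : coalg (nat * nat)) : bgcoalg :=
  @BgCoalg {malg k[cbas A]}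
    (fun p s x => forall t, t \in msupp x -> cdeg t = (p, s))
    (lext (fun t => lext (fun uv => tensor << uv.1 >> << uv.2 >>) (comult t)))
    (lext (fun t => counit t : k^o)).

(* The symmetry of bigraded vector spaces: exchanging elements of bidegrees
   (p, s) and (q, t) costs the sign (-1)^(p q + s t).  This is the sign for
   which the unsigned Alexander-Whitney isomorphism is symmetric monoidal. *)
Definition bisign (a b : nat * nat) : k :=
  (-1) ^+ (a.1 * b.1 + a.2 * b.2)%N.

Definition ctens (A B : coalg (nat * nat)) : coalg (nat * nat) :=
  @Coalg _ (cbas A * cbas B)%type
    (fun t => cdeg t.1 + cdeg t.2)
    (fun t => lext (fun a => lext (fun b =>
         bisign (cdeg a.2) (cdeg b.1) *: << ((a.1, b.1), (a.2, b.2)) >>)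
       (comult t.2)) (comult t.1))
    (fun t => counit t.1 * counit t.2).

End Coalgebras.

Section HopfCoalgebras.
Variables (k : fieldType) (I : countType) (G : nmodType) (d : I -> G).

Local Notation mon := {mset I}%mset.

Definition mdeg (m : mon) : G := \sum_(i <- finsupp m) d i *+ m i.

(* The basis element m stands for the product over i of gamma_(m i)(x_i);
   generators are even, so the product of the coproducts of the
   gamma_(m i)(x_i) involves no sign. *)
Definition divpow_comult (m : mon) : {malg k[(mon * mon)%type]} :=
  \sum_(a \in [set a : mon | (a `<=` m)%mset]%classic)
    (<< (a, (m `\` a)%mset : mon) >> : {malg k[(mon * mon)%type]}).

Definition divpow_coalg : coalg k G :=
  @Coalg k G mon mdeg divpow_comult (fun m => (m == mset0)%:R).

(* The basis element m stands for the product over i of w_i^(m i). *)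
Definition poly_comult (m : mon) : {malg k[(mon * mon)%type]} :=
  \sum_(a \in [set a : mon | (a `<=` m)%mset]%classic)
    ((\prod_(i <- finsupp m) 'C(m i, a i))%N%:R : k)
      *: (<< (a, (m `\` a)%mset : mon) >> : {malg k[(mon * mon)%type]}).

Definition poly_coalg : coalg k G :=
  @Coalg k G mon mdeg poly_comult (fun m => (m == mset0)%:R).

(* The number of pairs (i, j) in A * B such that j comes before i, in the
   order of the enumeration of I. *)
Definition inversions (A B : {fset I}) : nat :=
  (\sum_(i <- A) \sum_(j <- B) (choice.pickle j < choice.pickle i))%N.

(* The basis element S stands for the product of the y_i, i in S, taken in
   increasing order.  In the product of the y_i (x) 1 + 1 (x) y_i, each
   y_i (x) 1 anticommutes with each 1 (x) y_j. *)
Definition ext_comult (S : {fset I}) : {malg k[({fset I} * {fset I})%type]} :=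
  \sum_(A <- fpowerset S)
    ((-1) ^+ inversions A (S `\` A)%fset : k) *: << (A, (S `\` A)%fset) >>.

Definition ext_coalg : coalg k G :=
  @Coalg k G {fset I} (fun S => \sum_(i <- S) d i) ext_comult
    (fun S => (S == fset0)%:R).

End HopfCoalgebras.

Section Cohomology.
Variable k : fieldType.

(* Cosimplicial graded vector spaces with homogeneous bases.  The basis of
   X^n consists of the t with cell t and sdim t = n; other t are ignored.
   sdeg is the internal degree; coface i t is used for i <= sdim t + 1 and
   codegen i t for i < sdim t. *)
Record cosimp := Cosimp {
  sbas : choiceType;
  cell : pred sbas;
  sdim : sbas -> nat;
  sdeg : sbas -> nat;
  coface : nat -> sbas -> {malg k[sbas]};
  codegen : nat -> sbas -> {malg k[sbas]} }.

Section Complex.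
Variable X : cosimp.
Let M := {malg k[sbas X]}.

Definition differential : M -> M :=
  lext (fun t => \sum_(i < (sdim t).+2) (-1) ^+ i *: coface i t).

Definition codegeneracy (i : nat) : M -> M :=
  lext (fun t => if (i < sdim t)%N then codegen i t else 0).

Definition normalized (x : M) : Prop :=
  (forall t, t \in msupp x -> cell t) /\ (forall i, codegeneracy i x = 0).

Lemma normalized0 : normalized 0.
Proof. by split=> [t|i]; rewrite ?msupp0 // /codegeneracy linear0. Qed.

Lemma normalizedP a x y :
  normalized x -> normalized y -> normalized (a *: x + y).
Proof.
move=> [cx nx] [cy ny]; split=> [t|i]; last first.
  rewrite /codegeneracy lext_is_linear.
  by move: (nx i) (ny i); rewrite /codegeneracy => -> ->; rewrite scaler0 addr0.
rewrite -mcoeff_neq0 mcoeffD mcoeffZ => nz.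
have [/cx//|tx] := boolP (t \in msupp x).
have [/cy//|ty] := boolP (t \in msupp y).
by move: nz; rewrite !mcoeff_outdom // mulr0 addr0 eqxx.
Qed.

Definition cocycle_pred : {pred M} :=
  fun x => `[< normalized x /\ differential x = 0 >].

Lemma cocycle_pred_closed : submod_closed cocycle_pred.
Proof.
split=> [|a x y].
  by apply/asboolP; split; [exact: normalized0 | exact: linear0].
move=> /asboolP[nx dx] /asboolP[ny dy]; apply/asboolP.
split; first exact: normalizedP.
rewrite /differential lext_is_linear.
by move: dx dy; rewrite /differential => -> ->; rewrite scaler0 addr0.
Qed.

HB.instance Definition _ := GRing.isSubmodClosed.Build k M
  cocycle_pred (GRing.submod_closed_semi cocycle_pred_closed).

Definition cocycle : Type := {x : M | x \in cocycle_pred}.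
HB.instance Definition _ := [isSub of cocycle for @sval _ _].
HB.instance Definition _ := [Choice of cocycle by <:].
HB.instance Definition _ := [SubChoice_isSubLmodule of cocycle by <:].

Definition coboundary_pred : {pred cocycle} :=
  fun z => `[< exists2 y, normalized y & val z = differential y >].

Lemma coboundary_pred_closed : submod_closed coboundary_pred.
Proof.
split=> [|a x y].
  apply/asboolP; exists 0; first exact: normalized0.
  by rewrite /differential !linear0.
move=> /asboolP[x' nx ex] /asboolP[y' ny ey]; apply/asboolP.
exists (a *: x' + y'); first exact: normalizedP.
by rewrite /differential !linearP /= ex ey.
Qed.

HB.instance Definition _ := GRing.isSubmodClosed.Build k cocycle
  coboundary_pred (GRing.submod_closed_semi coboundary_pred_closed).

Definition cohomology : lmodType k := quotm coboundary_pred.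

Definition coclass (x : M) : cohomology := qclass _ (insubd (0 : cocycle) x).

Definition corepr (h : cohomology) : M := val (repr h).

End Complex.

(* The map induced by a morphism g of cosimplicial vector spaces, for which the
   choice of the representative corepr h does not matter. *)
Definition cohomology_map (X Y : cosimp)
    (g : {malg k[sbas X]} -> {malg k[sbas Y]}) (h : cohomology X) :
  cohomology Y := coclass (g (corepr h)).

(* The diagonal of the levelwise tensor product. *)
Definition diag (X Y : cosimp) : cosimp :=
  @Cosimp (sbas X * sbas Y)%type
    (fun t => [&& cell t.1, cell t.2 & sdim t.1 == sdim t.2])
    (fun t => sdim t.1)
    (fun t => sdeg t.1 + sdeg t.2)%N
    (fun i t => mtens (coface i t.1) (coface i t.2))
    (fun i t => mtens (codegen i t.1) (codegen i t.2)).

Definition first_coface (X : cosimp) : {malg k[sbas X]} -> {malg k[sbas X]} :=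
  lext (coface 0).

Definition last_coface (X : cosimp) : {malg k[sbas X]} -> {malg k[sbas X]} :=
  lext (fun t => coface (sdim t).+1 t).

(* On X^p (x) Y^q this is
   x (x) y |-> (delta_(p+q) ... delta_(p+1) x) (x) (delta_0 ... delta_0 y). *)
Definition alexander_whitney (X Y : cosimp)
    (x : {malg k[sbas X]}) (y : {malg k[sbas Y]}) :
  {malg k[sbas (diag X Y)]} :=
  lext (fun t => lext (fun u =>
      mtens (iter (sdim u) (@last_coface X) << t >>)
            (iter (sdim t) (@first_coface Y) << u >>)) y) x.

Definition kunneth (X Y : cosimp) :
  tens (cohomology X) (cohomology Y) -> cohomology (diag X Y) :=
  tlift (fun h h' => coclass (alexander_whitney (corepr h) (corepr h'))).

(* The inverse of the bijection kunneth, given by the choice of a preimage. *)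
Definition kunneth_inv (X Y : cosimp) (h : cohomology (diag X Y)) :
  tens (cohomology X) (cohomology Y) := xget 0 [set t | kunneth t = h]%classic.

End Cohomology.

Section CoHochschild.
Variables (k : fieldType) (C : coalg k nat).

(* The basis of the (n+1)-fold tensor power of C: words of length n+1. *)
Local Notation word := (seq (cbas C)).

Definition wdeg (s : word) : nat := (\sum_(b <- s) cdeg b)%N.

Definition coTHH_coface (i : nat) (s : word) : {malg k[word]} :=
  if drop i s is b :: r then
    lext (fun a => << take i s ++ [:: a.1, a.2 & r] >>) (comult b)
  else if s is b :: r then
    lext (fun a => (-1) ^+ (cdeg a.1 * wdeg (a.2 :: r))%N
                     *: << rcons (a.2 :: r) a.1 >>) (comult b)
  else 0.

Definition coTHH_codegen (i : nat) (s : word) : {malg k[word]} :=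
  if drop i.+1 s is b :: r then counit b *: << take i.+1 s ++ r >> else 0.

Definition coTHH : cosimp k :=
  @Cosimp k word (fun s => s != [::]) (fun s => (size s).-1) wdeg
    coTHH_coface coTHH_codegen.

(* The comultiplication of the tensor coalgebra C^(x)(n+1): apply the
   comultiplication of C to each letter, then move all the first tensor
   factors to the left. *)
Fixpoint word_comult (s : word) : {malg k[(word * word)%type]} :=
  if s is b :: r then
    lext (fun a => lext (fun u =>
        (-1) ^+ (cdeg a.2 * wdeg u.1)%N *: << (a.1 :: u.1, a.2 :: u.2) >>)
      (word_comult r)) (comult b)
  else << ([::], [::]) >>.

(* coHH_*(C), as a coalgebra when C is cocommutative.  The counit is induced
   by the map from coTHH(C) to the constant cosimplicial object k, whose
   cohomology is k in degree 0. *)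
Definition coHH : bgcoalg k :=
  @BgCoalg k (cohomology coTHH)
    (fun p s h => exists z : cocycle coTHH, h = qclass _ z /\
       forall w, w \in msupp (val z) -> sdim w = p /\ sdeg w = s)
    (fun h => kunneth_inv
       (cohomology_map (X := coTHH) (Y := diag coTHH coTHH) (lext word_comult) h))
    (fun h => lext (fun w : word => if w is [:: b] then counit b : k^o else 0)
       (corepr h)).

End CoHochschild.

(* Main.v *)
Require Import Defs.
From HB Require Import structures.
From mathcomp Require Import all_boot all_order all_algebra.
From mathcomp Require Import finmap multiset monalg.
From mathcomp Require Import boolp classical_sets cardinality fsbigop.
From mathcomp Require Import zify ring.

Set Implicit Arguments.
Unset Strict Implicit.
Unset Printing Implicit Defensive.

Import GRing.Theory.
Local Open Scope quotient_scope.
Local Open Scope ring_scope.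

(** Both isomorphisms are instances of one comparison. A is a graded
   cocommutative coalgebra with a homogeneous basis and a weight that is zero
   only on the unit; it is treated as a coalgebra braided by signs ([bcoalg]).
   Words in its basis are a basis of the cosimplicial vector space coTHH(A), and
   the normalized cochains are spanned by the words without the unit behind the
   first letter, the head. The coboundary of such a word is the reduced cobar
   differential of the tail, up to terms that split the head.

   Let K be the expected cohomology of the cobar complex: the exterior algebra
   on the z_i for divided powers, the polynomial algebra on the w_j for an
   exterior coalgebra. The primitive generators of A act on K by multiplication
   and the rest of the basis acts by zero ([koszul]). Letting the tail of a word
   act on the unit of K sends a word to an element of the tensor product of A
   and K ([head_eval]). This map kills coboundaries: the first and the last
   coface contribute the same terms with opposite signs, by graded
   cocommutativity ([head_eval_wdif]). It therefore defines a map from coHH(A)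
   to the tensor product of A and K.

   This map is bijective because the Koszul complex, the tensor product of A and
   K with the differential that moves a generator from A to K, contracts onto
   the unit: the contraction moves the smallest, or the largest, generator back
   from K to A ([move_contraction]). It follows, by induction on the weight,
   that a cobar cocycle that evaluates to zero in K is a coboundary
   ([cobar_acyclic]). Filtering the coHochschild complex by the weight of the
   head leaves only the cobar differential of the tail ([filtration_acyclic]),
   which gives injectivity ([head_eval_inj]) and surjectivity
   ([head_eval_surj]).

   The coproduct is computed on the diagonal of the tensor square of coTHH(A).
   Its basis consists of pairs of words of equal length, that is, of words of
   pairs of letters, so it is the coHochschild complex of the tensor square of A
   and is compared in the same way with the tensor square of K ([ktens],
   [diag_map_inj]). Under these comparisons the Alexander-Whitney map becomes
   the exchange of the two middle factors ([pair_eval_aw]): in all but one of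
   its terms, two letters other than the unit form a pair, and such a pair acts
   by zero. The coproduct of words becomes the coproduct of the tensor product
   of A and K ([head_eval_zip_comult]). Hence the Kunneth map is onto and the
   coproduct of coHH(A) is the expected one ([coHH_model]).

   What remains is to exhibit the two coalgebras with their models. Both are
   dual to algebras with a monomial basis ([twisted_monoid]): multisets of
   generators under addition, and finite sets of generators under disjoint
   union, with the sign that counts inversions. *)

(** * Linear maps given on a basis *)

Reserved Notation "\lin_ ( a <- x ) F"
  (at level 41, F at level 41, a name, x at level 50,
   format "'[' \lin_ ( a  <-  x ) '/  '  F ']'").

HB.lock Definition lin (k : fieldType) (T : choiceType) (V : lmodType k)
  (f : T -> V) (x : {malg k[T]}) : V := lext f x.

Notation "\lin_ ( a <- x ) F" := (lin (fun a => F) x) : ring_scope.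

Lemma lextE (k : fieldType) (T : choiceType) (V : lmodType k) :
  @lext k T V = @lin k T V.
Proof. by rewrite lin.unlock. Qed.

Lemma lin_is_linear (k : fieldType) (T : choiceType) (V : lmodType k)
  (f : T -> V) : linear (lin f).
Proof. by rewrite -lextE; apply: lext_is_linear. Qed.

HB.instance Definition _ (k : fieldType) (T : choiceType) (V : lmodType k)
    (f : T -> V) :=
  GRing.isLinear.Build k {malg k[T]} V *:%R (lin f) (lin_is_linear f).

Section LinearCalculus.
Variable k : fieldType.

Lemma mcoeff_basis (T : choiceType) (t u : T) :
  (<< t >> : {malg k[T]})@_u = (t == u)%:R.
Proof. exact: mcoeffU. Qed.

Lemma linE (T : choiceType) (V : lmodType k) (f : T -> V) (x : {malg k[T]}) :
  lin f x = \sum_(t <- msupp x) x@_t *: f t.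
Proof. by rewrite -lextE. Qed.

Section Generic.
Variables (T : choiceType) (V : lmodType k).
Implicit Types (f g : T -> V) (x y : {malg k[T]}) (P Q : pred T).

Lemma linU f t : lin f << t >> = f t.
Proof.
rewrite -lextE (@lextEw _ _ _ f _ [fset t]%fset) ?msuppU_le //.
by rewrite big_seq_fset1 mcoeffUU scale1r.
Qed.

Lemma linB f x y : lin f (x - y) = lin f x - lin f y.
Proof. exact: linearB. Qed.

Lemma linD f x y : lin f (x + y) = lin f x + lin f y.
Proof. exact: linearD. Qed.

Lemma linZ f a x : lin f (a *: x) = a *: lin f x.
Proof. exact: linearZ. Qed.

Lemma linN f x : lin f (- x) = - lin f x.
Proof. exact: linearN. Qed.

Lemma lin0 f : lin f 0 = 0.
Proof. exact: linear0. Qed.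

Lemma lin_sum f (I : Type) (r : seq I) (P : pred I) (F : I -> {malg k[T]}) :
  lin f (\sum_(i <- r | P i) F i) = \sum_(i <- r | P i) lin f (F i).
Proof. exact: linear_sum. Qed.

Lemma eq_in_lin f g x : {in msupp x, f =1 g} -> lin f x = lin g x.
Proof.
by move=> fg; rewrite !linE; apply: eq_big_seq => t tx; rewrite fg.
Qed.

Lemma eq_lin f g x : f =1 g -> lin f x = lin g x.
Proof. by move=> fg; apply: eq_in_lin => t _. Qed.

Lemma linDf f g x : \lin_(t <- x) (f t + g t) = lin f x + lin g x.
Proof.
by rewrite !linE -big_split /=; apply: eq_bigr => t _; rewrite scalerDr.
Qed.

Lemma linNf f x : \lin_(t <- x) (- f t) = - lin f x.
Proof. by rewrite !linE -sumrN; apply: eq_bigr => t _; rewrite scalerN. Qed.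

Lemma linBf f g x : \lin_(t <- x) (f t - g t) = lin f x - lin g x.
Proof. by rewrite linDf linNf. Qed.

Lemma linZf a f x : \lin_(t <- x) (a *: f t) = a *: lin f x.
Proof.
rewrite !linE scaler_sumr; apply: eq_bigr => t _.
by rewrite !scalerA mulrC.
Qed.

Lemma lin0f x : \lin_(t <- x) (0 : V) = 0.
Proof. by rewrite !linE big1 // => t _; rewrite scaler0. Qed.

Lemma lin_sumf (I : Type) (r : seq I) (P : pred I) (F : I -> T -> V) x :
  \lin_(t <- x) (\sum_(i <- r | P i) F i t) = \sum_(i <- r | P i) lin (F i) x.
Proof.
under [RHS]eq_bigr do rewrite linE.
rewrite linE exchange_big /=; apply: eq_bigr => t _; exact: scaler_sumr.
Qed.

Lemma lin_single f x (t0 : T) :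
  (forall t, t \in msupp x -> t != t0 -> f t = 0) -> lin f x = x@_t0 *: f t0.
Proof.
move=> f0; rewrite -lextE (@lextEw _ _ _ f _ (t0 |` msupp x)%fset); last first.
  by apply/fsubsetP => t tx; rewrite in_fsetE tx orbT.
rewrite (bigD1_seq t0) ?fset_uniq //= ?in_fsetE ?eqxx // big1 ?addr0 // => t nt.
have [tx|tx] := boolP (t \in msupp x); first by rewrite f0 ?scaler0.
by rewrite mcoeff_outdom // scale0r.
Qed.

Lemma linear_lin (W : lmodType k) (h : {linear V -> W}) f x :
  h (lin f x) = \lin_(t <- x) h (f t).
Proof. by rewrite !linE linear_sum; apply: eq_bigr => t _; rewrite linearZ. Qed.

Lemma eq_linear (V' : lmodType k) (h h' : {linear {malg k[T]} -> V'}) :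
  (forall t, h << t >> = h' << t >>) -> h =1 h'.
Proof.
move=> hh x; rewrite [x]monalgE !linear_sum; apply: eq_bigr => t _.
have -> : << x@_t *g t >> = x@_t *: << t >> :> {malg k[T]}.
  by apply/malgP => u; rewrite mcoeffZ !mcoeffU mulrnAr mulr1.
by rewrite !linearZ hh.
Qed.

End Generic.

Lemma lin_lin (S T : choiceType) (V : lmodType k) (f : T -> V)
    (g : S -> {malg k[T]}) x : lin f (lin g x) = \lin_(s <- x) lin f (g s).
Proof. exact: linear_lin. Qed.

Lemma lin_id (T : choiceType) (x : {malg k[T]}) : \lin_(t <- x) << t >> = x.
Proof. by apply: (@eq_linear _ _ (lin _) idfun) => t; rewrite /= linU. Qed.

Lemma exchange_lin (S T : choiceType) (V : lmodType k) (f : S -> T -> V)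
    (x : {malg k[S]}) (y : {malg k[T]}) :
  \lin_(s <- x) \lin_(t <- y) f s t = \lin_(t <- y) \lin_(s <- x) f s t.
Proof.
rewrite !linE; under eq_bigr do rewrite linE scaler_sumr.
under [RHS]eq_bigr do rewrite linE.
rewrite exchange_big /=; apply: eq_bigr => t _.
rewrite scaler_sumr; apply: eq_bigr => s _.
by rewrite !scalerA mulrC.
Qed.

Lemma mcoeff_lin (S T : choiceType) (f : S -> {malg k[T]}) x t :
  (lin f x)@_t = \sum_(s <- msupp x) x@_s * (f s)@_t.
Proof.
rewrite !linE raddf_sum /=; apply: eq_bigr => s _; exact: mcoeffZ.
Qed.

(** ** Supports *)

Definition supp_on (T : choiceType) (P : pred T) (x : {malg k[T]}) : bool :=
  all P (msupp x).

Section Supports.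
Variables (T : choiceType).
Implicit Types (x y : {malg k[T]}) (P Q : pred T).

Lemma supp_onP P x : reflect {in msupp x, forall t, P t} (supp_on P x).
Proof. exact: allP. Qed.

Lemma supp_on_coef P x : (forall t, x@_t != 0 -> P t) -> supp_on P x.
Proof. by move=> h; apply/allP => t; rewrite -mcoeff_neq0; apply: h. Qed.

Lemma coef_supp_on P x t : supp_on P x -> ~~ P t -> x@_t = 0.
Proof.
move=> /allP h nP; apply: mcoeff_outdom; apply/negP => /h; exact/negP.
Qed.

Lemma supp_on0 P : supp_on P 0.
Proof. by apply: supp_on_coef => t; rewrite mcoeff0 eqxx. Qed.

Lemma supp_onU P t : P t -> supp_on P << t >>.
Proof.
move=> Pt; apply: supp_on_coef => u; rewrite mcoeff_basis.
by case: (t =P u) => [<-//|_]; rewrite /= eqxx.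
Qed.

Lemma supp_onD P x y : supp_on P x -> supp_on P y -> supp_on P (x + y).
Proof.
move=> hx hy; apply: supp_on_coef => t; apply: contraNT => nP.
by rewrite mcoeffD (coef_supp_on hx nP) (coef_supp_on hy nP) addr0.
Qed.

Lemma supp_onZ P a x : supp_on P x -> supp_on P (a *: x).
Proof.
move=> hx; apply: supp_on_coef => t; apply: contraNT => nP.
by rewrite mcoeffZ (coef_supp_on hx nP) mulr0.
Qed.

Lemma supp_onN P x : supp_on P x -> supp_on P (- x).
Proof. by rewrite -scaleN1r; apply: supp_onZ. Qed.

Lemma supp_onB P x y : supp_on P x -> supp_on P y -> supp_on P (x - y).
Proof. by move=> hx hy; apply/supp_onD/supp_onN. Qed.

Lemma supp_on_sum P (I : Type) (r : seq I) (R : pred I) F :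
  (forall i, R i -> supp_on P (F i)) -> supp_on P (\sum_(i <- r | R i) F i).
Proof.
move=> h; elim/big_ind: _ => //; [exact: supp_on0 | exact: supp_onD].
Qed.

Lemma sub_supp_on P Q x : (forall t, P t -> Q t) -> supp_on P x -> supp_on Q x.
Proof. by move=> PQ /allP h; apply/allP => t /h /PQ. Qed.

Lemma eq_supp_on P Q x : P =1 Q -> supp_on P x = supp_on Q x.
Proof. by move=> e; rewrite /supp_on (eq_all e). Qed.

Lemma supp_onI P Q x : supp_on (predI P Q) x = supp_on P x && supp_on Q x.
Proof. exact: all_predI. Qed.

Lemma eq_lin_on (V : lmodType k) (f g : T -> V) P x :
  supp_on P x -> (forall t, P t -> f t = g t) -> lin f x = lin g x.
Proof. by move=> /allP h fg; apply: eq_in_lin => t /h /fg. Qed.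

End Supports.

Section SupportsExtension.
Variables (T : choiceType).
Implicit Types (x y : {malg k[T]}) (P Q : pred T).

Lemma supp_on_lin (S : choiceType) P (Q : pred S) (f : T -> {malg k[S]}) x :
  supp_on P x -> (forall t, P t -> supp_on Q (f t)) -> supp_on Q (lin f x).
Proof.
move=> /allP hx hf; rewrite !linE big_seq; apply: supp_on_sum => t tx.
by apply: supp_onZ; apply: hf; apply: hx.
Qed.

Lemma supp_on_lin_in (S : choiceType) (Q : pred S) (f : T -> {malg k[S]}) x :
  {in msupp x, forall t, supp_on Q (f t)} -> supp_on Q (lin f x).
Proof.
move=> hf; rewrite !linE big_seq; apply: supp_on_sum => t tx.
by apply: supp_onZ; apply: hf.
Qed.

Definition restrict P x : {malg k[T]} := \lin_(t <- x) (if P t then << t >> else 0).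

Lemma mcoeff_restrict P x t : (restrict P x)@_t = if P t then x@_t else 0.
Proof.
rewrite /restrict mcoeff_lin.
have e s : (if P s then << s >> else 0 : {malg k[T]})@_t
           = (if P t then (s == t)%:R else 0 : k).
  case: (boolP (P s)) => Ps; rewrite ?mcoeff_basis ?mcoeff0.
    by case: (s =P t) => [<-|]; [rewrite Ps | case: ifP].
  by case: (s =P t) => [<-|]; [rewrite (negPf Ps) | case: ifP].
under eq_bigr do rewrite e.
case: ifP => Pt; last by rewrite big1 // => s _; rewrite mulr0.
have [tx|tx] := boolP (t \in msupp x).
  rewrite (bigD1_seq t) ?fset_uniq //= eqxx mulr1 big1 ?addr0 // => s.
  by move=> /negPf->; rewrite mulr0.
rewrite mcoeff_outdom // big_seq big1 // => s sx.
by case: (s =P t) => [es|]; [rewrite -es sx in tx | rewrite mulr0].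
Qed.

Lemma supp_on_restrict P x : supp_on P (restrict P x).
Proof.
apply: supp_on_coef => t; rewrite mcoeff_restrict.
by case: ifP => //; rewrite eqxx.
Qed.

Lemma supp_on_restrict_of Q P x : supp_on Q x -> supp_on Q (restrict P x).
Proof.
move=> hx; apply: supp_on_lin hx _ => t Qt.
by case: ifP => _; [apply: supp_onU | apply: supp_on0].
Qed.

Lemma restrict_id P x : supp_on P x -> restrict P x = x.
Proof.
by move=> h; rewrite -[RHS]lin_id; apply: eq_lin_on h _ => t ->.
Qed.

End SupportsExtension.

(** ** Tensor products of chains *)

Section Mtens.
Variables (S T : choiceType).
Implicit Types (x : {malg k[S]}) (y : {malg k[T]}).

Lemma mtensE x y : mtens x y = \lin_(s <- x) \lin_(t <- y) << (s, t) >>.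
Proof. by rewrite /mtens !lextE. Qed.

Lemma mtensUU s t : mtens << s >> << t >> = << (s, t) >> :> {malg k[(S * T)%type]}.
Proof. by rewrite mtensE !linU. Qed.

Lemma lin_mtens (V : lmodType k) (f : S * T -> V) x y :
  lin f (mtens x y) = \lin_(s <- x) \lin_(t <- y) f (s, t).
Proof.
rewrite mtensE lin_lin; apply: eq_lin => s.
by rewrite lin_lin; apply: eq_lin => t; rewrite linU.
Qed.

Lemma mtensDl x x' y : mtens (x + x') y = mtens x y + mtens x' y.
Proof. by rewrite !mtensE linD. Qed.

Lemma mtensZl a x y : mtens (a *: x) y = a *: mtens x y.
Proof. by rewrite !mtensE linZ. Qed.

Lemma mtens0l y : mtens (0 : {malg k[S]}) y = 0.
Proof. by rewrite mtensE lin0. Qed.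

Lemma mtensC x y : mtens x y = \lin_(t <- y) \lin_(s <- x) << (s, t) >>.
Proof. by rewrite mtensE exchange_lin. Qed.

Lemma mtensDr x y y' : mtens x (y + y') = mtens x y + mtens x y'.
Proof. by rewrite !mtensC linD. Qed.

Lemma mtensZr a x y : mtens x (a *: y) = a *: mtens x y.
Proof. by rewrite !mtensC linZ. Qed.

Lemma mtens0r x : mtens x (0 : {malg k[T]}) = 0.
Proof. by rewrite mtensC lin0. Qed.

Lemma mtens_linl (R : choiceType) (f : R -> {malg k[S]}) z y :
  mtens (lin f z) y = \lin_(r <- z) mtens (f r) y.
Proof. by rewrite mtensE lin_lin; apply: eq_lin => r; rewrite mtensE. Qed.

Lemma mtens_linr (R : choiceType) (f : R -> {malg k[T]}) z x :
  mtens x (lin f z) = \lin_(r <- z) mtens x (f r).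
Proof. by rewrite mtensC lin_lin; apply: eq_lin => r; rewrite mtensC. Qed.

Lemma mtens_lin2 x y (f : S -> {malg k[S]})
    (g : T -> {malg k[T]}) :
  mtens (lin f x) (lin g y)
  = \lin_(p <- mtens x y) mtens (f p.1) (g p.2).
Proof.
rewrite lin_mtens mtens_linl; apply: eq_lin => s /=.
by rewrite mtens_linr.
Qed.

Lemma supp_on_mtens (P : pred S) (Q : pred T) x y :
  supp_on P x -> supp_on Q y -> supp_on (fun p => P p.1 && Q p.2) (mtens x y).
Proof.
move=> hx hy; rewrite mtensE; apply: supp_on_lin hx _ => s Ps; apply: supp_on_lin hy _ => t Qt.
by apply: supp_onU; rewrite /= Ps.
Qed.

End Mtens.

Lemma mcoeff_linM (S T : choiceType) (f : S -> {malg k[T]}) x t s0 :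
  (forall s, s \in msupp x -> s != s0 -> (f s)@_t = 0) ->
  (lin f x)@_t = x@_s0 * (f s0)@_t.
Proof.
move=> h; rewrite mcoeff_lin.
have -> : \sum_(s <- msupp x) x@_s * (f s)@_t
        = lin (fun s => (f s)@_t : k^o) x by rewrite linE.
by rewrite (@lin_single _ _ _ _ s0).
Qed.

End LinearCalculus.

(** * Braided cocommutative coalgebras with a basis *)

(** The sign of the symmetry is a function bsgn of two basis elements, not of
   their degrees, so that the tensor square of such a coalgebra is again one.
   The weight detects the unit, and the inductions run over it. *)
Record bcoalg (k : fieldType) := BCoalg {
  bbas :> choiceType;
  bone : bbas;
  bcomul : bbas -> {malg k[(bbas * bbas)%type]};
  bsgn : bbas -> bbas -> k;
  bwt : bbas -> nat;
  bcoassoc : forall b,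
    \lin_(a <- bcomul b) \lin_(c <- bcomul a.1) << (c.1, (c.2, a.2)) >>
    = \lin_(a <- bcomul b) \lin_(c <- bcomul a.2) << (a.1, (c.1, c.2)) >>
      :> {malg k[(bbas * (bbas * bbas))%type]};
  bcounitl : forall b,
    \lin_(a <- bcomul b) (if a.1 == bone then << a.2 >> else 0)
    = << b >> :> {malg k[bbas]};
  bcounitr : forall b,
    \lin_(a <- bcomul b) (if a.2 == bone then << a.1 >> else 0)
    = << b >> :> {malg k[bbas]};
  bwtD : forall b a, a \in msupp (bcomul b) -> (bwt a.1 + bwt a.2 = bwt b)%N;
  bwt_eq0 : forall b, (bwt b == 0%N) = (b == bone);
  bsgnC : forall b c, bsgn b c = bsgn c b;
  bsgnDl : forall b c a, a \in msupp (bcomul b) ->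
    bsgn b c = bsgn a.1 c * bsgn a.2 c;
  bsgnK : forall b c, bsgn b c * bsgn b c = 1;
  bsgn1l : forall b, bsgn bone b = 1;
  bcocomm : forall b,
    \lin_(a <- bcomul b) bsgn a.1 a.2 *: << (a.2, a.1) >> = bcomul b }.

Arguments bone {k _}.
Arguments bcomul {k _}.
Arguments bsgn {k _}.
Arguments bwt {k _}.

Section Sweedler.
Variables (k : fieldType) (A : bcoalg k) (V : lmodType k).
Implicit Types b c : A.

Lemma coassocE (G : A -> A -> A -> V) b :
  \lin_(a <- bcomul b) \lin_(c <- bcomul a.1) G c.1 c.2 a.2
  = \lin_(a <- bcomul b) \lin_(c <- bcomul a.2) G a.1 c.1 c.2.
Proof.
pose F (x : A * (A * A)) := G x.1 x.2.1 x.2.2.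
transitivity (lin F (\lin_(a <- bcomul b) \lin_(c <- bcomul a.1)
   << (c.1, (c.2, a.2)) >>)).
  rewrite lin_lin; apply: eq_lin => a; rewrite lin_lin; apply: eq_lin => c.
  by rewrite linU.
rewrite bcoassoc lin_lin; apply: eq_lin => a; rewrite lin_lin.
by apply: eq_lin => c; rewrite linU.
Qed.

Lemma counitlE (G : A -> V) b :
  \lin_(a <- bcomul b) (if a.1 == bone then G a.2 else 0) = G b.
Proof.
rewrite -[RHS]linU -bcounitl lin_lin; apply: eq_lin => a.
by case: ifP; rewrite ?linU ?lin0.
Qed.

Lemma counitrE (G : A -> V) b :
  \lin_(a <- bcomul b) (if a.2 == bone then G a.1 else 0) = G b.
Proof.
rewrite -[RHS]linU -bcounitr lin_lin; apply: eq_lin => a.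
by case: ifP; rewrite ?linU ?lin0.
Qed.

Lemma cocommE (G : A -> A -> V) b :
  \lin_(a <- bcomul b) G a.1 a.2 = \lin_(a <- bcomul b) bsgn a.1 a.2 *: G a.2 a.1.
Proof.
rewrite -{1}bcocomm lin_lin; apply: eq_lin => a.
by rewrite linZ linU.
Qed.

End Sweedler.

Section BraidedTheory.
Variables (k : fieldType) (A : bcoalg k).
Implicit Types b c : A.

Lemma bwt1 : bwt (bone : A) = 0%N.
Proof. by apply/eqP; rewrite bwt_eq0. Qed.

Lemma bwt_gt0 b : (0 < bwt b)%N = (b != bone).
Proof. by rewrite lt0n bwt_eq0. Qed.

Lemma bsgn1r b : bsgn b bone = 1.
Proof. by rewrite bsgnC bsgn1l. Qed.

Lemma bsgnDr b c (a : A * A) : a \in msupp (bcomul b) ->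
  bsgn c b = bsgn c a.1 * bsgn c a.2.
Proof. by move=> h; rewrite !(bsgnC c) (bsgnDl c h). Qed.

Lemma comul_eq1 b a : a \in msupp (bcomul b) ->
  (b == bone) = (a.1 == bone) && (a.2 == bone).
Proof. by move=> /bwtD h; rewrite -!bwt_eq0 -h addn_eq0. Qed.

Lemma comul1 : bcomul (bone : A) = << (bone, bone) >>.
Proof.
rewrite -{1}[bcomul bone]lin_id.
transitivity (\lin_(a <- bcomul (bone : A))
   (if a.1 == bone then << (bone, a.2) >> else 0 : {malg k[(A * A)%type]})).
  apply: eq_in_lin => a /comul_eq1; rewrite eqxx => /esym/andP[/eqP e _].
  by rewrite e eqxx; case: a e => a1 a2 /= ->.
exact: (@counitlE _ _ _ (fun x => << (bone, x) >>)).
Qed.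

End BraidedTheory.

(** * Words: the cyclic cobar construction *)

Section Words.
Variables (k : fieldType) (A : bcoalg k).
Implicit Types (b c : A) (u v w : seq A).

Local Notation chain := {malg k[seq A]}.

Definition wsgn b w : k := \prod_(c <- w) bsgn b c.

Lemma wsgn_cons b c w : wsgn b (c :: w) = bsgn b c * wsgn b w.
Proof. exact: big_cons. Qed.

Lemma wsgn_rcons b w c : wsgn b (rcons w c) = wsgn b w * bsgn b c.
Proof. by rewrite /wsgn -cats1 big_cat big_seq1. Qed.

Lemma wsgn1 w : wsgn bone w = 1.
Proof. by rewrite /wsgn big1 // => c _; rewrite bsgn1l. Qed.

Lemma wsgnD b w a : a \in msupp (bcomul b) ->
  wsgn b w = wsgn a.1 w * wsgn a.2 w.
Proof.
move=> h; rewrite /wsgn -big_split /=; apply: eq_bigr => c _.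
exact: bsgnDl.
Qed.

Definition cons_chain b (x : chain) : chain := \lin_(u <- x) << b :: u >>.

Fixpoint inner_coface i w : chain :=
  if w is b :: r then
    if i is j.+1 then cons_chain b (inner_coface j r)
    else \lin_(a <- bcomul b) << [:: a.1, a.2 & r] >>
  else 0.

Arguments inner_coface _ !_ : simpl nomatch.

Definition outer_coface w : chain :=
  if w is b :: r then
    \lin_(a <- bcomul b) wsgn a.1 (a.2 :: r) *: << rcons (a.2 :: r) a.1 >>
  else 0.

Definition wcoface i w : chain :=
  if (i < size w)%N then inner_coface i w else outer_coface w.

Lemma cons_chain_lin (S : choiceType) b (f : S -> chain) x :
  cons_chain b (lin f x) = \lin_(s <- x) cons_chain b (f s).
Proof. exact: lin_lin. Qed.

Lemma lin_cons_chain (V : lmodType k) (f : seq A -> V) b x :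
  lin f (cons_chain b x) = \lin_(u <- x) f (b :: u).
Proof. by rewrite lin_lin; apply: eq_lin => u; rewrite linU. Qed.

Lemma cons_chainU b u : cons_chain b << u >> = << b :: u >>.
Proof. exact: linU. Qed.

Lemma inner_inner i j w : (i < j)%N ->
  lin (inner_coface j) (inner_coface i w)
  = lin (inner_coface i) (inner_coface j.-1 w).
Proof.
elim: w i j => [|b r IH] [|i] [|[|j]] //= ij; rewrite ?lin0 //.
- rewrite !lin_lin; under eq_lin do rewrite linU /=.
  under [RHS]eq_lin do rewrite linU /=.
  under eq_lin do rewrite cons_chain_lin.
  under eq_lin do under eq_lin do rewrite cons_chainU.
  by rewrite (coassocE (fun x y z => << [:: x, y, z & r] >>)).
- rewrite lin_lin lin_cons_chain /= exchange_lin; apply: eq_lin => a.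
  rewrite linU /= /cons_chain lin_lin; apply: eq_lin => u.
  by rewrite linU.
- rewrite !lin_cons_chain /=.
  by rewrite -cons_chain_lin IH // cons_chain_lin.
Qed.

Lemma inner_coface_rcons i w b : (i < size w)%N ->
  inner_coface i (rcons w b) = \lin_(u <- inner_coface i w) << rcons u b >>.
Proof.
elim: w i => [|c r IH] [|i] //= ir.
  by rewrite lin_lin; apply: eq_lin => a; rewrite linU.
rewrite IH // lin_cons_chain cons_chain_lin; apply: eq_lin => u.
by rewrite cons_chainU.
Qed.

Lemma inner_coface_last w b :
  inner_coface (size w) (rcons w b)
  = \lin_(a <- bcomul b) << rcons (rcons w a.1) a.2 >>.
Proof.
elim: w => [|c r IH] //=; rewrite IH cons_chain_lin; apply: eq_lin => a.
by rewrite cons_chainU.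
Qed.

Lemma inner_coface_sgn b i w u : u \in msupp (inner_coface i w) ->
  wsgn b u = wsgn b w.
Proof.
have : supp_on (fun u => wsgn b u == wsgn b w) (inner_coface i w).
  elim: w i => [|c r IH] [|i] /=; rewrite ?supp_on0 //.
    apply: supp_on_lin_in => a ha; apply: supp_onU.
    by rewrite !wsgn_cons mulrA (bsgnDr b ha).
  by apply: supp_on_lin (IH i) _ => v /eqP e; apply: supp_onU; rewrite !wsgn_cons e.
by move=> /supp_onP h /h /eqP.
Qed.

Lemma outer_inner i w : (i < size w)%N ->
  lin outer_coface (inner_coface i w) = lin (inner_coface i) (outer_coface w).
Proof.
case: w i => [|b r] [|i] //= ir; rewrite ?lin0 //.
  rewrite !lin_lin; under eq_lin do rewrite linU /=.
  rewrite (coassocE (fun x y z => wsgn x [:: y, z & r] *: << rcons [:: y, z & r] x >>)).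
  apply: eq_lin => a; rewrite linZ linU /= -linZf; apply: eq_in_lin => c hc.
  by rewrite !wsgn_cons (bsgnDr a.1 hc) mulrA.
rewrite lin_cons_chain lin_lin /= exchange_lin; apply: eq_lin => a.
rewrite linZ linU /= inner_coface_rcons // cons_chain_lin -linZf.
apply: eq_in_lin => u hu.
by rewrite wsgn_cons (inner_coface_sgn _ hu) cons_chainU wsgn_cons.
Qed.

Lemma outer_outer w :
  lin outer_coface (outer_coface w)
  = lin (inner_coface (size w)) (outer_coface w).
Proof.
case: w => [|b r]; rewrite ?lin0 // [outer_coface _]/= !lin_lin.
transitivity (\lin_(a <- bcomul b) \lin_(c <- bcomul a.1)
    (bsgn c.1 a.2 * bsgn c.2 a.2 * wsgn c.1 r * wsgn c.2 r)
      *: << rcons (rcons (a.2 :: r) c.1) c.2 >> : chain).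
  rewrite (coassocE (fun x y z => (bsgn x z * bsgn y z * wsgn x r * wsgn y r)
      *: << rcons (rcons (z :: r) x) y >>)); apply: eq_lin => a.
  rewrite linZ linU /= -linZf; apply: eq_in_lin => c hc.
  rewrite scalerA !wsgn_cons wsgn_rcons (bsgnDr a.1 hc) (bsgnC c.1 a.1).
  congr (_ *: _); set p := bsgn a.1 c.1.
  have pp : p * p = 1 by apply: bsgnK.
  by rewrite -[RHS]mulr1 -pp; ring.
apply: eq_lin => a; rewrite linZ linU.
rewrite (_ : size (b :: r) = size (a.2 :: r)) // inner_coface_last -linZf.
apply: eq_in_lin => c hc.
rewrite wsgn_cons (bsgnDl _ hc) (wsgnD _ hc); congr (_ *: _); ring.
Qed.

Definition has_size n w := size w == n.

Lemma inner_coface_size i w :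
  supp_on (has_size (size w).+1) (inner_coface i w).
Proof.
elim: w i => [|c r IH] [|i] /=; rewrite ?supp_on0 //.
  by apply: supp_on_lin_in => a ha; apply: supp_onU; rewrite /has_size /=.
by apply: supp_on_lin (IH i) _ => v /eqP e; apply: supp_onU; rewrite /has_size /= e.
Qed.

Lemma outer_coface_size w : supp_on (has_size (size w).+1) (outer_coface w).
Proof.
case: w => [|b r]; rewrite ?supp_on0 //; apply: supp_on_lin_in => a ha.
by apply/supp_onZ/supp_onU; rewrite /has_size size_rcons.
Qed.

Lemma wcoface_size i w : supp_on (has_size (size w).+1) (wcoface i w).
Proof.
by rewrite /wcoface; case: ifP => _; [apply: inner_coface_size|apply: outer_coface_size].
Qed.

Lemma wcoface_wcoface i j w : (i < j)%N -> (j <= (size w).+1)%N ->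
  lin (wcoface j) (wcoface i w) = lin (wcoface i) (wcoface j.-1 w).
Proof.
move=> ij jw.
have wE m n : lin (wcoface m) (wcoface n w) =
    lin (if (m < (size w).+1)%N then inner_coface m else outer_coface) (wcoface n w).
  apply: eq_lin_on (wcoface_size n w) _ => u /eqP eu.
  by rewrite /wcoface eu; case: ifP.
rewrite !wE {wE}; move: jw; rewrite leq_eqVlt ltnS => /orP[/eqP ej|jw]; last first.
  have iw : (i < size w)%N := leq_trans ij jw.
  have j1w : (j.-1 < size w)%N by case: j ij jw.
  rewrite /wcoface !ltnS jw (ltnW iw) iw j1w; exact: inner_inner.
rewrite ej ltnn -ej ij /wcoface ej /= ltnn.
move: ij; rewrite ej ltnS leq_eqVlt => /orP[/eqP->|iw].
  by rewrite ltnn outer_outer.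
by rewrite iw outer_inner.
Qed.

Definition wdif w : chain := \sum_(i < (size w).+1) (-1) ^+ i *: wcoface i w.

Lemma wdif_size w : supp_on (has_size (size w).+1) (wdif w).
Proof. by apply: supp_on_sum => i _; apply/supp_onZ/wcoface_size. Qed.

End Words.

Lemma altsum_square (R : pzRingType) (V : lmodType R) n (F : nat -> nat -> V) :
  (forall i j, (i < j)%N -> (j <= n.+1)%N -> F j i = F i j.-1) ->
  \sum_(i < n.+1) \sum_(j < n.+2) (-1) ^+ i *: ((-1) ^+ j *: F j i) = 0.
Proof.
move=> hF; pose G i j := (-1) ^+ i *: ((-1) ^+ j *: F i j).
have swap i j : (-1) ^+ i *: ((-1) ^+ j *: F j i) = G j i.
  by rewrite /G !scalerA -!exprD addnC.
transitivity (\sum_(i < n.+1) (\sum_(j < n.+1 | (j <= i)%N) G j i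
              - \sum_(j < n.+1 | (i <= j)%N) G i j)).
  apply: eq_bigr => i _; rewrite (bigID (fun j : 'I__ => (j <= i)%N)) /=.
  congr (_ + _).
    rewrite big_mkcond big_ord_recr /= leqNgt ltnS -ltnS ltn_ord addr0.
    by rewrite -big_mkcond; apply: eq_bigr => j _; rewrite swap.
  rewrite big_mkcond big_ord_recl /= add0r -big_mkcond -sumrN /=.
  apply: eq_big => [j|j]; rewrite -?ltnNge /bump //= add1n => ij.
  have -> : F j.+1 i = F i j by apply: hF => //; exact: ltn_ord.
  by rewrite exprS mulN1r scaleNr scalerN.
rewrite sumrB; apply/eqP; rewrite subr_eq0; apply/eqP.
by rewrite (exchange_big_dep xpredT).
Qed.

Section WordDifferential.
Variables (k : fieldType) (A : bcoalg k).
Implicit Types (b c : A) (u v w : seq A) (x : {malg k[seq A]}).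

Lemma wdif_wdif w : lin (@wdif k A) (wdif w) = 0.
Proof.
rewrite {2}/wdif lin_sum.
transitivity (\sum_(i < (size w).+1) \sum_(j < (size w).+2)
  (-1) ^+ i *: ((-1) ^+ j *: lin (wcoface j) (wcoface i w))).
  apply: eq_bigr => i _; rewrite linZ -scaler_sumr; congr (_ *: _).
  transitivity (\lin_(u <- wcoface i w) \sum_(j < (size w).+2) (-1) ^+ j *: wcoface j u).
    by apply: eq_lin_on (wcoface_size i w) _ => u /eqP <-.
  by rewrite lin_sumf; apply: eq_bigr => j _; rewrite linZf.
apply: (@altsum_square _ _ (size w) (fun j i => lin (wcoface j) (wcoface i w))).
by move=> i j ij jw; apply: wcoface_wcoface.
Qed.

End WordDifferential.

(** * The reduced cobar differential *)

Section Cobar.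
Variables (k : fieldType) (A : bcoalg k).
Implicit Types (b c : A) (u v w : seq A).

Local Notation chain := {malg k[seq A]}.

Definition nonunit b := b != bone.

Definition normal_word w := if w is c :: v then all nonunit v else false.

Definition reduced (V : nmodType) (G : A -> A -> V) (a : A * A) : V :=
  if (a.1 == bone) || (a.2 == bone) then 0 else G a.1 a.2.

Fixpoint cobar w : chain :=
  if w is b :: r then
    \lin_(a <- bcomul b) reduced (fun x y => << [:: x, y & r] >>) a
    - cons_chain b (cobar r)
  else 0.

Arguments cobar !_ : simpl nomatch.

(** Coassociativity restricted to the triples without the unit: a factor that is
   the unit only has the unit as its parts, so iterating the reduced coproduct
   leaves out exactly the triples that contain the unit. *)
Lemma reduced_coassoc (V : lmodType k) (G : A -> A -> A -> V) b :
  \lin_(a <- bcomul b) reduced (fun x z =>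
     \lin_(c <- bcomul x) reduced (fun x y => G x y z) c) a
  = \lin_(a <- bcomul b) reduced (fun x z =>
     \lin_(c <- bcomul z) reduced (fun y z => G x y z) c) a.
Proof.
pose G' x y z : V :=
  if [|| x == bone, y == bone | z == bone] then 0 else G x y z.
transitivity (\lin_(a <- bcomul b) \lin_(c <- bcomul a.1) G' c.1 c.2 a.2).
  apply: eq_lin => -[x z]; rewrite /reduced /G' /=.
  case: (altP (x =P bone)) => [->|x1] /=; first by rewrite comul1 linU /= eqxx.
  case: (altP (z =P bone)) => [->|z1] /=.
    by under eq_lin do rewrite !orbT; rewrite lin0f.
  by apply: eq_lin => c; rewrite orbF.
rewrite coassocE; apply: eq_lin => -[x z]; rewrite /reduced /G' /=.
case: (altP (x =P bone)) => [->|x1] /=; first by rewrite lin0f.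
by case: (altP (z =P bone)) => [->|z1] //=; rewrite comul1 linU /= eqxx.
Qed.

Lemma lin_reduced (V W : lmodType k) (G : A -> A -> V) (h : {linear V -> W})
    (x : {malg k[(A * A)%type]}) :
  h (\lin_(a <- x) reduced G a) = \lin_(a <- x) reduced (fun b c => h (G b c)) a.
Proof.
rewrite linear_lin; apply: eq_lin => a; rewrite /reduced.
by case: ifP; rewrite ?linear0.
Qed.

Lemma reducedB (V : zmodType) (F G : A -> A -> V) a :
  reduced (fun x y => F x y - G x y) a = reduced F a - reduced G a.
Proof. by rewrite /reduced; case: ifP; rewrite ?subr0. Qed.

Lemma cobar_cobar w : lin cobar (cobar w) = 0.
Proof.
elim: w => [|b r IH] /=; rewrite ?lin0 // linB lin_cons_chain lin_reduced /=.
under [X in _ - X]eq_lin do rewrite /=.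
rewrite linBf -cons_chain_lin IH /cons_chain lin0 subr0.
apply/eqP; rewrite subr_eq0; apply/eqP.
have -> : \lin_(u <- cobar r) \lin_(a <- bcomul b)
            reduced (fun x y => << [:: x, y & u] >> : chain) a
  = \lin_(a <- bcomul b) reduced (fun x y => cons_chain x (cons_chain y (cobar r))) a.
  rewrite exchange_lin; apply: eq_lin => a; rewrite /reduced.
  case: ifP => _; rewrite ?lin0f // /cons_chain lin_lin; apply: eq_lin => u.
  by rewrite linU.
transitivity (\lin_(a <- bcomul b) (
   reduced (fun x z => \lin_(c <- bcomul x) reduced (fun x y => << [:: x, y, z & r] >> : chain) c) a
   - reduced (fun x z => \lin_(c <- bcomul z) reduced (fun y z => << [:: x, y, z & r] >> : chain) c) a
   + reduced (fun x y => cons_chain x (cons_chain y (cobar r))) a)).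
  apply: eq_lin => a; rewrite -reducedB /reduced; case: ifP => _; first by rewrite addr0.
  rewrite linU /= /cons_chain linB lin_reduced opprB addrA addrAC.
  congr (_ - _ + _); apply: eq_lin => c; rewrite /reduced; case: ifP => //= _.
  by rewrite linU.
by rewrite linDf linBf (reduced_coassoc (fun x y z => << [:: x, y, z & r] >>)) subrr add0r.
Qed.

Lemma comul_split (V : lmodType k) (G : A -> A -> V) b :
  \lin_(a <- bcomul b) G a.1 a.2
  = \lin_(a <- bcomul b) (if a.2 == bone then 0 else G a.1 a.2) + G b bone.
Proof.
rewrite -[G b bone](@counitrE _ _ _ (fun x => G x bone)) -linDf.
apply: eq_lin => a; case: ifP => [/eqP->|_]; by rewrite ?add0r ?addr0.
Qed.

Lemma comul_splitl (V : lmodType k) (G : A -> A -> V) b :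
  \lin_(a <- bcomul b) G a.1 a.2
  = \lin_(a <- bcomul b) (if a.1 == bone then 0 else G a.1 a.2) + G bone b.
Proof.
rewrite -[G bone b](@counitlE _ _ _ (fun x => G bone x)) -linDf.
apply: eq_lin => a; case: ifP => [/eqP->|_]; by rewrite ?add0r ?addr0.
Qed.

Lemma comul_reduced (V : lmodType k) (G : A -> A -> V) b : nonunit b ->
  \lin_(a <- bcomul b) G a.1 a.2
  = \lin_(a <- bcomul b) reduced G a + G bone b + G b bone.
Proof.
move=> nb; rewrite comul_split; congr (_ + _).
rewrite -[G bone b](@counitlE _ _ _ (fun x => G bone x)) -linDf.
apply: eq_in_lin => a /comul_eq1; rewrite (negPf nb) /reduced.
by case: eqP => [->|_]; case: eqP => [->|_] //=; rewrite ?addr0 ?add0r.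
Qed.

Definition inner_dif w : chain := \sum_(i < size w) (-1) ^+ i *: inner_coface i w.

Lemma inner_dif_cons b r :
  inner_dif (b :: r)
  = \lin_(a <- bcomul b) << [:: a.1, a.2 & r] >> - cons_chain b (inner_dif r).
Proof.
rewrite /inner_dif big_ord_recl expr0 scale1r /=; congr (_ + _).
rewrite /cons_chain linear_sum /= -sumrN; apply: eq_bigr => i _.
by rewrite linZ exprS mulN1r scaleNr.
Qed.

(** Splitting a unit off a letter gives the same word, with opposite signs, as
   splitting it off the neighbouring letter; only the units added at the two
   ends of the word survive. *)
Lemma inner_dif_nonunit w : all nonunit w ->
  inner_dif w = cobar w + << bone :: w >> - (-1) ^+ size w *: << rcons w bone >>.
Proof.
elim: w => [|b r IH] /=.
  by rewrite /inner_dif big_ord0 add0r expr0 scale1r subrr.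
case/andP=> nb /IH e; rewrite inner_dif_cons e /cons_chain.
rewrite (comul_reduced (fun x y => << [:: x, y & r] >>) nb) linB linD linZ !linU.
rewrite exprS; move: (lin _ _) (lin _ _) => X Y.
move: << _ >> << _ >> << _ >> ((-1) ^+ _) => P Q R s; apply/malgP => t.
rewrite !(mcoeffD, mcoeffN, mcoeffZ); ring.
Qed.

Lemma wdif_inner w : wdif w = inner_dif w + (-1) ^+ size w *: outer_coface w.
Proof.
rewrite /wdif big_ord_recr [wcoface _ _]/wcoface ltnn.
rewrite (eq_bigr (fun i : 'I__ => (-1) ^+ i *: inner_coface i w)) => [|i _].
  by [].
by rewrite /wcoface /= ltn_ord.
Qed.

(** The words with a unit in the tail cancel: those with the unit at the end
   against the outer coface, those with the unit after the head against the
   first coface. *)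
Lemma wdif_normal c v : all nonunit v ->
  wdif (c :: v)
  = \lin_(a <- bcomul c) (if a.2 == bone then 0 else << [:: a.1, a.2 & v] >>)
    - cons_chain c (cobar v)
    - (-1) ^+ size v *: \lin_(a <- bcomul c)
        (if a.1 == bone then 0
         else wsgn a.1 (a.2 :: v) *: << rcons (a.2 :: v) a.1 >>).
Proof.
move=> nv; rewrite wdif_inner inner_dif_cons (inner_dif_nonunit nv).
rewrite (comul_split (fun x y => << [:: x, y & v] >>)) /=.
rewrite (comul_splitl (fun x y => wsgn x (y :: v) *: << rcons (y :: v) x >>)).
rewrite wsgn1 scale1r /cons_chain linB linD linZ !linU exprS rcons_cons.
move: (lin _ _) (lin _ _) (lin _ _) => X Y Z.
move: << _ >> << _ >> ((-1) ^+ _) => P Q s; apply/malgP => t.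
rewrite !(mcoeffD, mcoeffN, mcoeffZ); ring.
Qed.

End Cobar.

Arguments nonunit {k A} _.

(** * Koszul models *)

Section KoszulDifferential.
Variables (k : fieldType) (A : bcoalg k) (L : choiceType).
Variable act : A -> L -> {malg k[L]}.

Definition koszul_dif (x : A * L) : {malg k[(A * L)%type]} :=
  \lin_(a <- bcomul x.1) \lin_(l <- act a.2 x.2) << (a.1, l) >>.

End KoszulDifferential.

(** A basis of the expected cohomology of the cobar complex of A: the letters
   act on it as multiplications, so only those of weight one act, they
   anticommute up to the sign of the braiding, and they satisfy the quadratic relations dual to the coproduct.
   These relations make koszul_dif a differential on the tensor product with A,
   and khtp contracts it onto the unit. *)
Record koszul (k : fieldType) (A : bcoalg k) := Koszul {
  kbas :> choiceType;
  kone : kbas;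
  klen : kbas -> nat;
  kact : A -> kbas -> {malg k[kbas]};
  khtp : A * kbas -> {malg k[(A * kbas)%type]};
  klen1 : klen kone = 0%N;
  kact_wt : forall b l, bwt b != 1%N -> kact b l = 0;
  kact_len : forall b l m, m \in msupp (kact b l) -> klen m = (klen l).+1;
  kactC : forall b c l,
    lin (kact b) (kact c l) = - bsgn b c *: lin (kact c) (kact b l);
  kact_quad : forall b l, \lin_(a <- bcomul b) lin (kact a.1) (kact a.2 l) = 0;
  khtp_supp : forall x y, y \in msupp (khtp x) ->
    bwt y.1 = (bwt x.1).+1 /\ klen x.2 = (klen y.2).+1;
  khtpP : forall x, x != (bone, kone) ->
    lin (koszul_dif kact) (khtp x) + lin khtp (koszul_dif kact x) = << x >> }.

Arguments kone {k A _}.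
Arguments klen {k A _}.
Arguments kact {k A _}.
Arguments khtp {k A _}.

Section KoszulTheory.
Variables (k : fieldType) (A : bcoalg k) (K : koszul A).
Implicit Types (b c : A) (u v w : seq A) (l m : K).

Local Notation chain := {malg k[seq A]}.
Local Notation kdif := (koszul_dif (@kact k A K)).

Fixpoint eval w : {malg k[K]} :=
  if w is b :: r then lin (kact b) (eval r) else << kone >>.

Definition pair_with b (y : {malg k[K]}) : {malg k[(A * K)%type]} :=
  \lin_(l <- y) << (b, l) >>.

Definition head_eval w : {malg k[(A * K)%type]} :=
  if w is c :: v then pair_with c (eval v) else 0.

Definition wwt w := (\sum_(b <- w) bwt b)%N.

Lemma wwt_cons b w : wwt (b :: w) = (bwt b + wwt w)%N.
Proof. exact: big_cons. Qed.

Lemma wwt_rcons w b : wwt (rcons w b) = (wwt w + bwt b)%N.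
Proof. by rewrite /wwt -cats1 big_cat big_seq1. Qed.

Lemma kact1 l : kact bone l = 0.
Proof. by rewrite kact_wt ?bwt1. Qed.

Lemma eval_supp w l : l \in msupp (eval w) -> klen l = size w /\ wwt w = size w.
Proof.
have : supp_on (fun l => (klen l == size w) && (wwt w == size w)) (eval w).
  elim: w => [|b r IH] /=; first by apply: supp_onU; rewrite klen1 /wwt big_nil.
  apply: supp_on_lin IH _ => m /andP[/eqP em /eqP er].
  have [wb|wb] := eqVneq (bwt b) 1%N; last by rewrite kact_wt // supp_on0.
  apply/supp_onP => n /kact_len ->.
  by rewrite wwt_cons em er wb add1n !eqxx.
by move=> /supp_onP h /h /andP[/eqP -> /eqP ->].
Qed.

Lemma eval_quad b r :
  \lin_(a <- bcomul b) reduced (fun x y => eval [:: x, y & r]) a = 0.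
Proof.
transitivity (\lin_(a <- bcomul b) lin (fun l => lin (kact a.1) (kact a.2 l)) (eval r)).
  apply: eq_lin => -[x y]; rewrite /reduced /=.
  case: (altP (x =P bone)) => [->|_] /=.
    under eq_lin do under eq_lin do rewrite kact1.
    by under eq_lin do rewrite lin0f; rewrite lin0f.
  case: (altP (y =P bone)) => [->|_] /=; last by rewrite lin_lin.
  by under eq_lin do rewrite kact1 lin0; rewrite lin0f.
rewrite exchange_lin; under eq_lin do rewrite kact_quad.
by rewrite lin0f.
Qed.

(** The cobar differential replaces a letter by the products of the parts of its
   coproduct, which act as zero by the quadratic relations. *)
Lemma eval_cobar w : lin eval (cobar w) = 0.
Proof.
elim: w => [|b r IH]; first by rewrite /= lin0.
rewrite /= linB lin_cons_chain lin_reduced /=.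
have -> : \lin_(a <- bcomul b)
   reduced (fun x y => lin_body__canonical__GRing_Linear eval << [:: x, y & r] >>) a
   = \lin_(a <- bcomul b) reduced (fun x y => eval [:: x, y & r]) a.
  by apply: eq_lin => a; rewrite /reduced /= linU.
by rewrite eval_quad sub0r -lin_lin IH lin0 oppr0.
Qed.

(** Anticommutation moves the last letter to the front, past each of the others. *)
Lemma eval_rcons v b :
  eval (rcons v b) = ((-1) ^+ size v * wsgn b v) *: eval (b :: v).
Proof.
elim: v => [|c v IH]; first by rewrite /= /wsgn big_nil expr0 mulr1 scale1r.
rewrite rcons_cons [LHS]/= IH linZ [eval (b :: v)]/= lin_lin.
under eq_lin do rewrite kactC.
rewrite linZf scalerA wsgn_cons /= lin_lin exprS (bsgnC c b).
by congr (_ *: _); ring.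
Qed.

Lemma pair_with_lin (S : choiceType) b (f : S -> {malg k[K]}) x :
  pair_with b (lin f x) = \lin_(s <- x) pair_with b (f s).
Proof. exact: lin_lin. Qed.

Lemma lin_pair_with (V : lmodType k) (f : A * K -> V) b y :
  lin f (pair_with b y) = \lin_(l <- y) f (b, l).
Proof. by rewrite lin_lin; apply: eq_lin => l; rewrite linU. Qed.

Definition component b (x : A * K) : {malg k[K]} :=
  if x.1 == b then << x.2 >> else 0.

Lemma component_pair b c y : lin (component b) (pair_with c y)
  = if c == b then y else 0.
Proof.
rewrite lin_pair_with /component /=; case: ifP => _; last by rewrite lin0f.
exact: lin_id.
Qed.

Lemma lin_head_cons c (x : chain) :
  lin head_eval (cons_chain c x) = pair_with c (lin eval x).
Proof. by rewrite lin_cons_chain /= pair_with_lin. Qed.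

Lemma kdif_pair c y :
  lin kdif (pair_with c y)
  = \lin_(a <- bcomul c) pair_with a.1 (lin (kact a.2) y).
Proof.
rewrite lin_pair_with /koszul_dif /= exchange_lin; apply: eq_lin => a.
by rewrite pair_with_lin.
Qed.

(** Splitting the head turns the cobar differential into the Koszul differential;
   the extra term comes from the splitting that leaves the unit as head, which
   the reduced coproduct excludes. *)
Lemma kdif_head_eval w : normal_word w -> head bone w != bone ->
  lin kdif (head_eval w) = lin head_eval (cobar w) + pair_with bone (eval w).
Proof.
case: w => [|c v] //= nv nc; rewrite kdif_pair linB lin_head_cons eval_cobar.
rewrite [pair_with c 0]/pair_with lin0 subr0 lin_reduced /=.
rewrite (comul_reduced (fun x y => pair_with x (lin (kact y) (eval v))) nc).
rewrite [X in _ + X](_ : _ = 0) ?addr0; last first.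
  by under eq_lin do rewrite kact1; rewrite lin0f /pair_with lin0.
congr (_ + _); apply: eq_lin => a; rewrite /reduced; case: ifP => _ //=.
by rewrite linU.
Qed.

(** The cyclic coboundary of a word dies in the model: the two outer cofaces
   contribute each letter split off the head once on the left and once, after
   moving across the word, on the right, and these cancel by graded
   cocommutativity. *)
Lemma head_eval_wdif w : normal_word w -> lin head_eval (wdif w) = 0.
Proof.
case: w => [|c v] // nv.
rewrite wdif_normal // !linB linZ lin_head_cons eval_cobar.
rewrite [pair_with c 0]/pair_with lin0 subr0.
have -> : lin head_eval (\lin_(a <- bcomul c)
    (if a.2 == bone then 0 else << [:: a.1, a.2 & v] >>))
  = \lin_(a <- bcomul c) pair_with a.1 (lin (kact a.2) (eval v)).
  rewrite lin_lin; apply: eq_lin => a; case: ifP => [/eqP->|_].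
    by rewrite lin0; under eq_lin do rewrite kact1; rewrite lin0f /pair_with lin0.
  by rewrite linU.
apply/eqP; rewrite subr_eq0; apply/eqP.
rewrite (cocommE (fun x y => pair_with x (lin (kact y) (eval v)))) lin_lin -linZf.
apply: eq_lin => a; case: ifP => [/eqP->|_].
  rewrite lin0 scaler0.
  by under eq_lin do rewrite kact1; rewrite lin0f /pair_with lin0 scaler0.
rewrite linZ linU [head_eval _]/= eval_rcons wsgn_cons /=.
rewrite /pair_with linZ !scalerA; congr (_ *: _).
have s2 : (-1) ^+ size v * (-1) ^+ size v = 1 :> k by rewrite -expr2 sqrr_sign.
(* The split letter passes the tail twice: once in the outer coface and once, back,
   in the model. *)
have w2 : wsgn a.1 v * wsgn a.1 v = 1.
  by rewrite /wsgn -big_split big1 // => b _; apply: bsgnK.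
transitivity (bsgn a.1 a.2 * ((-1) ^+ size v * (-1) ^+ size v)
                * (wsgn a.1 v * wsgn a.1 v)); first by rewrite s2 w2 !mulr1.
ring.
Qed.

(** ** Lifting from the model to words *)

(** Iterating the decomposition of l writes it as a combination of products of
   letters, that is, as the value of a chain of words. *)
Fixpoint lift_rec n l : chain :=
  if n is n'.+1 then
    \lin_(y <- khtp (bone, l)) cons_chain y.1 (lift_rec n' y.2)
  else << [::] >>.

Definition lift_model l := lift_rec (klen l) l.

Definition lift_pair (x : A * K) : chain := cons_chain x.1 (lift_model x.2).

Lemma klen_eq0 l : klen l = 0%N -> l = kone.
Proof.
move=> l0; apply/eqP; apply: contraT => nl.
have nx : (bone : A, l) != (bone, kone) by rewrite xpair_eqE eqxx.
have := khtpP nx; rewrite /koszul_dif /= comul1 linU /= kact1 !lin0 addr0.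
rewrite linE big_seq big1 => [/malgP/(_ (bone, l))|y /khtp_supp[_ /=]].
  by rewrite mcoeff0 mcoeff_basis eqxx => /esym/eqP; rewrite oner_eq0.
by rewrite l0.
Qed.

(** The homotopy formula at (1, l), read in the component of the unit of A. *)
Lemma model_decomposition l : l != kone ->
  \lin_(y <- khtp (bone : A, l)) kact y.1 y.2 = << l >>.
Proof.
move=> nl; have nx : (bone : A, l) != (bone, kone) by rewrite xpair_eqE eqxx.
have /(congr1 (lin (component bone))) := khtpP nx.
rewrite {2}/koszul_dif /= comul1 linU /= kact1 !lin0 addr0 linU {2}/component eqxx.
move=> <-; rewrite lin_lin; apply: eq_lin => -[c m]; rewrite /koszul_dif /= lin_lin.
rewrite -[LHS](@counitlE _ _ _ (fun x => kact x m)); apply: eq_lin => a.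
rewrite -[X in lin _ X]/(pair_with _ _) component_pair; exact.
Qed.

Lemma lift_supp l : supp_on (fun w => [&& all nonunit w, size w == klen l
  & wwt w == klen l]) (lift_model l).
Proof.
rewrite /lift_model; move en : (klen l) => n.
elim: n l en => [|n IH] l en /=; first by apply: supp_onU; rewrite /wwt big_nil.
apply: supp_on_lin_in => y /khtp_supp[/=]; rewrite bwt1 en => w1 [/esym/IH h].
apply: supp_on_lin h _ => u /and3P[nu /eqP su /eqP wu]; apply: supp_onU.
by rewrite /= nu su wwt_cons wu w1 /nonunit -bwt_gt0 w1 !eqxx.
Qed.

Lemma eval_lift l : lin eval (lift_model l) = << l >>.
Proof.
rewrite /lift_model; move en : (klen l) => n.
elim: n l en => [|n IH] l en /=; first by rewrite linU /= (klen_eq0 en).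
rewrite -[RHS]model_decomposition; last first.
  by apply: contra_eq_neq en => ->; rewrite klen1.
rewrite lin_lin; apply: eq_in_lin => y /khtp_supp[_]; rewrite /= en => -[/esym e].
by rewrite lin_cons_chain /= -lin_lin IH // linU.
Qed.

Lemma head_eval_lift x : lin head_eval (lift_pair x) = << x >>.
Proof.
by rewrite lin_head_cons eval_lift /pair_with linU; case: x.
Qed.

End KoszulTheory.

(** * Acyclicity *)

Section Filtration.
Variables (k : fieldType) (A : bcoalg k) (K : koszul A).
Implicit Types (b c : A) (u v w : seq A).

Local Notation chain := {malg k[seq A]}.
Local Notation ev := (@eval k A K).
Local Notation hev := (@head_eval k A K).

Definition word_bound n w := all nonunit w && (wwt w <= n)%N.

(** The filling chain also has to evaluate to zero: it becomes the tail of a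
   correction of a longer chain, whose head evaluation must not change. *)
Definition acyclic_upto n := forall z : chain, supp_on (word_bound n) z ->
  lin (@cobar k A) z = 0 -> lin ev z = 0 ->
  exists y, [/\ supp_on (word_bound n) y, lin (@cobar k A) y = z & lin ev y = 0].

(** The predicate H selects the allowed heads: all letters but the unit for the
   cobar complex, all letters for the coHochschild complex. *)
Definition headed (H : pred A) n w : bool :=
  if w is c :: v then [&& H c, all nonunit v & (wwt w <= n)%N] else false.

Definition head_wt w : nat := if w is c :: _ then bwt c else 0%N.

Definition tail_of c w : chain :=
  if w is c' :: v then if c' == c then << v >> else 0 else 0.

Definition cons_cobar w : chain := if w is c :: v then cons_chain c (cobar v) else 0.

Lemma tail_of_cons_cobar c w :
  lin (tail_of c) (cons_cobar w) = lin (@cobar k A) (tail_of c w).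
Proof.
case: w => [|b v] /=; first by rewrite !lin0.
rewrite lin_cons_chain /=; case: ifP => _; first by rewrite linU lin_id.
by rewrite lin0f lin0.
Qed.

Lemma component_head_eval c w :
  lin (component c) (hev w) = lin ev (tail_of c w).
Proof.
case: w => [|b v] /=; first by rewrite !lin0.
by rewrite component_pair; case: ifP; rewrite ?linU ?lin0.
Qed.

Variables (H : pred A) (n : nat) (D : seq A -> chain).

Hypothesis D_low : forall c v, headed H n (c :: v) ->
  supp_on (fun u => headed H n u && (head_wt u < bwt c)%N)
    (D (c :: v) + cons_chain c (cobar v)).
Hypothesis D_D : forall x, supp_on (headed H n) x -> lin D (lin D x) = 0.
Hypothesis D_eval : forall x, supp_on (headed H n) x -> lin hev x = 0 ->
  lin hev (lin D x) = 0.
Hypothesis tails : forall c, H c -> (bwt c <= n)%N -> acyclic_upto (n - bwt c).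

Lemma headed_cons c u : H c -> (bwt c <= n)%N -> word_bound (n - bwt c) u ->
  headed H n (c :: u).
Proof. by move=> Hc cn /andP[nu wu] /=; rewrite Hc nu wwt_cons -leq_subRL. Qed.

(** A cocycle whose words have heads of weight at most [M] is, in the words
   with head [c] of weight [M], a family of cobar cocycles; acyclicity of the
   tails removes them, which lowers [M]. *)
Lemma filtration_acyclic (x : chain) : supp_on (headed H n) x ->
  lin D x = 0 -> lin hev x = 0 ->
  exists y, [/\ supp_on (headed H n) y, lin D y = x & lin hev y = 0].
Proof.
suff main M : forall x, supp_on (fun w => headed H n w && (head_wt w < M)%N) x ->
    lin D x = 0 -> lin hev x = 0 ->
    exists y, [/\ supp_on (headed H n) y, lin D y = x & lin hev y = 0].
  move=> hx; apply: (main n.+1); apply: sub_supp_on hx => -[|c v] //= hw.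
  rewrite hw ltnS; case/and3P: hw => _ _; apply: leq_trans.
  by rewrite wwt_cons leq_addr.
elim: M {x} => [|M IH] x hx Dx Ex.
  exists 0; rewrite !lin0 supp_on0; split => //.
  rewrite -[RHS]lin_id; apply/esym; rewrite -[RHS](lin0f _ x).
  by apply: eq_lin_on hx _ => w; rewrite andbF.
have hx' : supp_on (headed H n) x by apply: sub_supp_on hx => w /andP[].
pose cs := undup [seq head bone w | w <- msupp x & head_wt w == M].
pose xc c := lin (tail_of c) x.
have csP c : c \in cs -> [/\ bwt c = M, H c & (bwt c <= n)%N].
  rewrite mem_undup => /mapP[w]; rewrite mem_filter => /andP[/eqP wM /(allP hx')].
  case: w wM => [|b v] //= wM /and3P[Hb _ bn] ->; split => //.
  by apply: leq_trans bn; rewrite wwt_cons leq_addr.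
have supp_xc c : c \in cs -> supp_on (word_bound (n - bwt c)) (xc c).
  move=> /csP[_ _ cn]; apply: supp_on_lin hx' _ => -[|b v] //= /and3P[_ nv wv].
  case: eqP => [<-|_]; last exact: supp_on0.
  apply: supp_onU; rewrite /word_bound nv leq_subRL //; last first.
    by apply: leq_trans wv; rewrite wwt_cons leq_addr.
  by rewrite -wwt_cons.
have cob_xc c : c \in cs -> lin (@cobar k A) (xc c) = 0.
  move=> /csP[cM _ _]; have := congr1 (lin (tail_of c)) Dx.
  rewrite lin0 !lin_lin /xc => e.
  rewrite -[RHS]oppr0 -e -linNf; apply: eq_in_lin => w /(allP hx).
  case: w => [|b v] //= /andP[hw wM]; rewrite -[LHS](tail_of_cons_cobar c (b :: v)).
  apply/esym/eqP; rewrite eqr_oppLR -addr_eq0 -linD /=; apply/eqP.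
  have low := D_low hw; rewrite -[RHS](lin0f _ (D (b :: v) + cons_chain b (cobar v))).
  apply: eq_lin_on low _ => -[|c' u] //= /andP[_ lt].
  case: eqP => // ec; move: lt; rewrite ec cM => lt.
  by move: (leq_trans lt wM); rewrite ltnn.
have ev_xc c : lin ev (xc c) = 0.
  rewrite /xc lin_lin; under eq_lin do rewrite -component_head_eval.
  by rewrite -lin_lin Ex lin0.
(* Y c fills the tails of the words of x with head c. *)
have /choice[Y YP] : forall c, exists y, c \in cs ->
    [/\ supp_on (word_bound (n - bwt c)) y, lin (@cobar k A) y = xc c & lin ev y = 0].
  move=> c; have [cc|] := boolP (c \in cs); last by exists 0.
  have [_ Hc cn] := csP c cc.
  by have [y yP] := tails Hc cn (supp_xc c cc) (cob_xc c cc) (ev_xc c); exists y.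
pose y := - \sum_(c <- cs) cons_chain c (Y c).
have hy : supp_on (headed H n) y.
  rewrite /y big_seq; apply/supp_onN/supp_on_sum => c cc.
  have [_ Hc cn] := csP c cc; have [hY _ _] := YP c cc.
  by apply: supp_on_lin hY _ => u hu; apply/supp_onU/headed_cons.
have Ey : lin hev y = 0.
  rewrite /y linN lin_sum big_seq big1 ?oppr0 // => c cc.
  by have [_ _ e] := YP c cc; rewrite lin_head_cons e /pair_with lin0.
(* Collecting the words of x by their heads recovers the part with heads of weight M. *)
have top : \sum_(c <- cs) cons_chain c (xc c)
         = restrict (fun w => head_wt w == M) x.
  under eq_bigr do rewrite /xc cons_chain_lin.
  rewrite -lin_sumf /restrict; apply: eq_in_lin => w wx.
  have := allP hx w wx; case: w wx => [|b v] //= wx _.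
  have e c : cons_chain c (if b == c then << v >> else 0) =
      if c == b then << b :: v >> else 0 :> chain.
    rewrite eq_sym; case: eqP => [->|_]; first exact: cons_chainU.
    exact: lin0.
  under eq_bigr do rewrite e.
  rewrite -big_mkcond; case: ifP => bM; last first.
    rewrite big_seq_cond big1 // => c /andP[cc /eqP cb].
    by move: bM; rewrite -cb; have [-> _ _] := csP c cc; rewrite eqxx.
  have bc : b \in cs.
    by rewrite mem_undup; apply/mapP; exists (b :: v); rewrite ?mem_filter //= bM.
  by rewrite -big_filter (perm_big [:: b]) ?big_seq1 // filter_pred1_uniq ?undup_uniq.
have hD : supp_on (fun w => headed H n w && (head_wt w < M)%N) (x - lin D y).
  (* By D_low, D acts on the words with head c as minus the cobar differential of the
     tails, up to words with lighter heads. *)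
  pose low := \sum_(c <- cs) lin D (cons_chain c (Y c)) + \sum_(c <- cs) cons_chain c (xc c).
  have -> : x - lin D y = low + (x - \sum_(c <- cs) cons_chain c (xc c)).
    rewrite /y linN lin_sum opprK /low; move: (\sum_(c <- cs) _) (\sum_(c <- cs) _) => P Q.
    by rewrite addrACA addrN addr0 addrC.
  apply: supp_onD.
    rewrite /low -big_split big_seq; apply: supp_on_sum => c cc /=.
    have [cM Hc cn] := csP c cc; have [hY <- _] := YP c cc.
    rewrite lin_cons_chain cons_chain_lin -linDf.
    apply: supp_on_lin hY _ => u hu.
    by apply: sub_supp_on (D_low (headed_cons Hc cn hu)) => w; rewrite cM.
  rewrite top.
  have -> : x - restrict (fun w => head_wt w == M) x
          = restrict (fun w => head_wt w != M) x.
    apply/malgP => w; rewrite mcoeffB !mcoeff_restrict.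
    by case: ifP => _; rewrite /= ?subrr ?subr0.
  rewrite (@eq_supp_on _ _ _ (predI (fun w => headed H n w && (head_wt w < M.+1)%N)
     (fun w => head_wt w != M))) => [|w]; last first.
    by rewrite /= ltnS ltn_neqAle [X in _ && X]andbC andbA.
  by rewrite supp_onI supp_on_restrict supp_on_restrict_of.
have D0 : lin D (x - lin D y) = 0 by rewrite linB Dx D_D // subr0.
have E0 : lin hev (x - lin D y) = 0 by rewrite linB Ex D_eval // subr0.
have [y' [hy' Dy' Ey']] := IH _ hD D0 E0.
exists (y' + y); rewrite !linD Dy' Ey Ey' addr0 subrK; split => //.
exact: supp_onD.
Qed.

End Filtration.

Section Acyclicity.
Variables (k : fieldType) (A : bcoalg k) (K : koszul A).
Implicit Types (b c : A) (u v w : seq A).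

Local Notation chain := {malg k[seq A]}.
Local Notation ev := (@eval k A K).
Local Notation hev := (@head_eval k A K).
Local Notation kdif := (koszul_dif (@kact k A K)).
Local Notation hnonunit := (headed (@nonunit k A)).

Lemma split_supp (P : pred (seq A)) b (G : A -> A -> chain) :
  (forall x y, nonunit x -> nonunit y -> (bwt x + bwt y = bwt b)%N ->
     supp_on P (G x y)) ->
  supp_on P (\lin_(a <- bcomul b) reduced G a).
Proof.
move=> h; apply: supp_on_lin_in => a /bwtD ab; rewrite /reduced.
case: ifP => [_|/norP[n1 n2]]; [exact: supp_on0 | exact: h].
Qed.

Lemma cobar_supp w : all nonunit w ->
  supp_on (fun u => [&& all nonunit u, wwt u == wwt w & u != [::]]) (cobar w).
Proof.
elim: w => [|b r IH] /=; first by rewrite supp_on0.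
case/andP=> nb nr; apply: supp_onB.
  apply: split_supp => x y nx ny e; apply: supp_onU.
  by rewrite /= nx ny nr !wwt_cons addnA e eqxx.
apply: supp_on_lin (IH nr) _ => u /and3P[nu /eqP wu _]; apply: supp_onU.
by rewrite /= nb nu !wwt_cons wu eqxx.
Qed.

Lemma cobar_low n c v : hnonunit n (c :: v) ->
  supp_on (fun u => hnonunit n u && (head_wt u < bwt c)%N)
    (cobar (c :: v) + cons_chain c (cobar v)).
Proof.
case/and3P=> nc nv wn; rewrite subrK; apply: split_supp => x y nx ny e.
apply: supp_onU; rewrite /= nx ny nv -e -addn1 leq_add2l bwt_gt0 [_ != _]ny andbT.
by move: wn; rewrite !wwt_cons addnA e.
Qed.

Lemma cobar_headed n x : supp_on (hnonunit n) x ->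
  supp_on (hnonunit n) (lin (@cobar k A) x).
Proof.
move=> hx; apply: supp_on_lin hx _ => -[|c v] // /and3P[nc nv wn].
have nw : all nonunit (c :: v) by rewrite /= nc nv.
apply: sub_supp_on (cobar_supp nw) => -[|b u] /and3P[//] /andP[nb nu] /eqP e _.
by apply/and3P; split => //; rewrite e.
Qed.

Lemma kdif_head_eval_chain n x : supp_on (hnonunit n) x ->
  lin kdif (lin hev x) = lin hev (lin (@cobar k A) x) + pair_with bone (lin ev x).
Proof.
move=> hx; rewrite pair_with_lin !lin_lin -linDf.
apply: eq_lin_on hx _ => -[|c v] // /and3P[nc nv _].
by rewrite kdif_head_eval.
Qed.

Lemma component1_head_eval n x : supp_on (hnonunit n) x ->
  lin (component bone) (lin hev x) = 0.
Proof.
move=> hx; rewrite lin_lin -[RHS](lin0f _ x); apply: eq_lin_on hx _.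
move=> -[|c v] // /and3P[nc _ _].
by rewrite component_head_eval /= (negPf nc) lin0.
Qed.

Lemma eval_component n x : supp_on (hnonunit n) x ->
  lin ev x = lin (component bone) (lin kdif (lin hev x)).
Proof.
move=> hx; rewrite (kdif_head_eval_chain hx) linD component_pair eqxx.
by rewrite (component1_head_eval (cobar_headed hx)) add0r.
Qed.

Lemma eval_headed n z : supp_on (word_bound n) z -> lin ev z = 0 ->
  supp_on (hnonunit n) z.
Proof.
move=> hz ez; apply: supp_on_coef => -[|c v] nz; last first.
  have := allP hz (c :: v); rewrite -mcoeff_neq0 => /(_ nz) /andP[/andP[nc nv] wn].
  by apply/and3P.
have : (lin ev z)@_kone = z@_[::].
  rewrite (@mcoeff_linM _ _ _ _ _ _ [::]) /= ?mcoeff_basis ?eqxx ?mulr1 //.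
  move=> w _ nw; apply: mcoeff_outdom; apply: contra nw => /eval_supp[].
  by rewrite klen1 => /esym/eqP; rewrite size_eq0.
by rewrite ez mcoeff0 => e; rewrite -e eqxx in nz.
Qed.

Lemma koszul_lift n z : supp_on (hnonunit n) z ->
  supp_on (hnonunit n) (lin (@lift_pair k A K) (lin khtp (lin hev z))).
Proof.
move=> hz; rewrite !lin_lin; apply: supp_on_lin hz _ => -[|c v] // /and3P[nc nv wn].
rewrite /= /pair_with !lin_lin; apply: supp_on_lin_in => l /eval_supp[ll wv].
rewrite linU; apply: supp_on_lin_in => -[b m] /khtp_supp[/= wb lm].
rewrite /lift_pair /=; apply: supp_on_lin (lift_supp m) _ => u.
case/and3P=> nu _ /eqP wu; apply: supp_onU; rewrite /= nu /nonunit -bwt_gt0 wb /=.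
by rewrite wwt_cons wb wu addSnnS -lm ll -wv -wwt_cons.
Qed.

(** The homotopy formula applies to all terms but (1, 1), which does not occur. *)
Lemma koszul_fill z : lin kdif (lin hev z) = 0 ->
  lin (component bone) (lin hev z) = 0 :> {malg k[K]} ->
  lin kdif (lin khtp (lin hev z)) = lin hev z.
Proof.
move=> dz cz; rewrite -[RHS]lin_id.
transitivity (\lin_(x <- lin hev z) (lin kdif (khtp x) + lin khtp (kdif x))).
  by rewrite linDf -!lin_lin dz lin0 addr0.
apply: eq_in_lin => x hx; apply: khtpP; apply: contraTneq hx => ->.
rewrite -mcoeff_eq0 -[X in X == _]mulr1.
have := congr1 (mcoeff kone) cz.
rewrite mcoeff0 (@mcoeff_linM _ _ _ _ _ _ (bone, kone)).
  by rewrite /component eqxx mcoeff_basis eqxx => ->.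
move=> [c l] _; rewrite /component /= xpair_eqE.
by case: (c == bone) => /= [/negPf e|_]; rewrite ?mcoeff0 // mcoeff_basis e.
Qed.

(** Induction on the weight bound.  The head evaluation of a cobar cocycle z that
   evaluates to zero is a Koszul cocycle.  The contraction fills it, and lifting
   the filling to words gives a chain y whose coboundary has the same head
   evaluation as z.  The difference is treated by filtration_acyclic, as the
   tails of its words have smaller weight than z. *)
Theorem cobar_acyclic n : acyclic_upto K n.
Proof.
elim/ltn_ind: n => n IH z hz Cz Ez.
have hz' := eval_headed hz Ez.
have dz : lin kdif (lin hev z) = 0.
  by rewrite (kdif_head_eval_chain hz') Cz Ez lin0 /pair_with lin0 addr0.
pose y := lin (@lift_pair k A K) (lin khtp (lin hev z)).
have hy : supp_on (hnonunit n) y := koszul_lift hz'.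
have ey : lin hev y = lin khtp (lin hev z).
  by rewrite lin_lin -[RHS]lin_id; apply: eq_lin => x; apply: head_eval_lift.
have dy : lin kdif (lin hev y) = lin hev z.
  by rewrite ey koszul_fill // (component1_head_eval hz').
have Ey : lin ev y = 0.
  by rewrite (eval_component hy) dy (component1_head_eval hz').
have Cy : lin hev (lin (@cobar k A) y) = lin hev z.
  by rewrite -dy (kdif_head_eval_chain hy) Ey /pair_with lin0 addr0.
have CC (x : chain) : lin (@cobar k A) (lin (@cobar k A) x) = 0.
  by rewrite lin_lin; under eq_lin do rewrite cobar_cobar; rewrite lin0f.
have [x [hx Cx Ex]] : exists x, [/\ supp_on (hnonunit n) x,
    lin (@cobar k A) x = z - lin (@cobar k A) y & lin hev x = 0].
  apply: (@filtration_acyclic _ _ K (@nonunit k A) n (@cobar k A)).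
  - exact: cobar_low.
  - by move=> x _; apply: CC.
  - move=> x hx ex; have := kdif_head_eval_chain hx.
    by rewrite (eval_component hx) ex !lin0 /pair_with lin0 addr0.
  - move=> c nc cn; apply: IH; rewrite -subn_gt0 subKn // bwt_gt0; exact: nc.
  - by apply: supp_onB hz' (cobar_headed hy).
  - by rewrite linB Cz CC subr0.
  - by rewrite linB Cy subrr.
exists (x + y); rewrite !linD Cx subrK Ey addr0 (eval_component hx) Ex !lin0.
split => //; apply: sub_supp_on (supp_onD hx hy) => -[|c v] //.
by case/and3P=> nc nv wn; rewrite /word_bound /= nc nv.
Qed.

Definition normal_of n w := normal_word w && (wwt w == n).

Lemma wdif_supp w : normal_word w ->
  supp_on (normal_of (wwt w)) (wdif w).
Proof.
case: w => [|c v] //= nv; rewrite (wdif_normal c nv).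
apply: supp_onB; [apply: supp_onB|apply: supp_onZ].
- apply: supp_on_lin_in => a /bwtD e; case: ifP => [_|n2]; first exact: supp_on0.
  by apply: supp_onU; rewrite /normal_of /= /nonunit n2 nv !wwt_cons addnA e eqxx.
- apply: supp_on_lin (cobar_supp nv) _ => u /and3P[nu /eqP wu _]; apply: supp_onU.
  by rewrite /normal_of /= nu !wwt_cons wu eqxx.
- apply: supp_on_lin_in => a /bwtD e; case: ifP => [_|n1]; first exact: supp_on0.
  apply/supp_onZ/supp_onU; rewrite /normal_of /= all_rcons /nonunit n1 nv.
  by rewrite !wwt_cons wwt_rcons -e /=; apply/eqP; lia.
Qed.

Lemma wdif_low n c v : headed predT n (c :: v) ->
  supp_on (fun u => headed predT n u && (head_wt u < bwt c)%N)
    (wdif (c :: v) + cons_chain c (cobar v)).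
Proof.
case/and3P=> _ nv wn; rewrite (wdif_normal c nv) addrAC subrK.
apply: supp_onB; last apply: supp_onZ.
  apply: supp_on_lin_in => a /bwtD e; case: ifP => [_|n2]; first exact: supp_on0.
  apply: supp_onU; rewrite /= /nonunit n2 nv -e -addn1 leq_add2l bwt_gt0 n2 andbT.
  by move: wn; rewrite !wwt_cons -e addnA /= andbT.
apply: supp_on_lin_in => a /bwtD e; case: ifP => [_|n1]; first exact: supp_on0.
apply/supp_onZ/supp_onU; rewrite /= all_rcons /nonunit n1 nv -e.
rewrite -add1n leq_add2r bwt_gt0 n1 /= andbT; move: wn.
by rewrite !wwt_cons wwt_rcons -e; lia.
Qed.

Lemma wdif_chain_supp x : supp_on (@normal_word k A) x ->
  supp_on (@normal_word k A) (lin (@wdif k A) x).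
Proof.
move=> hx; apply: supp_on_lin hx _ => w nw.
by apply: sub_supp_on (wdif_supp nw) => u /andP[].
Qed.

Lemma wdif_chain_square (x : chain) : lin (@wdif k A) (lin (@wdif k A) x) = 0.
Proof. by rewrite lin_lin; under eq_lin do rewrite wdif_wdif; rewrite lin0f. Qed.

Lemma head_eval_wdif_chain x : supp_on (@normal_word k A) x ->
  lin hev (lin (@wdif k A) x) = 0.
Proof.
move=> hx; rewrite lin_lin -[RHS](lin0f _ x).
by apply: eq_lin_on hx _ => w; apply: head_eval_wdif.
Qed.

(** The leading part of the coboundary of a word, for the filtration by the
   weight of the head, is the cobar differential of the tail. *)
Theorem head_eval_inj x : supp_on (@normal_word k A) x ->
  lin (@wdif k A) x = 0 -> lin hev x = 0 ->
  exists y, [/\ supp_on (@normal_word k A) y, lin (@wdif k A) y = x & lin hev y = 0].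
Proof.
move=> hx Dx Ex; pose n := (\max_(w <- msupp x) wwt w)%N.
have nhead w : headed predT n w -> normal_word w.
  by case: w => [|c v] // /and3P[].
have hx' : supp_on (headed predT n) x.
  apply/supp_onP => w wx; have := supp_onP _ _ hx w wx.
  case: w wx => [|c v] //= wx nv; rewrite nv /n.
  by rewrite (big_rem _ wx) /= leq_maxl.
have [y [hy Dy Ey]] := filtration_acyclic (@wdif_low n)
  (fun x _ => wdif_chain_square x)
  (fun x hx _ => head_eval_wdif_chain (sub_supp_on nhead hx))
  (fun c _ _ => @cobar_acyclic _) hx' Dx Ex.
by exists y; split => //; apply: sub_supp_on hy.
Qed.

(** Lifting y to words gives a chain whose coboundary has head evaluation zero,
   hence is the coboundary of a chain that can be subtracted without changing
   the head evaluation. *)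
Theorem head_eval_surj (y : {malg k[(A * K)%type]}) :
  exists x, [/\ supp_on (@normal_word k A) x, lin (@wdif k A) x = 0 & lin hev x = y].
Proof.
pose x := lin (@lift_pair k A K) y.
have hx : supp_on (@normal_word k A) x.
  apply: supp_on_lin_in => -[c l] _; apply: supp_on_lin (lift_supp l) _ => u.
  by case/and3P=> nu _ _; apply: supp_onU.
have Ex : lin hev x = y.
  by rewrite lin_lin -[RHS]lin_id; apply: eq_lin => z; apply: head_eval_lift.
have [z [hz Dz Ez]] := head_eval_inj (wdif_chain_supp hx) (wdif_chain_square x)
  (head_eval_wdif_chain hx).
exists (x - z); rewrite !linB Dz subrr Ex Ez subr0; split => //; exact: supp_onB.
Qed.

End Acyclicity.

(** * Tensor products of coalgebras and of their models *)

Section TensorCoalgebra.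
Variables (k : fieldType) (A A' : bcoalg k).

Local Notation B := (A * A')%type.

(** No sign is paid for exchanging the middle factors: a letter of the tensor
   product stands for two letters at the same place of two separate words, on
   which the cofaces act simultaneously. *)
Definition tens_comul (b : B) : {malg k[(B * B)%type]} :=
  \lin_(a <- bcomul b.1) \lin_(a' <- bcomul b.2)
    << ((a.1, a'.1), (a.2, a'.2)) >>.

Definition tens_sgn (b c : B) : k := bsgn b.1 c.1 * bsgn b.2 c.2.

Definition tens_wt (b : B) : nat := (bwt b.1 + bwt b.2)%N.

Lemma tens_comulE (V : lmodType k) (G : B * B -> V) b :
  lin G (tens_comul b)
  = \lin_(a <- bcomul b.1) \lin_(a' <- bcomul b.2) G ((a.1, a'.1), (a.2, a'.2)).
Proof.
rewrite lin_lin; apply: eq_lin => a; rewrite lin_lin; apply: eq_lin => a'.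
by rewrite linU.
Qed.

Lemma tens_comul_supp b a : a \in msupp (tens_comul b) ->
  (a.1.1, a.2.1) \in msupp (bcomul b.1) /\ (a.1.2, a.2.2) \in msupp (bcomul b.2).
Proof.
have : supp_on (fun a => ((a.1.1, a.2.1) \in msupp (bcomul b.1))
    && ((a.1.2, a.2.2) \in msupp (bcomul b.2))) (tens_comul b).
  apply: supp_on_lin_in => -[x y] h; apply: supp_on_lin_in => -[x' y'] h'.
  by apply: supp_onU; rewrite /= h h'.
by move=> /supp_onP h /h /andP.
Qed.

Lemma tens_coassoc b :
  \lin_(a <- tens_comul b) \lin_(c <- tens_comul a.1) << (c.1, (c.2, a.2)) >>
  = \lin_(a <- tens_comul b) \lin_(c <- tens_comul a.2) << (a.1, (c.1, c.2)) >>
    :> {malg k[(B * (B * B))%type]}.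
Proof.
pose F x y z x' y' z' : {malg k[(B * (B * B))%type]} :=
  << ((x, x'), ((y, y'), (z, z'))) >>.
transitivity (\lin_(a <- bcomul b.1) \lin_(c <- bcomul a.1)
  \lin_(a' <- bcomul b.2) \lin_(c' <- bcomul a'.1) F c.1 c.2 a.2 c'.1 c'.2 a'.2).
  rewrite tens_comulE; apply: eq_lin => a /=; rewrite exchange_lin.
  by apply: eq_lin => a'; rewrite tens_comulE.
rewrite (coassocE (fun x y z => \lin_(a' <- bcomul b.2) \lin_(c' <- bcomul a'.1)
   F x y z c'.1 c'.2 a'.2)).
rewrite tens_comulE; apply: eq_lin => a /=.
under [RHS]eq_lin do rewrite tens_comulE.
rewrite /= [RHS]exchange_lin; apply: eq_lin => c.
by rewrite (coassocE (fun x y z => F a.1 c.1 c.2 x y z)).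
Qed.

Lemma tens_counitl b :
  \lin_(a <- tens_comul b) (if a.1 == (bone, bone) then << a.2 >> else 0)
  = << b >> :> {malg k[B]}.
Proof.
case: b => b b'; rewrite tens_comulE /=.
rewrite -[RHS](@counitlE _ _ _ (fun y => << (y, b') >>)).
apply: eq_lin => a; case: (altP (a.1 =P bone)) => [->|n1] /=.
  rewrite -[RHS](@counitlE _ _ _ (fun y => << (a.2, y) >>)); apply: eq_lin => a'.
  by rewrite xpair_eqE eqxx.
by under eq_lin do rewrite xpair_eqE (negPf n1); rewrite lin0f.
Qed.

Lemma tens_counitr b :
  \lin_(a <- tens_comul b) (if a.2 == (bone, bone) then << a.1 >> else 0)
  = << b >> :> {malg k[B]}.
Proof.
case: b => b b'; rewrite tens_comulE /=.
rewrite -[RHS](@counitrE _ _ _ (fun y => << (y, b') >>)).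
apply: eq_lin => a; case: (altP (a.2 =P bone)) => [->|n1] /=.
  rewrite -[RHS](@counitrE _ _ _ (fun y => << (a.1, y) >>)); apply: eq_lin => a'.
  by rewrite xpair_eqE eqxx.
by under eq_lin do rewrite xpair_eqE (negPf n1); rewrite lin0f.
Qed.

Lemma tens_wtD b a : a \in msupp (tens_comul b) ->
  (tens_wt a.1 + tens_wt a.2 = tens_wt b)%N.
Proof.
by move=> /tens_comul_supp[/bwtD/= h /bwtD/= h']; rewrite /tens_wt addnACA h h'.
Qed.

Lemma tens_wt_eq0 b : (tens_wt b == 0%N) = (b == (bone, bone)).
Proof. by rewrite addn_eq0 !bwt_eq0; case: b. Qed.

Lemma tens_sgnC b c : tens_sgn b c = tens_sgn c b.
Proof. by rewrite /tens_sgn bsgnC [X in _ * X]bsgnC. Qed.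

Lemma tens_sgnDl b c a : a \in msupp (tens_comul b) ->
  tens_sgn b c = tens_sgn a.1 c * tens_sgn a.2 c.
Proof.
move=> /tens_comul_supp[h h']; rewrite /tens_sgn (bsgnDl _ h) (bsgnDl _ h') /=.
ring.
Qed.

Lemma tens_sgnK b c : tens_sgn b c * tens_sgn b c = 1.
Proof. by rewrite /tens_sgn mulrACA !bsgnK mulr1. Qed.

Lemma tens_sgn1l b : tens_sgn (bone, bone) b = 1.
Proof. by rewrite /tens_sgn !bsgn1l mulr1. Qed.

Lemma tens_cocomm b :
  \lin_(a <- tens_comul b) tens_sgn a.1 a.2 *: << (a.2, a.1) >> = tens_comul b.
Proof.
rewrite tens_comulE /tens_comul.
rewrite [RHS](@cocommE _ _ _ (fun x y => \lin_(a' <- bcomul b.2)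
   << ((x, a'.1), (y, a'.2)) >>)); apply: eq_lin => a.
rewrite (@cocommE _ _ _ (fun x y => << ((a.2, x), (a.1, y)) >>)) -linZf.
by apply: eq_lin => a'; rewrite scalerA.
Qed.

Definition btens : bcoalg k :=
  @BCoalg k B (bone, bone) tens_comul tens_sgn tens_wt tens_coassoc tens_counitl
    tens_counitr tens_wtD tens_wt_eq0 tens_sgnC tens_sgnDl tens_sgnK tens_sgn1l
    tens_cocomm.

End TensorCoalgebra.

Section TensorModel.
Variables (k : fieldType) (A A' : bcoalg k) (K : koszul A) (K' : koszul A').

Local Notation L := (K * K')%type.
Local Notation sgn l := ((-1) ^+ klen l : k).

Definition lact b (x : L) : {malg k[L]} := \lin_(m <- kact b x.1) << (m, x.2) >>.

Definition ract b (x : L) : {malg k[L]} :=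
  sgn x.1 *: \lin_(m <- kact b x.2) << (x.1, m) >>.

(** A pair acts through one of its letters when the other is the unit; the second acts
   with the sign for moving a letter past the first factor. *)
Definition tens_act (b : btens A A') (x : L) : {malg k[L]} :=
  (if b.2 == bone then lact b.1 x else 0) + (if b.1 == bone then ract b.2 x else 0).

Definition tens_len (x : L) : nat := (klen x.1 + klen x.2)%N.

Definition interleave (x : A * K) (x' : A' * K') : (A * A') * L :=
  ((x.1, x'.1), (x.2, x'.2)).

(** The first factor is contracted, and where it is already the unit, the
   second. *)
Definition tens_htp (x : btens A A' * L) : {malg k[(btens A A' * L)%type]} :=
  if (x.1.1, x.2.1) == (bone, kone)
  then \lin_(y <- khtp (x.1.2, x.2.2)) << interleave (x.1.1, x.2.1) y >>
  else \lin_(y <- khtp (x.1.1, x.2.1)) << interleave y (x.1.2, x.2.2) >>.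

Lemma lact_lact b c x : lin (lact b) (lact c x)
  = - bsgn b c *: lin (lact c) (lact b x).
Proof.
rewrite /lact !lin_lin; under eq_lin do rewrite linU /=.
under [in RHS]eq_lin do rewrite linU /=.
rewrite -[LHS](lin_lin (fun m => << (m, x.2) >>)) kactC linZ lin_lin.
by [].
Qed.

Lemma lin_lact (V : lmodType k) (f : L -> V) b x :
  lin f (lact b x) = \lin_(m <- kact b x.1) f (m, x.2).
Proof. by rewrite lin_lin; apply: eq_lin => m; rewrite linU. Qed.

Lemma lin_ract (V : lmodType k) (f : L -> V) b x :
  lin f (ract b x) = sgn x.1 *: \lin_(m <- kact b x.2) f (x.1, m).
Proof. by rewrite linZ lin_lin; congr (_ *: _); apply: eq_lin => m; rewrite linU. Qed.

Lemma sgnK (l : K) : sgn l * sgn l = 1.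
Proof. by rewrite -expr2 sqrr_sign. Qed.

Lemma ract_ract b c x : lin (ract b) (ract c x)
  = - bsgn b c *: lin (ract c) (ract b x).
Proof.
have e d d' : lin (ract d) (ract d' x)
    = \lin_(m <- lin (kact d) (kact d' x.2)) << (x.1, m) >>.
  rewrite lin_ract lin_lin; under eq_lin do rewrite /ract /=.
  by rewrite linZf scalerA sgnK scale1r.
by rewrite !e kactC linZ.
Qed.

Lemma lact_ract b c x : lin (lact b) (ract c x)
  = sgn x.1 *: \lin_(m <- kact b x.1) \lin_(m' <- kact c x.2) << (m, m') >>.
Proof. by rewrite lin_ract /lact /= exchange_lin. Qed.

Lemma ract_lact b c x : lin (ract c) (lact b x) = - lin (lact b) (ract c x).
Proof.
rewrite lact_ract lin_lact -scaleNr -linZf; apply: eq_in_lin => m /kact_len e.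
by rewrite /ract /= e exprS mulN1r.
Qed.

Lemma lact1 x : lact bone x = 0.
Proof. by rewrite /lact kact1 lin0. Qed.

Lemma ract1 x : ract bone x = 0.
Proof. by rewrite /ract kact1 lin0 scaler0. Qed.

Lemma lin_tens_act b (y : {malg k[L]}) :
  lin (tens_act b) y = (if b.2 == bone then lin (lact b.1) y else 0)
                       + (if b.1 == bone then lin (ract b.2) y else 0).
Proof. by rewrite linDf; congr (_ + _); case: ifP => _; rewrite ?lin0f. Qed.

Lemma tens_act_act b c x : lin (tens_act b) (tens_act c x) =
    (if (b.2 == bone) && (c.2 == bone) then lin (lact b.1) (lact c.1 x) else 0)
  + (if (b.2 == bone) && (c.1 == bone) then lin (lact b.1) (ract c.2 x) else 0)
  + (if (b.1 == bone) && (c.2 == bone) then lin (ract b.2) (lact c.1 x) else 0)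
  + (if (b.1 == bone) && (c.1 == bone) then lin (ract b.2) (ract c.2 x) else 0).
Proof.
rewrite lin_tens_act /tens_act.
by case: (b.1 == bone); case: (b.2 == bone); case: (c.1 == bone);
  case: (c.2 == bone); rewrite /= ?linD ?lin0 ?addr0 ?add0r ?addrA.
Qed.

Lemma tens_act_wt b x : bwt b != 1%N -> tens_act b x = 0.
Proof.
case: b => b b'; rewrite /bwt /= /tens_wt /tens_act /= => wb.
case: (altP (b' =P bone)) wb => [->|_]; case: (altP (b =P bone)) => [->|_] //=.
- by rewrite lact1 ract1 addr0.
- by rewrite bwt1 addn0 /lact => /kact_wt->; rewrite lin0 addr0.
- by rewrite bwt1 add0n /ract => /kact_wt->; rewrite lin0 scaler0 addr0.
- by rewrite addr0.
Qed.

Lemma tens_act_len b x m : m \in msupp (tens_act b x) -> tens_len m = (tens_len x).+1.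
Proof.
have : supp_on (fun m => tens_len m == (tens_len x).+1) (tens_act b x).
  apply: supp_onD; case: ifP => _; rewrite ?supp_on0 //.
    apply: supp_on_lin_in => n /kact_len e; apply: supp_onU.
    by rewrite /tens_len /= e addSn.
  apply/supp_onZ/supp_on_lin_in => n /kact_len e; apply: supp_onU.
  by rewrite /tens_len /= e addnS.
by move=> /supp_onP h /h /eqP.
Qed.

Lemma tens_actC b c x :
  lin (tens_act b) (tens_act c x) = - bsgn b c *: lin (tens_act c) (tens_act b x).
Proof.
case: b c => b b' [c c']; rewrite !tens_act_act /=.
rewrite /tens_sgn /=.
rewrite [(c' == bone) && _]andbC [(c == bone) && (b' == _)]andbC.
rewrite [(c' == bone) && (b == _)]andbC [(c == bone) && (b == _)]andbC.
rewrite !scalerDr -!addrA; congr (_ + _).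
  case: ifP => [/andP[/eqP-> /eqP->]|_]; last by rewrite scaler0.
  by rewrite bsgn1l mulr1 lact_lact.
rewrite addrCA; congr (_ + _); last congr (_ + _).
- case: ifP => [/andP[/eqP-> /eqP->]|_]; last by rewrite scaler0.
  by rewrite bsgn1l mul1r bsgn1r scaleN1r ract_lact.
- case: ifP => [/andP[/eqP-> /eqP->]|_]; last by rewrite scaler0.
  by rewrite bsgn1l mulr1 bsgn1r scaleN1r ract_lact opprK.
- case: ifP => [/andP[/eqP-> /eqP->]|_]; last by rewrite scaler0.
  by rewrite bsgn1l mul1r ract_ract.
Qed.

(** The two mixed sums are the compositions of the left and the right action in
   both orders, which cancel because these actions anticommute. *)
Lemma tens_act_quad b x :
  \lin_(a <- bcomul b) lin (tens_act a.1) (tens_act a.2 x) = 0.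
Proof.
case: b => b b'; rewrite [bcomul _]/(tens_comul (b, b')).
pose T a a' := lin (tens_act (a.1, a'.1)) (tens_act (a.2, a'.2) x).
transitivity (\lin_(a <- bcomul b) \lin_(a' <- bcomul b') T a a').
  by rewrite tens_comulE.
rewrite /T; under eq_lin do under eq_lin do rewrite tens_act_act /=.
under eq_lin do rewrite !linDf; rewrite !linDf.
have -> : \lin_(a <- bcomul b) \lin_(a' <- bcomul b')
  (if (a'.1 == bone) && (a'.2 == bone) then lin (lact a.1) (lact a.2 x) else 0) = 0.
  rewrite exchange_lin -[RHS](lin0f _ (bcomul b')); apply: eq_lin => a'.
  case: (_ && _); last by rewrite lin0f.
  under eq_lin do rewrite lin_lact /lact /= -lin_lin.
  by rewrite -linear_lin /= kact_quad lin0.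
have -> : \lin_(a <- bcomul b) \lin_(a' <- bcomul b')
  (if (a.1 == bone) && (a.2 == bone) then lin (ract a'.1) (ract a'.2 x) else 0) = 0.
  rewrite -[RHS](lin0f _ (bcomul b)); apply: eq_lin => a.
  case: (_ && _); last by rewrite lin0f.
  under eq_lin do rewrite lin_ract /ract /= linZf scalerA sgnK scale1r -lin_lin.
  by rewrite -linear_lin /= kact_quad lin0.
have -> : \lin_(a <- bcomul b) \lin_(a' <- bcomul b')
  (if (a'.1 == bone) && (a.2 == bone) then lin (lact a.1) (ract a'.2 x) else 0)
  = lin (lact b) (ract b' x).
  rewrite -[RHS](@counitrE _ _ _ (fun y => lin (lact y) (ract b' x))).
  apply: eq_lin => a; case: eqP => _; last first.
    by under eq_lin do rewrite andbF; rewrite lin0f.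
  rewrite -[RHS](@counitlE _ _ _ (fun y => lin (lact a.1) (ract y x))).
  by apply: eq_lin => a'; rewrite andbT.
have -> : \lin_(a <- bcomul b) \lin_(a' <- bcomul b')
  (if (a.1 == bone) && (a'.2 == bone) then lin (ract a'.1) (lact a.2 x) else 0)
  = lin (ract b') (lact b x).
  rewrite -[RHS](@counitlE _ _ _ (fun y => lin (ract b') (lact y x))).
  apply: eq_lin => a; case: eqP => _; last by rewrite lin0f.
  by rewrite -[RHS](@counitrE _ _ _ (fun y => lin (ract y) (lact a.2 x))).
by rewrite ract_lact add0r addr0 subrr.
Qed.

Lemma tens_htp_supp x y : y \in msupp (tens_htp x) ->
  bwt y.1 = (bwt x.1).+1 /\ tens_len x.2 = (tens_len y.2).+1.
Proof.
have : supp_on (fun y => (bwt y.1 == (bwt x.1).+1) && (tens_len x.2 == (tens_len y.2).+1))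
    (tens_htp x).
  case: x => [[b b'] [l l']]; rewrite /tens_htp /bwt /= /tens_wt /=.
  by case: ifP => _; apply: supp_on_lin_in => -[c m] /khtp_supp[/= e1 e2];
    apply: supp_onU; rewrite /tens_len /= e1 e2 ?addnS ?addSn !eqxx.
by move=> /supp_onP h /h /andP[/eqP-> /eqP->].
Qed.

Lemma koszul_dif_len x y : y \in msupp (koszul_dif (@kact k A K) x) ->
  klen y.2 = (klen x.2).+1.
Proof.
have : supp_on (fun y => klen y.2 == (klen x.2).+1) (koszul_dif (@kact k A K) x).
  apply: supp_on_lin_in => a _; apply: supp_on_lin_in => m /kact_len e.
  by apply: supp_onU; rewrite /= e.
by move=> /supp_onP h /h /eqP.
Qed.

Lemma koszul_dif_tens x x' : koszul_dif tens_act (interleave x x')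
  = \lin_(y <- koszul_dif kact x) << interleave y x' >>
    + sgn x.2 *: \lin_(y <- koszul_dif kact x') << interleave x y >>.
Proof.
case: x x' => [b l] [b' l']; rewrite /koszul_dif /=.
pose T a a' : {malg k[(btens A A' * L)%type]} :=
  \lin_(m <- tens_act (a.2, a'.2) (l, l')) << ((a.1, a'.1), m) >>.
transitivity (\lin_(a <- bcomul b) \lin_(a' <- bcomul b') T a a').
  by rewrite tens_comulE.
have TE a a' : T a a' =
    (if a'.2 == bone then \lin_(m <- kact a.2 l) << ((a.1, a'.1), (m, l')) >> else 0)
  + (if a.2 == bone then sgn l *: \lin_(m <- kact a'.2 l') << ((a.1, a'.1), (l, m)) >> else 0).
  rewrite /T /tens_act /= linD.
  by congr (_ + _); case: ifP => _; rewrite ?lin0 ?lin_lact ?lin_ract.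
under eq_lin do under eq_lin do rewrite TE.
under eq_lin do rewrite linDf; rewrite linDf; congr (_ + _).
  rewrite lin_lin; apply: eq_lin => a; rewrite lin_lin.
  under [RHS]eq_lin do rewrite linU.
  exact: (@counitrE _ _ _ (fun y => \lin_(m <- kact a.2 l) << ((a.1, y), (m, l')) >>)).
rewrite exchange_lin lin_lin -linZf; apply: eq_lin => a'; rewrite lin_lin.
under [in RHS]eq_lin do rewrite linU.
exact: (@counitrE _ _ _ (fun y => sgn l *: \lin_(m <- kact a'.2 l') << ((y, a'.1), (l, m)) >>)).
Qed.

Lemma tens_htp_interleave x x' : tens_htp (interleave x x') =
  if x == (bone, kone) then \lin_(y <- khtp x') << interleave x y >>
  else \lin_(y <- khtp x) << interleave y x' >>.
Proof. by case: x x' => [b l] [b' l']. Qed.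

Lemma tens_htpP z : z != (bone, (kone, kone)) ->
  lin (koszul_dif tens_act) (tens_htp z) + lin tens_htp (koszul_dif tens_act z)
  = << z >>.
Proof.
have [x [x' ->]] : exists x x', z = interleave x x'.
  by case: z => -[b b'] [l l']; exists (b, l), (b', l').
move=> nz; rewrite tens_htp_interleave koszul_dif_tens.
have lx := @koszul_dif_len x; have Px := @khtpP _ _ K x.
have Px' := @khtpP _ _ K' x'.
have d1 : x = (bone, kone) -> koszul_dif kact x = 0 :> {malg k[(A * K)%type]}.
  move=> ->; rewrite /koszul_dif /= comul1 linU /=.
  by rewrite kact1 lin0.
move: (koszul_dif kact x) lx Px d1 => dx lx Px d1.
move E' : (koszul_dif kact x') Px' => dx' Px'.
rewrite linD linZ [X in _ + (X + _)]lin_lin [X in _ + (_ + _ *: X)]lin_lin.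
under [X in _ + (X + _)]eq_lin do rewrite linU tens_htp_interleave.
under [X in _ + (_ + _ *: X)]eq_lin do rewrite linU tens_htp_interleave.
have [ex|nx] := altP (x =P (bone, kone)).
  rewrite [X in X + _]lin_lin.
  under [X in X + _]eq_lin do rewrite linU koszul_dif_tens.
  rewrite (d1 ex) [X in _ + (X + _)]lin0 add0r.
  have d0 : koszul_dif kact (bone : A, kone : K) = 0.
    rewrite /koszul_dif /= comul1 linU /=.
    by rewrite kact1 lin0.
  rewrite ex d0; under [X in X + _]eq_lin do rewrite lin0 add0r.
  rewrite linZf -scalerDr /= klen1 expr0 scale1r.
  rewrite -[X in X + _]lin_lin -[X in _ + X]lin_lin -linD Px' ?linU //.
  by apply: contra nz => /eqP->; rewrite ex.
rewrite [X in X + _]lin_lin; under [X in X + _]eq_lin do rewrite linU koszul_dif_tens E'.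
rewrite [X in X + _]linDf.
have -> : \lin_(y <- khtp x) (sgn y.2 *: \lin_(y' <- dx') << interleave y y' >>)
  = - (sgn x.2 *: \lin_(y' <- dx') \lin_(y <- khtp x) << interleave y y' >>)
  :> {malg k[(btens A A' * L)%type]}.
  rewrite exchange_lin -linZf -linNf; apply: eq_in_lin => y /khtp_supp[_ ->].
  by rewrite exprS mulN1r scaleNr opprK.
rewrite [X in _ + (X + _)](_ : _ = \lin_(y <- dx) \lin_(w <- khtp y)
   << interleave w x' >>); last first.
  apply: eq_in_lin => y /lx e; case: eqP => // ey.
  by move: e; rewrite ey klen1.
rewrite addrACA addNr addr0 -[X in X + _]lin_lin -[X in _ + X]lin_lin -linD.
by rewrite (Px nx) linU.
Qed.

Lemma tens_len1 : tens_len (kone, kone) = 0%N.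
Proof. by rewrite /tens_len !klen1. Qed.

Definition ktens : koszul (btens A A') :=
  @Koszul k (btens A A') L (kone, kone) tens_len tens_act tens_htp tens_len1
    tens_act_wt tens_act_len tens_actC tens_act_quad tens_htp_supp tens_htpP.

End TensorModel.

(** * Cohomology classes and the maps they carry *)

Section CohomologyClasses.
Variables (k : fieldType) (X : cosimp k).
Local Notation M := {malg k[sbas X]}.
Implicit Types (x y : M) (h : cohomology X).

Lemma differentialE x :
  differential x = \lin_(t <- x) \sum_(i < (sdim t).+2) (-1) ^+ i *: coface i t.
Proof. by rewrite /differential lextE. Qed.

Lemma differentialP a x y :
  differential (a *: x + y) = a *: differential x + differential y.
Proof. by rewrite !differentialE linD linZ. Qed.

Lemma cocycleP x :
  reflect (normalized x /\ differential x = 0) (x \in @cocycle_pred k X).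
Proof. exact: asboolP. Qed.

Lemma val_cocycle (z : cocycle X) : val z \in @cocycle_pred k X.
Proof. exact: (valP z). Qed.

Lemma corepr_cocycle h : corepr h \in @cocycle_pred k X.
Proof. exact: (valP (repr h)). Qed.

Lemma val_insubd_cocycle x :
  x \in @cocycle_pred k X -> val (insubd (0 : cocycle X) x) = x.
Proof. by move=> hx; rewrite val_insubd hx. Qed.

Lemma insubd_val_cocycle (z : cocycle X) : insubd (0 : cocycle X) (val z) = z.
Proof. exact: valKd. Qed.

Lemma coclass_val (z : cocycle X) : coclass (val z) = qclass _ z.
Proof. by rewrite /coclass insubd_val_cocycle. Qed.

Lemma coreprK h : coclass (corepr h) = h.
Proof. by rewrite coclass_val /qclass reprK. Qed.

Lemma qclass_eq (z z' : cocycle X) :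
  qclass (@coboundary_pred k X) z = qclass _ z' <->
  exists2 y, normalized y & val z - val z' = differential y.
Proof.
rewrite /qclass; split=> [/qclassP/asboolP[y ny e]|[y ny e]].
  by exists y; rewrite -?e // raddfB.
by apply/qclassP/asboolP; exists y => //; rewrite -e raddfB.
Qed.

Lemma coclass_eq x y : x \in @cocycle_pred k X -> y \in @cocycle_pred k X ->
  coclass x = coclass y <->
  exists2 z, normalized z & x - y = differential z.
Proof.
by move=> hx hy; rewrite /coclass qclass_eq !val_insubd_cocycle.
Qed.

Lemma coclassP a x y : x \in @cocycle_pred k X -> y \in @cocycle_pred k X ->
  coclass (a *: x + y) = a *: coclass x + coclass y.
Proof.
move=> hx hy; rewrite /coclass -linearP; congr (qclass _ _); apply: val_inj.
rewrite linearP /= !val_insubd_cocycle //.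
have [[nx dx] [ny dy]] := (cocycleP _ hx, cocycleP _ hy).
apply/cocycleP; split; first exact: normalizedP.
by rewrite differentialP dx dy scaler0 addr0.
Qed.

Variables (V : lmodType k) (phi : {linear M -> V}).
Hypothesis phi_dif : forall y, normalized y -> phi (differential y) = 0.

Definition induced h : V := phi (corepr h).

Lemma induced_coclass x : x \in @cocycle_pred k X -> induced (coclass x) = phi x.
Proof.
move=> hx; have /(coclass_eq (corepr_cocycle _) hx)[y ny e] :=
  coreprK (coclass x).
by apply/eqP; rewrite /induced -subr_eq0 -linearB e phi_dif.
Qed.

Lemma induced_is_linear : linear induced.
Proof.
move=> a h h'; rewrite -[h in LHS]coreprK -[h' in LHS]coreprK -coclassP;
  do ?exact: corepr_cocycle.
rewrite induced_coclass ?linearP //.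
have [[nx dx] [ny dy]] := (cocycleP _ (corepr_cocycle h), cocycleP _ (corepr_cocycle h')).
apply/cocycleP; split; first exact: normalizedP.
by rewrite differentialP dx dy scaler0 addr0.
Qed.

Lemma induced_inj :
  (forall x, x \in @cocycle_pred k X -> phi x = 0 ->
     exists2 y, normalized y & differential y = x) -> injective induced.
Proof.
move=> phi_inj h h' e; rewrite -[h]coreprK -[h']coreprK.
have [cx cy] := (corepr_cocycle h, corepr_cocycle h').
apply/(coclass_eq cx cy).
have [y ny dy] : exists2 y, normalized y & differential y = corepr h - corepr h'.
  apply: phi_inj; last by rewrite linearB; apply/eqP; rewrite subr_eq0; apply/eqP.
  by rewrite rpredB.
by exists y.
Qed.

End CohomologyClasses.

(** * The coHochschild complex as a complex of words *)

Section Degenerate.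
Variable B : choiceType.
Implicit Types (s t : seq B) (e : B).

Definition del i s := take i s ++ drop i.+1 s.

Lemma del_inj e i s t : (i < size s)%N -> (i < size t)%N ->
  nth e s i = nth e t i -> del i s = del i t -> s = t.
Proof.
move=> hs ht en ed; rewrite -(cat_take_drop i s) -(cat_take_drop i t).
rewrite (drop_nth e hs) (drop_nth e ht) en.
have /eqP : take i s ++ drop i.+1 s = take i t ++ drop i.+1 t := ed.
by rewrite eqseq_cat ?size_take ?hs ?ht // => /andP[/eqP-> /eqP->].
Qed.

End Degenerate.

Section GradedCoalgebra.
Variables (k : fieldType) (A : bcoalg k) (deg : A -> nat).
Implicit Types (b c : A) (u v w : seq A).

Definition coalg_of : coalg k nat :=
  @Coalg k nat A deg bcomul (fun b => (b == bone)%:R).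

Local Notation X := (coTHH coalg_of).
Local Notation chain := {malg k[seq A]}.

Hypothesis deg_sgn : forall b c, bsgn b c = (-1) ^+ (deg b * deg c).

Lemma wsgn_deg b w : wsgn b w = (-1) ^+ (deg b * @wdeg k coalg_of w).
Proof.
rewrite /wsgn /wdeg; elim: w => [|c w IH]; rewrite ?big_nil ?muln0 //.
by rewrite !big_cons IH deg_sgn mulnDr exprD.
Qed.

Lemma inner_cofaceE i w : inner_coface i w =
  if drop i w is b :: r then \lin_(a <- bcomul b) << take i w ++ [:: a.1, a.2 & r] >>
  else 0.
Proof.
elim: w i => [|b r IH] [|i] //=; rewrite IH.
case: (drop i r) => [|c s]; first exact: lin0.
by rewrite cons_chain_lin; apply: eq_lin => a; rewrite cons_chainU.
Qed.

Lemma coTHH_cofaceE i w : @coTHH_coface k coalg_of i w = wcoface i w.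
Proof.
rewrite /coTHH_coface /wcoface inner_cofaceE !lextE.
have [iw|wi] := ltnP i (size w); last first.
  rewrite drop_oversize //; case: w wi => [|b r] wi //=.
  by apply: eq_lin => a; rewrite wsgn_deg.
by case e : (drop i w) => [|b r] //; have := congr1 size e;
   rewrite size_drop /= => /eqP; rewrite subn_eq0 leqNgt iw.
Qed.

Lemma differential_coTHH (x : chain) : supp_on (fun w => w != [::]) x ->
  @differential k X x = lin (@wdif k A) x.
Proof.
move=> hx; rewrite differentialE; apply: eq_lin_on hx _ => -[|b r] // _.
by rewrite /wdif /=; apply: eq_bigr => i _; rewrite coTHH_cofaceE.
Qed.

Lemma coTHH_codegenE i w : (i < (size w).-1)%N ->
  @coTHH_codegen k coalg_of i w = (nth bone w i.+1 == bone)%:R *: << del i.+1 w >>.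
Proof.
move=> iw; have iw' : (i.+1 < size w)%N by case: w iw => [|b r] //=; rewrite ltnS.
by rewrite /coTHH_codegen (drop_nth bone iw').
Qed.

Lemma normal_nth w : normal_word w ->
  forall i, (i < (size w).-1)%N -> nth bone w i.+1 != bone.
Proof. by case: w => [|b r] //= /allP h i ir; apply: h; apply: mem_nth. Qed.

Lemma nth_normal w : w != [::] ->
  (forall i, (i < (size w).-1)%N -> nth bone w i.+1 != bone) -> normal_word w.
Proof.
case: w => [|b r] //= _ h; apply/(all_nthP bone) => i; exact: h.
Qed.

(** A codegeneracy deletes a letter if it is the unit.  Words with the unit at
   the same place remain distinct when it is deleted, so all of them have
   coefficient zero in a normalized cochain. *)
Lemma normalized_coTHH (x : chain) :
  @normalized k X x <-> supp_on (@normal_word k A) x.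
Proof.
split=> [[cx sx]|hx].
  apply/supp_onP => w wx; apply: nth_normal => [|i iw]; first exact: cx.
  apply/eqP => e; have := congr1 (mcoeff (del i.+1 w)) (sx i).
  rewrite /codegeneracy lextE mcoeff0 (@mcoeff_linM _ _ _ _ _ _ w) /=.
    rewrite iw coTHH_codegenE // e eqxx scale1r mcoeff_basis eqxx mulr1 => /eqP.
    by rewrite mcoeff_eq0 wx.
  move=> s sx' sw; case: ifP => [si|_]; last by rewrite mcoeff0.
  rewrite coTHH_codegenE // mcoeffZ mcoeff_basis.
  case: (altP (nth bone s i.+1 =P bone)) => [en|_]; last by rewrite mul0r.
  case: eqP => [ed|_]; last by rewrite mulr0.
  case/eqP: sw; apply: (@del_inj _ bone i.+1) => //; last by rewrite en e.
    by case: (s) si => //= ? ?; rewrite ltnS.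
  by case: (w) iw => //= ? ?; rewrite ltnS.
split=> [w wx|i].
  by have := supp_onP _ _ hx w wx; case: w {wx}.
rewrite /codegeneracy lextE -[RHS](lin0f _ x); apply: eq_lin_on hx _ => w nw.
by case: ifP => iw //=; rewrite coTHH_codegenE // (negPf (normal_nth nw iw)) scale0r.
Qed.

Lemma cocycle_coTHH (x : chain) : reflect
  (supp_on (@normal_word k A) x /\ lin (@wdif k A) x = 0) (x \in @cocycle_pred k X).
Proof.
have ne (y : chain) : supp_on (@normal_word k A) y -> supp_on (fun w => w != [::]) y.
  by apply: sub_supp_on => -[].
apply: (iffP (cocycleP _)) => -[].
  by move=> /normalized_coTHH hx; rewrite differential_coTHH ?ne.
move=> hx dx; rewrite differential_coTHH ?ne //; split => //.
exact/normalized_coTHH.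
Qed.

Variable K : koszul A.
Local Notation hev := (@head_eval k A K).

Definition model_map : cohomology X -> {malg k[(A * K)%type]} :=
  @induced k X _ (lin hev).

Lemma hev_differential (y : chain) : @normalized k X y ->
  lin hev (@differential k X y) = 0.
Proof.
move=> /normalized_coTHH hy; rewrite differential_coTHH ?head_eval_wdif_chain //.
by apply: sub_supp_on hy => -[].
Qed.

Lemma model_map_coclass (x : chain) : x \in @cocycle_pred k X ->
  model_map (@coclass k X x) = lin hev x.
Proof. by move=> hx; rewrite /model_map induced_coclass //; apply: hev_differential. Qed.

Lemma model_map_linear : linear model_map.
Proof. by apply: induced_is_linear; apply: hev_differential. Qed.

Lemma model_map_inj : injective model_map.
Proof.
apply: induced_inj => x /cocycle_coTHH[hx dx] ex.
have [y [hy dy _]] := head_eval_inj hx dx ex.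
exists y; first exact/normalized_coTHH.
by rewrite differential_coTHH //; apply: sub_supp_on hy => -[].
Qed.

Lemma model_map_surj y : exists h, model_map h = y.
Proof.
have [x [hx dx ex]] := head_eval_surj y; exists (@coclass k X x).
by rewrite model_map_coclass //; apply/cocycle_coTHH.
Qed.

End GradedCoalgebra.

(** * The diagonal complex as a complex of words of pairs *)

Section Diagonal.
Variables (k : fieldType) (A : bcoalg k) (deg : A -> nat).
Hypothesis deg_sgn : forall b c, bsgn b c = (-1) ^+ (deg b * deg c).
Implicit Types (b c : A) (u v w : seq A).

Local Notation X := (coTHH (coalg_of deg)).
Local Notation T := (btens A A).
Local Notation pair_chain := {malg k[(seq A * seq A)%type]}.
Local Notation chain2 := {malg k[seq T]}.

Definition zip_word (t : seq A * seq A) : seq T := zip t.1 t.2.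

Definition zip_chain (t : seq A * seq A) : chain2 := << zip_word t >>.

Definition unzip_chain (s : seq T) : pair_chain := << (unzip1 s, unzip2 s) >>.

(** The words of pairs correspond to the pairs of words of equal length, which
   are the basis of the diagonal. *)
Definition paired (t : seq A * seq A) := (t.1 != [::]) && (size t.1 == size t.2).

Definition paired_normal t := paired t && normal_word (zip_word t).

Lemma zip_unzip_chain (y : chain2) : lin zip_chain (lin unzip_chain y) = y.
Proof.
rewrite lin_lin -[RHS]lin_id; apply: eq_lin => s; rewrite linU.
by rewrite /zip_chain /zip_word zip_unzip.
Qed.

Lemma unzip_zip_chain (x : pair_chain) : supp_on paired x ->
  lin unzip_chain (lin zip_chain x) = x.
Proof.
move=> hx; rewrite lin_lin -[RHS]lin_id; apply: eq_lin_on hx _ => -[u v].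
case/andP=> _ /eqP /= e; rewrite linU /unzip_chain /zip_word /=.
by rewrite unzip1_zip ?unzip2_zip ?e.
Qed.

Lemma lin_zip_mtens (x y : {malg k[seq A]}) :
  lin zip_chain (mtens x y) = \lin_(u <- x) \lin_(v <- y) << zip_word (u, v) >>.
Proof. exact: lin_mtens. Qed.

Lemma zip_inner i u v : size u = size v ->
  lin zip_chain (mtens (inner_coface i u) (inner_coface i v))
  = inner_coface i (zip_word (u, v)).
Proof.
rewrite lin_zip_mtens; elim: u v i => [|b u IH] [|c v] // [|i] => [_|_|[e]|[e]] /=;
  rewrite ?lin0 //.
  rewrite lin_lin [RHS](tens_comulE (fun a : T * T => << [:: a.1, a.2 & zip u v] >>)).
  apply: eq_lin => a; rewrite linU lin_lin; apply: eq_lin => a'.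
  by rewrite linU.
rewrite -(IH _ _ e) lin_cons_chain /cons_chain lin_lin; apply: eq_lin => u'.
rewrite !lin_lin; apply: eq_lin => v'.
by rewrite !linU.
Qed.

Lemma wsgn_zip (a : T) u v : size u = size v ->
  wsgn a (zip_word (u, v)) = wsgn a.1 u * wsgn a.2 v.
Proof.
elim: u v => [|b u IH] [|c v] // => [_|[e]]; first by rewrite /wsgn !big_nil mulr1.
by rewrite /zip_word /= !wsgn_cons [wsgn _ _]IH // mulrACA.
Qed.

(** Moving a pair of letters across a word of pairs costs the product of the
   signs for the two words. *)
Lemma zip_outer u v : size u = size v ->
  lin zip_chain (mtens (outer_coface u) (outer_coface v))
  = outer_coface (zip_word (u, v)).
Proof.
rewrite lin_zip_mtens; case: u v => [|b u] [|c v] // => [_|[e]] /=; first by rewrite lin0.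
rewrite lin_lin [RHS](tens_comulE (fun a : T * T =>
   wsgn a.1 (a.2 :: zip u v) *: << rcons (a.2 :: zip u v) a.1 >>)).
apply: eq_lin => a; rewrite linZ linU lin_lin -linZf; apply: eq_lin => a'.
rewrite linZ linU scalerA /=; congr (_ *: _); last first.
  by rewrite /zip_word /= zip_rcons.
have es : size (a.2 :: u) = size (a'.2 :: v) by rewrite /= e.
by rewrite -(wsgn_zip (a.1, a'.1) es).
Qed.

Lemma zip_coface i u v : size u = size v ->
  lin zip_chain (mtens (wcoface i u) (wcoface i v)) = wcoface i (zip_word (u, v)).
Proof.
move=> e; rewrite /wcoface /zip_word size_zip -e minnn.
by case: ifP => _; [apply: zip_inner | apply: zip_outer].
Qed.

Definition pair_dif (t : seq A * seq A) : pair_chain :=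
  \sum_(i < (size t.1).+1) (-1) ^+ i *: mtens (wcoface i t.1) (wcoface i t.2).

Lemma differential_diag (x : pair_chain) : supp_on paired x ->
  @differential k (diag X X) x = lin pair_dif x.
Proof.
move=> hx; rewrite differentialE; apply: eq_lin_on hx _ => -[[|b u] v]; first by case/andP.
move=> _; rewrite /pair_dif /=; apply: eq_bigr => i _.
by rewrite !coTHH_cofaceE.
Qed.

Lemma zip_pair_dif (x : pair_chain) : supp_on paired x ->
  lin zip_chain (lin pair_dif x) = lin (@wdif k T) (lin zip_chain x).
Proof.
move=> hx; rewrite !lin_lin; apply: eq_lin_on hx _ => -[u v] /andP[_ /eqP/= e].
rewrite linU /wdif lin_sum /zip_word size_zip -e minnn.
by apply: eq_bigr => i _; rewrite linZ zip_coface.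
Qed.

Lemma paired_pair_dif (x : pair_chain) : supp_on paired x ->
  supp_on paired (lin pair_dif x).
Proof.
move=> hx; apply: supp_on_lin hx _ => -[u v] /andP[_ /eqP/= e].
apply: supp_on_sum => i _; apply: supp_onZ.
apply: sub_supp_on (supp_on_mtens (wcoface_size i u) (wcoface_size i v)) => -[s t].
by rewrite /paired /has_size /= => /andP[/eqP es /eqP et]; rewrite es et e -size_eq0 es eqxx.
Qed.

Lemma diag_codegenE i u v : size u = size v -> (i < (size u).-1)%N ->
  mtens (@coTHH_codegen k (coalg_of deg) i u) (@coTHH_codegen k (coalg_of deg) i v)
  = (nth bone (zip_word (u, v)) i.+1 == bone)%:R *: << (del i.+1 u, del i.+1 v) >>.
Proof.
move=> e iu; rewrite !coTHH_codegenE -?e // mtensZl mtensZr mtensUU scalerA.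
by rewrite -natrM mulnb /zip_word nth_zip.
Qed.

(** As for coTHH: a codegeneracy of the diagonal vanishes unless both words have
   the unit at the same place. *)
Lemma normalized_diag (x : pair_chain) :
  @normalized k (diag X X) x <-> supp_on paired_normal x.
Proof.
have cellE (t : seq A * seq A) : @cell k (diag X X) t = paired t.
  case: t => -[|b u] [|c v] //=; by rewrite /paired /= eqSS.
split=> [[cx sx]|hx].
  apply/supp_onP => -[u v] wx; have /andP[/= nu /eqP e] : paired (u, v).
    by rewrite -cellE; apply: cx.
  have ez : size (zip_word (u, v)) = size u by rewrite size_zip -e minnn.
  rewrite /paired_normal /paired /= nu e eqxx /=.
  apply: nth_normal => [|i]; first by rewrite -size_eq0 ez size_eq0.
  rewrite ez => iw; apply/eqP => en; have iw' : (i.+1 < size u)%N.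
    by case: (u) iw => //= ? ?; rewrite ltnS.
  have := congr1 (mcoeff (del i.+1 u, del i.+1 v)) (sx i).
  rewrite /codegeneracy lextE mcoeff0 (@mcoeff_linM _ _ _ _ _ _ (u, v)).
    rewrite /= iw diag_codegenE // en eqxx scale1r mcoeff_basis eqxx mulr1.
    by move=> /eqP; rewrite mcoeff_eq0 wx.
  move=> [s t] sx' sw; case: ifP => [si|_]; last by rewrite mcoeff0.
  have /andP[_ /eqP/= est] : paired (s, t) by rewrite -cellE; apply: cx.
  have si' : (i.+1 < size s)%N by case: (s) si => //= ? ?; rewrite ltnS.
  rewrite diag_codegenE // mcoeffZ mcoeff_basis.
  case: eqP => [es|_]; last by rewrite mul0r.
  case: eqP => [[ed ed']|_]; last by rewrite mulr0.
  move: es en; rewrite /zip_word !nth_zip //= => -[es1 es2] [eu1 eu2].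
  case/eqP: sw; congr (_, _).
    by apply: (@del_inj _ bone i.+1); rewrite ?es1 ?eu1.
  by apply: (@del_inj _ bone i.+1); rewrite -?est -?e ?es2 ?eu2.
split=> [w wx|i].
  by rewrite cellE; have /andP[] := supp_onP _ _ hx w wx.
rewrite /codegeneracy lextE -[RHS](lin0f _ x); apply: eq_lin_on hx _ => -[u v].
case/andP=> /andP[/= nu /eqP/= e] nw; case: ifP => // iw.
have iz : (i < (size (zip_word (u, v))).-1)%N by rewrite size_zip -e minnn.
by rewrite /= diag_codegenE // (negPf (normal_nth nw iz)) scale0r.
Qed.

Lemma paired_normal_paired (x : pair_chain) :
  supp_on paired_normal x -> supp_on paired x.
Proof. by apply: sub_supp_on => t /andP[]. Qed.

Lemma zip_normal (x : pair_chain) : supp_on paired_normal x ->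
  supp_on (@normal_word k T) (lin zip_chain x).
Proof. by move=> hx; apply: supp_on_lin hx _ => t /andP[_ nt]; apply: supp_onU. Qed.

Lemma cocycle_diag (x : pair_chain) : reflect
  (supp_on paired_normal x /\ lin (@wdif k T) (lin zip_chain x) = 0)
  (x \in @cocycle_pred k (diag X X)).
Proof.
apply: (iffP (cocycleP _)) => -[].
  move=> /normalized_diag hx; have px := paired_normal_paired hx.
  by rewrite differential_diag // -zip_pair_dif // => ->; rewrite lin0.
move=> hx dx; have px := paired_normal_paired hx.
split; first exact/normalized_diag.
rewrite differential_diag // -[LHS]unzip_zip_chain ?paired_pair_dif //.
by rewrite zip_pair_dif // dx lin0.
Qed.

Variable K : koszul A.
Local Notation hev2 := (@head_eval k T (ktens K K)).

Definition pair_eval (t : seq A * seq A) : {malg k[(T * ktens K K)%type]} :=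
  hev2 (zip_word t).

Lemma lin_pair_eval (x : pair_chain) :
  lin pair_eval x = lin hev2 (lin zip_chain x).
Proof. by rewrite lin_lin; apply: eq_lin => t; rewrite linU. Qed.

Definition diag_map : cohomology (diag X X) -> {malg k[(T * ktens K K)%type]} :=
  @induced k (diag X X) _ (lin pair_eval).

Lemma pair_eval_differential (y : pair_chain) : @normalized k (diag X X) y ->
  lin pair_eval (@differential k (diag X X) y) = 0.
Proof.
move=> /normalized_diag hy; have py := paired_normal_paired hy.
rewrite differential_diag // lin_pair_eval zip_pair_dif //.
by rewrite head_eval_wdif_chain // zip_normal.
Qed.

Lemma diag_map_coclass (x : pair_chain) : x \in @cocycle_pred k (diag X X) ->
  diag_map (@coclass k (diag X X) x) = lin pair_eval x.
Proof.
by move=> hx; rewrite /diag_map induced_coclass //; apply: pair_eval_differential.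
Qed.

Lemma diag_map_linear : linear diag_map.
Proof. by apply: induced_is_linear; apply: pair_eval_differential. Qed.

Lemma diag_map_inj : injective diag_map.
Proof.
apply: induced_inj => x /cocycle_diag[hx dx].
rewrite /= lin_pair_eval => ex.
have [y [hy dy _]] := @head_eval_inj k T (ktens K K) _ (zip_normal hx) dx ex.
have hy' : supp_on paired_normal (lin unzip_chain y).
  apply: supp_on_lin hy _ => s ns; apply: supp_onU.
  rewrite /paired_normal /zip_word /= zip_unzip ns /paired /= !size_map eqxx.
  by case: s ns.
exists (lin unzip_chain y); first exact/normalized_diag.
have py := paired_normal_paired hy'.
rewrite differential_diag // -[LHS]unzip_zip_chain ?paired_pair_dif //.
by rewrite zip_pair_dif // zip_unzip_chain dy unzip_zip_chain // paired_normal_paired.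
Qed.

End Diagonal.

(** * The Alexander-Whitney map on words *)

Lemma iter_linE (k : fieldType) (S : choiceType) (f : S -> {malg k[S]}) n x :
  \lin_(s <- x) iter n (lin f) << s >> = iter n (lin f) x.
Proof.
elim: n => [|n IH] /=; first exact: lin_id.
by rewrite -IH lin_lin.
Qed.

Lemma iter_lin_sum (k : fieldType) (S : choiceType) (f : S -> {malg k[S]}) n
    (m : nat) (c : nat -> k) (F : nat -> {malg k[S]}) :
  iter n (lin f) (\sum_(i < m) c i *: F i)
  = \sum_(i < m) c i *: iter n (lin f) (F i).
Proof.
rewrite -iter_linE lin_sum; apply: eq_bigr => i _.
by rewrite linZ iter_linE.
Qed.

Lemma mtens_suml (k : fieldType) (S U : choiceType) m (c : nat -> k)
    (F : nat -> {malg k[S]}) (y : {malg k[U]}) :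
  mtens (\sum_(i < m) c i *: F i) y = \sum_(i < m) c i *: mtens (F i) y.
Proof.
elim: m => [|m IH]; first by rewrite !big_ord0 mtens0l.
by rewrite !big_ord_recr /= mtensDl IH mtensZl.
Qed.

Lemma mtens_sumr (k : fieldType) (S U : choiceType) m (c : nat -> k)
    (F : nat -> {malg k[S]}) (y : {malg k[U]}) :
  mtens y (\sum_(i < m) c i *: F i) = \sum_(i < m) c i *: mtens y (F i).
Proof.
elim: m => [|m IH]; first by rewrite !big_ord0 mtens0r.
by rewrite !big_ord_recr /= mtensDr IH mtensZr.
Qed.

Section AlexanderWhitney.
Variables (k : fieldType) (A : bcoalg k).
Implicit Types (b c : A) (u v w t : seq A).
Local Notation chain := {malg k[seq A]}.
Local Notation L := (lin (@outer_coface k A)).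
Local Notation F := (lin (@inner_coface k A 0)).
Implicit Types (x y : chain).

Lemma outer_chain_size n q x : supp_on (has_size n) x ->
  supp_on (has_size (n + q)%N) (iter q L x).
Proof.
move=> hx; elim: q => [|q IH] /=; first by rewrite addn0.
by apply: supp_on_lin IH _ => w /eqP e; rewrite addnS -e; apply: outer_coface_size.
Qed.

Lemma inner_chain_size n p x : supp_on (has_size n) x ->
  supp_on (has_size (n + p)%N) (iter p F x).
Proof.
move=> hx; elim: p => [|p IH]; first by rewrite /= addn0.
by rewrite iterS; apply: supp_on_lin IH _ => w /eqP e; rewrite addnS -e; apply: inner_coface_size.
Qed.

Lemma inner_iter_outer i n q x : supp_on (has_size n) x -> (i < n)%N ->
  lin (inner_coface i) (iter q L x) = iter q L (lin (inner_coface i) x).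
Proof.
move=> hx i_n; elim: q => [|q IH] //=; rewrite -IH !lin_lin.
apply: eq_lin_on (outer_chain_size q hx) _ => w /eqP ew.
by rewrite outer_inner // ew (leq_trans i_n) ?leq_addr.
Qed.

(** The iterated last coface only splits the original head, and each coface
   beyond the end of the original word splits one of the letters coming from it
   once more; by coassociativity, it does not matter which one. *)
Lemma wcoface_iter_outer i n q x : supp_on (has_size n) x ->
  (n <= i)%N -> (i <= n + q)%N ->
  lin (wcoface i) (iter q L x) = iter q.+1 L x.
Proof.
move=> hx ni; elim: q => [|q IH] iq.
  rewrite /=; apply: eq_lin_on hx _ => w /eqP ew.
  by rewrite /wcoface ew ltnNge ni.
have hq := outer_chain_size q hx.
move: iq; rewrite leq_eqVlt => /orP[/eqP->|]; last rewrite addnS ltnS.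
  rewrite [iter q.+2 _ _]/=; apply: eq_lin_on (outer_chain_size q.+1 hx) _ => w /eqP ew.
  by rewrite /wcoface ew ltnn.
move=> iq; rewrite iterS lin_lin.
transitivity (\lin_(w <- iter q L x) L (wcoface i w)).
  apply: eq_lin_on hq _ => w /eqP ew; rewrite -[RHS]/(L (wcoface i w)).
  transitivity (lin (inner_coface i) (outer_coface w)).
    apply: eq_lin_on (outer_coface_size w) _ => u /eqP eu.
    by rewrite /wcoface eu ltnS ew iq.
  move: iq; rewrite -ew leq_eqVlt /wcoface => /orP[/eqP->|iw].
    by rewrite ltnn outer_outer.
  by rewrite iw outer_inner.
by rewrite -lin_lin IH.
Qed.

(** By coassociativity, it does not matter which of the letters coming from the
   head is split once more. *)
Lemma inner_iter_first i p x : (i <= p)%N ->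
  lin (inner_coface i) (iter p F x) = iter p.+1 F x.
Proof.
elim: p i => [|p IH] [|i] // ip; rewrite iterS lin_lin.
under eq_lin do rewrite inner_inner //=.
by rewrite -lin_lin IH.
Qed.

Lemma wcoface_iter_first i p m x : supp_on (has_size m) x -> (0 < m)%N ->
  (i <= m)%N ->
  lin (wcoface (p + i)%N) (iter p F x) = iter p F (lin (wcoface i) x).
Proof.
move=> hx m0 im; elim: p => [|p IH] //; rewrite [in LHS]iterS lin_lin.
rewrite iterS -IH lin_lin; apply: eq_lin_on (inner_chain_size p hx) _ => w /eqP ew.
have w0 : (0 < size w)%N by rewrite ew addn_gt0 m0.
transitivity (lin (wcoface (p + i).+1%N) (wcoface 0 w)); first by rewrite /wcoface w0.
rewrite wcoface_wcoface //; last by rewrite ltnS ew addnC leq_add2r.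
apply: eq_lin_on (wcoface_size _ w) _ => u /eqP eu.
by rewrite /wcoface eu.
Qed.

Definition aw t u : {malg k[(seq A * seq A)%type]} :=
  mtens (iter (size u).-1 L << t >>) (iter (size t).-1 F << u >>).

Lemma aw_size t u : t != [::] -> u != [::] ->
  supp_on (fun s => (size s.1 == (size t + size u).-1)%N
                 && (size s.2 == (size t + size u).-1)%N) (aw t u).
Proof.
move=> nt nu.
have ht : supp_on (has_size (size t)) (<< t >> : chain) by apply: supp_onU; apply: eqxx.
have hu : supp_on (has_size (size u)) (<< u >> : chain) by apply: supp_onU; apply: eqxx.
apply: sub_supp_on (supp_on_mtens (outer_chain_size (size u).-1 ht)
  (inner_chain_size (size t).-1 hu)) => -[s s'] /andP[/eqP e /eqP e'].
rewrite /= e e'; case: t u nt nu {ht hu e e'} => [|b t] [|c u] // _ _ /=.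
by rewrite addnS addSn /= addSn addnC !eqxx.
Qed.

(** As many cofaces as t has letters act on t and only lengthen the iterated
   first coface of u; the others act on u and only lengthen the iterated last
   coface of t.  The last coface of t and the first coface of u, which give the
   same term with opposite signs, are added on the right. *)
Lemma pair_dif_aw t u : t != [::] -> u != [::] ->
  lin (@pair_dif k A) (aw t u)
  = \lin_(t' <- wdif t) aw t' u
    + (-1) ^+ (size t).-1 *: \lin_(u' <- wdif u) aw t u'.
Proof.
move=> nt nu; have [p ep] : exists p, size t = p.+1.
  by case: t nt => // b t _; exists (size t).
have [q eq] : exists q, size u = q.+1 by case: u nu => // b u _; exists (size u).
have ht : supp_on (has_size p.+1) (<< t >> : chain).
  by apply: supp_onU; apply/eqP.
have hu : supp_on (has_size q.+1) (<< u >> : chain).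
  by apply: supp_onU; apply/eqP.
pose a := iter q L << t >>; pose b := iter p F << u >>.
pose a' := iter q.+1 L << t >>; pose b' := iter p.+1 F << u >>.
have E1 : \lin_(t' <- wdif t) aw t' u
    = \sum_(i < p.+2) (-1) ^+ i *: mtens (iter q L (wcoface i t)) b'.
  transitivity (\lin_(t' <- wdif t) mtens (iter q L << t' >>) b').
    apply: eq_lin_on (wdif_size t) _ => t' /eqP et.
    by rewrite /aw et ep eq.
  rewrite -mtens_linl iter_linE /wdif ep.
  by rewrite (@iter_lin_sum _ _ _ _ _ (fun i => (-1) ^+ i) (fun i => wcoface i t))
    (@mtens_suml _ _ _ _ (fun i => (-1) ^+ i) (fun i => iter q L (wcoface i t))).
have E2 : \lin_(u' <- wdif u) aw t u'
    = \sum_(i < q.+2) (-1) ^+ i *: mtens a' (iter p F (wcoface i u)).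
  transitivity (\lin_(u' <- wdif u) mtens a' (iter p F << u' >>)).
    apply: eq_lin_on (wdif_size u) _ => u' /eqP eu.
    by rewrite /aw eu ep eq.
  rewrite -mtens_linr iter_linE /wdif eq.
  by rewrite (@iter_lin_sum _ _ _ _ _ (fun i => (-1) ^+ i) (fun i => wcoface i u))
    (@mtens_sumr _ _ _ _ (fun i => (-1) ^+ i) (fun i => iter p F (wcoface i u))).
have E0 : lin (@pair_dif k A) (aw t u)
    = \sum_(i < p.+1 + q.+1) (-1) ^+ i *: mtens (lin (wcoface i) a) (lin (wcoface i) b).
  transitivity (\lin_(s <- aw t u) \sum_(i < p.+1 + q.+1)
     (-1) ^+ i *: mtens (wcoface i s.1) (wcoface i s.2)).
    apply: eq_lin_on (aw_size nt nu) _ => s /andP[/eqP es _].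
    by rewrite /pair_dif es ep eq addSn addnS.
  rewrite lin_sumf; apply: eq_bigr => i _; rewrite linZf mtens_lin2.
  by rewrite /aw ep eq.
have low1 (i : 'I_p.+1) : lin (wcoface i) a = iter q L (wcoface i t).
  transitivity (lin (inner_coface i) a).
    apply: eq_lin_on (outer_chain_size q ht) _ => w /eqP ew.
    by rewrite /wcoface ew ltn_addr.
  by rewrite /a (inner_iter_outer _ ht) // linU /wcoface ep ltn_ord.
have low2 (i : 'I_p.+1) : lin (wcoface i) b = b'.
  transitivity (lin (inner_coface i) b).
    apply: eq_lin_on (inner_chain_size p hu) _ => w /eqP ew.
    by rewrite /wcoface ew addSnnS addnC (leq_trans (ltn_ord i)) ?leq_addr.
  by rewrite /b inner_iter_first // -ltnS.
have high1 (j : 'I_q.+1) : lin (wcoface (p.+1 + j)%N) a = a'.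
  by rewrite /a (wcoface_iter_outer ht) ?leq_addr // leq_add2l -ltnS.
have high2 (j : 'I_q.+1) : lin (wcoface (p.+1 + j)%N) b = iter p F (wcoface j.+1 u).
  by rewrite /b addSnnS (wcoface_iter_first _ hu) // linU.
have top : iter q L (wcoface p.+1 t) = a'.
  by rewrite /wcoface ep ltnn /a' iterSr /= linU.
have bot : iter p F (wcoface 0 u) = b' by rewrite /wcoface eq /b' iterSr /= linU.
rewrite E0 [X in _ = X + _]E1 [X in _ = _ + _ *: X]E2 {E0 E1 E2} ep [p.+1.-1]/=.
rewrite big_split_ord [X in _ = X + _]big_ord_recr.
rewrite [X in _ = _ + _ *: X]big_ord_recl expr0 scale1r scalerDr -addrA.
rewrite [iter q L _]top [iter p F _]bot [in X in _ = _ + X]exprS mulN1r scaleNr.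
rewrite [X in _ = _ + X]addKr scaler_sumr.
apply: f_equal2; apply: eq_bigr => j _; first by rewrite /= low1 low2.
rewrite [nat_of_ord (rshift _ _)]/= high1 high2.
by rewrite scalerA -exprD /= /bump /= add1n addnS addSn.
Qed.

Lemma outer_tail t v q : behead t = v -> t != [::] ->
  supp_on (fun s => [&& s != [::], (size s == size t + q)%N & take (size v) (behead s) == v])
    (iter q L << t >>).
Proof.
move=> tv nt; elim: q => [|q IH] /=.
  by apply: supp_onU; rewrite nt addn0 tv take_size !eqxx.
apply: supp_on_lin IH _ => -[|b r] // /and3P[_ /eqP es /eqP ev].
apply: supp_on_lin_in => a _; apply/supp_onZ/supp_onU; rewrite /= size_rcons addnS -es eqxx.
rewrite -cats1 takel_cat ?ev //=; move: es.
by case: t tv nt => //= c t <- _; rewrite addSn => -[->]; rewrite leq_addr.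
Qed.

Lemma inner_tail t v p : behead t = v -> t != [::] ->
  supp_on (fun s => [&& s != [::], (size s == size t + p)%N & drop p (behead s) == v])
    (iter p F << t >>).
Proof.
move=> tv nt; elim: p => [|p IH].
  by apply: supp_onU; rewrite nt addn0 drop0 tv !eqxx.
rewrite iterS; apply: supp_on_lin IH _ => -[|b r] // /and3P[_ /eqP es /eqP ev].
apply: supp_on_lin_in => a _; apply/supp_onU; rewrite /= addnS -es eqxx.
by rewrite /= in ev; rewrite ev eqxx.
Qed.

Lemma paired_normal_aw t u : normal_word t -> normal_word u ->
  supp_on (@paired_normal k A) (aw t u).
Proof.
case: t u => [|c v] [|c' v'] // nv nv'.
apply: sub_supp_on (supp_on_mtens (outer_tail (t := c :: v) (size v') erefl isT)
  (inner_tail (t := c' :: v') (size v) erefl isT)) => -[[|b s] [|b' s']] //; first by rewrite andbF.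
case/andP=> /and3P[_ /eqP[es] /eqP ev] /and3P[_ /eqP[es'] /eqP ev'].
rewrite /paired_normal /paired /zip_word /=.
rewrite es es' addnC eqxx /=; apply/(all_nthP ((bone, bone) : btens A A)) => i.
rewrite size_zip es es' [(size v' + _)%N]addnC minnn => iv.
rewrite nth_zip ?es ?es' // 1?addnC // /nonunit xpair_eqE.
move: ev ev' => /= ev ev'; have [iv1|iv1] := ltnP i (size v).
  rewrite negb_and -(nth_take _ iv1) ev; apply/orP; left.
  exact: (allP nv _ (mem_nth _ iv1)).
rewrite negb_and; apply/orP; right.
rewrite -(subnKC iv1) -nth_drop ev'; apply: (allP nv'); apply: mem_nth.
by rewrite ltn_subLR.
Qed.

Local Notation isone := (fun b : A => b == bone).

(** The counit removes the units split off the head, and the sign for moving a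
   unit is trivial. *)
Lemma strip_outer (V : lmodType k) (G : A -> V) c v q :
  \lin_(s <- iter q L << c :: v >>)
    (if all isone (drop (size v) (behead s)) then G (head bone s) else 0) = G c.
Proof.
elim: q => [|q IH]; first by rewrite /= linU /= drop_size.
rewrite iterS lin_lin -[RHS]IH.
apply: eq_lin_on (outer_tail (t := c :: v) q erefl isT) _ => -[|b r] // /and3P[_ /eqP[es] _].
rewrite lin_lin -[RHS](@counitlE _ _ _ (fun z => if all isone (drop (size v) r) then G z else 0)).
apply: eq_lin => a; rewrite linZ linU /= -cats1 drop_cat.
have vr : (size v <= size r)%N by rewrite es leq_addr.
case: (ltnP (size v) (size r)) => vr'.
  rewrite all_cat /= andbT; case: eqP => [->|_]; last by rewrite andbF scaler0.
  by rewrite andbT wsgn1 scale1r.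
have e : size v = size r by apply/eqP; rewrite eqn_leq vr.
rewrite e subnn drop0 drop_size /= andbT; case: eqP => [->|_]; last by rewrite scaler0.
by rewrite wsgn1 scale1r.
Qed.

Lemma strip_inner (V : lmodType k) (G : A -> V) c v p :
  \lin_(s <- iter p F << c :: v >>)
    (if all isone (take p (behead s)) then G (head bone s) else 0) = G c.
Proof.
elim: p => [|p IH]; first by rewrite /= linU /= take0.
rewrite iterS lin_lin -[RHS]IH.
apply: eq_lin_on (inner_tail (t := c :: v) p erefl isT) _ => -[|b r] // _.
rewrite lin_lin -[RHS](@counitrE _ _ _ (fun z => if all isone (take p r) then G z else 0)).
by apply: eq_lin => a; rewrite linU /=; case: eqP.
Qed.

Variable K : koszul A.
Local Notation ev := (@eval k A K).
Local Notation ev2 := (@eval k (btens A A) (ktens K K)).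

(** A pair whose second letter is not the unit acts only if its first letter is
   the unit. *)
Lemma eval_zip_right r v : size r = size v -> all nonunit v ->
  ev2 (zip_word (r, v)) =
  if all isone r then \lin_(l <- ev v) << (kone, l) >> else 0.
Proof.
rewrite /zip_word; elim: r v => [|b r IH] [|c v] // => [_ _|[e] /andP[nc nv]].
  by rewrite /= linU.
rewrite [LHS]/= [ev2 _]IH //; case: ifP => [ar|nr] /=.
  case: (altP (b =P bone)) => [->|nb] /=.
    rewrite ar [LHS]lin_lin [RHS]lin_lin; apply: eq_lin => l; rewrite linU.
    by rewrite /tens_act /= (negPf nc) eqxx add0r /ract klen1 expr0 scale1r.
  rewrite [LHS]lin_lin -[RHS](lin0f _ (ev v)); apply: eq_lin => l.
  by rewrite linU /tens_act /= (negPf nc) (negPf nb) addr0.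
by rewrite lin0 nr andbF.
Qed.

Lemma eval_zip_left v r (w : seq (btens A A)) (y : {malg k[K]}) :
  size v = size r -> all nonunit v ->
  ev2 w = \lin_(l <- y) << (kone, l) >> ->
  ev2 (zip_word (v, r) ++ w) =
  if all isone r then \lin_(m <- ev v) \lin_(l <- y) << (m, l) >> else 0.
Proof.
rewrite /zip_word => e nv ew.
elim: v r e nv => [|c v IH] [|b r] // => [_ _|[e] /andP[nc nv]].
  by rewrite /= ew linU.
rewrite [LHS]/= [ev2 _]IH //; case: ifP => [ar|nr] /=.
  case: (altP (b =P bone)) => [->|nb] /=.
    rewrite ar [LHS]lin_lin [RHS]lin_lin; apply: eq_lin => m; rewrite lin_lin exchange_lin.
    apply: eq_lin => l; rewrite linU.
    by rewrite /tens_act /= (negPf nc) eqxx addr0.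
  rewrite [LHS]lin_lin -[RHS](lin0f _ (ev v)); apply: eq_lin => m.
  rewrite lin_lin -[RHS](lin0f _ y); apply: eq_lin => l.
  by rewrite linU /tens_act /= (negPf nc) (negPf nb) addr0.
by rewrite lin0 nr andbF.
Qed.

(** In the model of the square, only the summand of the Alexander-Whitney map
   in which all the letters added by iterated cofaces are units survives. *)
Lemma pair_eval_aw t u : normal_word t -> normal_word u ->
  lin (pair_eval K) (aw t u)
  = \lin_(x <- head_eval K t) \lin_(y <- head_eval K u) << interleave x y >>.
Proof.
case: t u => [|c v] [|c' v'] // nv nv'.
pose G b b' := \lin_(m <- ev v) \lin_(l <- ev v') << interleave (b, m) (b', l) >>.
transitivity (\lin_(s <- iter (size v') L << c :: v >>)
  \lin_(s' <- iter (size v) F << c' :: v' >>)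
    (if all isone (drop (size v) (behead s)) then
       if all isone (take (size v) (behead s')) then G (head bone s) (head bone s') else 0
     else 0)).
  rewrite /aw lin_mtens /=.
  apply: eq_lin_on (outer_tail (t := c :: v) (size v') erefl isT) _ => -[|b s] //.
  case/and3P=> _ /eqP[es] /eqP ev1.
  apply: eq_lin_on (inner_tail (t := c' :: v') (size v) erefl isT) _ => -[|b' s'] //.
  case/and3P=> _ /eqP[es'] /eqP ev2'.
  rewrite /= in ev1 ev2'.
  rewrite /pair_eval /zip_word /=.
  rewrite -[s](cat_take_drop (size v)) -[s'](cat_take_drop (size v)) ev1 ev2'.
  have sz1 : size v = size (take (size v) s').
    by rewrite size_take es'; case: ltnP => // h; apply/eqP; rewrite eqn_leq h leq_addl.
  have sz2 : size (drop (size v) s) = size v' by rewrite size_drop es addKn.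
  rewrite zip_cat // drop_size_cat // (take_size_cat _ (esym sz1)).
  rewrite -[zip v _]/(zip_word (v, take (size v) s')).
  rewrite -[zip (drop _ _) _]/(zip_word (drop (size v) s, v')).
  have ezr := eval_zip_right sz2 nv'.
  case: ifP ezr => [_ ezr|_ ezr].
    rewrite (eval_zip_left sz1 nv ezr); case: ifP => _; last by rewrite /pair_with lin0.
    rewrite pair_with_lin; apply: eq_lin => m; rewrite pair_with_lin; apply: eq_lin => l.
    by rewrite /pair_with linU.
  have ezr' : ev2 (zip_word (drop (size v) s, v')) = \lin_(l <- 0) << (kone, l) >>.
    by rewrite lin0.
  rewrite (eval_zip_left sz1 nv ezr'); case: ifP => _; last by rewrite /pair_with lin0.
  by under eq_lin do rewrite lin0; rewrite lin0f /pair_with lin0.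
transitivity (G c c').
  rewrite -[RHS](strip_outer (fun b => G b c') c v (size v')); apply: eq_lin => s.
  case: ifP => _; last by rewrite lin0f.
  exact: (strip_inner (fun b' => G (head bone s) b') c' v' (size v)).
rewrite /G /= lin_pair_with; apply: eq_lin => m; rewrite lin_pair_with.
by [].
Qed.

End AlexanderWhitney.

(** * The coproduct of words *)

Section WordCoproduct.
Variables (k : fieldType) (A : bcoalg k).
Implicit Types (b c : A) (v w : seq A) (u : seq (btens A A)).
Local Notation T := (btens A A).
Local Notation chain2 := {malg k[seq (btens A A)]}.

Definition comul4 (V : lmodType k) (G : A -> A -> A -> A -> V) b : V :=
  \lin_(a <- bcomul b) \lin_(c <- bcomul a.1) \lin_(d <- bcomul a.2)
    G c.1 c.2 d.1 d.2.

(** Cocommutativity lets the two middle factors of an iterated coproduct be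
   exchanged; this is what makes the coproduct a morphism of coalgebras. *)
Lemma comul4_swap (V : lmodType k) (G : A -> A -> A -> A -> V) b :
  comul4 G b = comul4 (fun x y z t => bsgn y z *: G x z y t) b.
Proof.
have e (H : A -> A -> A -> A -> V) : comul4 H b =
    \lin_(a <- bcomul b) \lin_(c <- bcomul a.2) \lin_(d <- bcomul c.1)
      H a.1 d.1 d.2 c.2.
  rewrite /comul4 (coassocE (fun x y z => \lin_(d <- bcomul z) H x y d.1 d.2)).
  apply: eq_lin => a.
  by rewrite -(coassocE (fun y z t => H a.1 y z t)).
rewrite !e; apply: eq_lin => a; apply: eq_lin => c.
by rewrite (cocommE (fun y z => G a.1 y z c.2)).
Qed.

(** The coproduct of a tensor power, written in words of pairs; the sign moves the
   second half of a letter past the first halves of the later ones. *)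
Fixpoint zip_comult w : chain2 :=
  if w is b :: r then
    \lin_(a <- bcomul b) \lin_(u <- zip_comult r) wsgn a.2 (unzip1 u) *: << a :: u >>
  else << [::] >>.

Lemma zip_comult_size w : supp_on (has_size (size w)) (zip_comult w).
Proof.
elim: w => [|b r IH] /=; first exact: supp_onU.
apply: supp_on_lin_in => a _; apply: supp_on_lin IH _ => u /eqP e.
by apply/supp_onZ/supp_onU; rewrite /has_size /= e.
Qed.

Lemma zip_comult_sgn w u c : u \in msupp (zip_comult w) ->
  wsgn c w = wsgn c (unzip1 u) * wsgn c (unzip2 u).
Proof.
have : supp_on (fun u => wsgn c w == wsgn c (unzip1 u) * wsgn c (unzip2 u)) (zip_comult w).
  elim: w => [|b r IH] /=; first by apply: supp_onU; rewrite /wsgn !big_nil mulr1.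
  apply: supp_on_lin_in => a ha; apply: supp_on_lin IH _ => s /eqP e.
  apply/supp_onZ/supp_onU; rewrite /= !wsgn_cons e (bsgnDr c ha).
  by rewrite mulrACA.
by move=> /supp_onP h /h /eqP.
Qed.

Lemma inner_coface_sgn1 c i u s : s \in msupp (inner_coface i u) ->
  wsgn c (unzip1 s) = wsgn c (unzip1 u).
Proof.
have : supp_on (fun s => wsgn c (unzip1 s) == wsgn c (unzip1 u)) (inner_coface i u).
  elim: u i => [|b r IH] [|i] /=; rewrite ?supp_on0 //.
    apply: supp_on_lin_in => a /tens_comul_supp[ha _]; apply: supp_onU.
    by rewrite /= !wsgn_cons mulrA (bsgnDr c ha).
  by apply: supp_on_lin (IH i) _ => t /eqP e; apply: supp_onU; rewrite /= !wsgn_cons e.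
by move=> /supp_onP h /h /eqP.
Qed.

Lemma zip_comult_rcons w b : zip_comult (rcons w b) =
  \lin_(u <- zip_comult w) \lin_(a <- bcomul b) wsgn a.1 (unzip2 u) *: << rcons u a >>.
Proof.
elim: w => [|c w IH] /=.
  rewrite linU; apply: eq_lin => a; rewrite linU /wsgn /= !big_nil !scale1r.
  by case: a.
rewrite lin_lin; apply: eq_lin => e; rewrite IH !lin_lin; apply: eq_lin => u.
rewrite lin_lin linZ linU -linZf; apply: eq_lin => a.
rewrite linZ linU [unzip1 (rcons _ _)]map_rcons wsgn_rcons /= wsgn_cons !scalerA.
by rewrite (bsgnC a.1); congr (_ *: _); ring.
Qed.

(** The head contributes four factors; the two middle ones are ordered differently
   on the two sides. *)
Lemma zip_comult_inner i w : (i < size w)%N ->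
  lin zip_comult (inner_coface i w) = lin (inner_coface i) (zip_comult w).
Proof.
elim: w i => [|b r IH] [|i] // ir; last first.
  rewrite [inner_coface _ _]/= lin_cons_chain /= exchange_lin lin_lin.
  apply: eq_lin => a; rewrite -lin_lin IH // !lin_lin; apply: eq_lin => u.
  rewrite linZ linU /= /cons_chain -linZf; apply: eq_in_lin => s hs.
  by rewrite (inner_coface_sgn1 _ hs).
pose ws c u := wsgn c (unzip1 u).
transitivity (comul4 (fun x y z t => \lin_(u <- zip_comult r)
   (bsgn y z * ws y u * ws t u) *: << [:: (x, y), (z, t) & u] >> : chain2) b).
  rewrite /= lin_lin; apply: eq_lin => a; rewrite linU /=; apply: eq_lin => c.
  rewrite [LHS]lin_lin; apply: eq_lin => d; rewrite [LHS]lin_lin; apply: eq_lin => u.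
  rewrite linZ linU /= wsgn_cons scalerA; case: c d => c1 c2 [d1 d2] /=.
  by congr (_ *: _); rewrite /ws; ring.
rewrite comul4_swap /= lin_lin; apply: eq_lin => a.
transitivity (\lin_(u <- zip_comult r) \lin_(c <- bcomul a.1) \lin_(d <- bcomul a.2)
   ws a.2 u *: << [:: (c.1, d.1), (c.2, d.2) & u] >> : chain2).
  rewrite [RHS]exchange_lin; apply: eq_lin => c.
  rewrite [RHS]exchange_lin; apply: eq_in_lin => d hd.
  rewrite -linZf; apply: eq_lin => u; rewrite scalerA; congr (_ *: _).
  rewrite /ws (wsgnD _ hd) (bsgnC d.1); have := bsgnK c.2 d.1.
  by move: (bsgn _ _) => s ss; rewrite !mulrA ss mul1r.
rewrite lin_lin; apply: eq_lin => u; rewrite linZ linU /=.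
rewrite (tens_comulE (fun f : T * T => << [:: f.1, f.2 & u] >>)) -linZf.
by apply: eq_lin => c; rewrite -linZf.
Qed.

Lemma zip_comult_outer w : lin zip_comult (outer_coface w) = lin (@outer_coface k T) (zip_comult w).
Proof.
case: w => [|b r]; first by rewrite /= lin0 linU.
pose w1 c u := wsgn c (unzip1 u); pose w2 c u := wsgn c (unzip2 u).
transitivity (comul4 (fun x y z t => \lin_(u <- zip_comult r)
   (bsgn x z * bsgn y z * bsgn y t * w1 x u * w1 y u * w2 y u * w1 t u)
     *: << rcons ((z, t) :: u) (x, y) >> : chain2) b).
  rewrite /= lin_lin; apply: eq_lin => a.
  transitivity (\lin_(d <- bcomul a.2) \lin_(u <- zip_comult r) \lin_(c <- bcomul a.1)
     (wsgn a.1 (a.2 :: r) * w1 d.2 u * (bsgn c.1 d.2 * w2 c.1 u))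
       *: << rcons (d :: u) c >> : chain2).
    rewrite linZ linU -rcons_cons zip_comult_rcons /= lin_lin -linZf; apply: eq_lin => d.
    rewrite lin_lin -linZf; apply: eq_lin => u; rewrite linZ linU /= -!linZf.
    by apply: eq_lin => c; rewrite !scalerA (wsgn_cons _ d.2) /w1 mulrA.
  rewrite [RHS]exchange_lin; apply: eq_in_lin => -[z t] hd.
  rewrite [RHS]exchange_lin; apply: eq_in_lin => u hu.
  apply: eq_in_lin => -[x y] hc; congr (_ *: _); rewrite /= wsgn_cons.
  rewrite (zip_comult_sgn _ hu) !(wsgnD _ hc) /= (bsgnDl _ hc) /= !(bsgnDr _ hd) /=.
  rewrite -/(w1 x u) -/(w1 y u) -/(w2 x u) -/(w2 y u).
  have := bsgnK x t; have : w2 x u * w2 x u = 1.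
    by rewrite /w2 /wsgn -big_split big1 // => q _; apply: bsgnK.
  (* The sign of x against t, and that of x against the second halves in u, occur twice
     and cancel. *)
  move: (bsgn x t) (w2 x u) => p q qq pp.
  transitivity ((p * p) * (q * q) * (bsgn x z * bsgn y z * bsgn y t
     * w1 x u * w1 y u * w2 y u * w1 t u)); first ring.
  by rewrite pp qq !mul1r.
rewrite comul4_swap /= lin_lin; apply: eq_lin => a.
transitivity (\lin_(u <- zip_comult r) \lin_(c <- bcomul a.1) \lin_(d <- bcomul a.2)
   (w1 a.2 u * (wsgn ((c.1, d.1) : T) ((c.2, d.2) :: u)))
     *: << rcons ((c.2, d.2) :: u) (c.1, d.1) >> : chain2).
  rewrite [RHS]exchange_lin; apply: eq_lin => c.
  rewrite [RHS]exchange_lin; apply: eq_in_lin => d hd.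
  rewrite -linZf; apply: eq_lin => u; rewrite scalerA; congr (_ *: _).
  have -> : wsgn ((c.1, d.1) : T) ((c.2, d.2) :: u)
          = bsgn c.1 c.2 * bsgn d.1 d.2 * (w1 c.1 u * w2 d.1 u).
    rewrite wsgn_cons -[bsgn _ _]/(bsgn c.1 c.2 * bsgn d.1 d.2); congr (_ * _).
    rewrite -[in LHS](zip_unzip u) (@wsgn_zip _ _ (c.1, d.1)) //.
    by rewrite !size_map.
  rewrite /w1 (wsgnD _ hd) (bsgnC d.1 c.2); have := bsgnK c.2 d.1.
  move: (bsgn c.2 d.1) => s ss.
  transitivity ((s * s) * (bsgn c.1 c.2 * bsgn d.1 d.2 * wsgn c.1 (unzip1 u)
     * w2 d.1 u * wsgn d.1 (unzip1 u) * wsgn d.2 (unzip1 u))); first ring.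
  by rewrite ss mul1r; ring.
rewrite lin_lin; apply: eq_lin => u; rewrite linZ linU /=.
rewrite (tens_comulE (fun f : T * T => wsgn f.1 (f.2 :: u) *: << rcons (f.2 :: u) f.1 >>)).
rewrite -linZf; apply: eq_lin => c; rewrite -linZf; apply: eq_lin => d.
by rewrite scalerA.
Qed.

Lemma zip_comult_wdif w : lin zip_comult (wdif w) = lin (@wdif k T) (zip_comult w).
Proof.
transitivity (\lin_(u <- zip_comult w) \sum_(i < (size w).+1) (-1) ^+ i *: wcoface i u);
  last by apply: eq_lin_on (zip_comult_size w) _ => u /eqP e; rewrite /wdif e.
rewrite /wdif lin_sum lin_sumf; apply: eq_bigr => i _; rewrite linZ linZf.
congr (_ *: _); transitivity (lin (if (i < size w)%N then inner_coface i
    else @outer_coface k T) (zip_comult w)).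
  by rewrite /wcoface; case: ifP => iw; [apply: zip_comult_inner | apply: zip_comult_outer].
by apply: eq_lin_on (zip_comult_size w) _ => u /eqP e; rewrite /wcoface e; case: ifP.
Qed.

Lemma zip_comult_nonunit w : all nonunit w -> supp_on (all (@nonunit k T)) (zip_comult w).
Proof.
elim: w => [|b r IH] /=; first by move=> _; apply: supp_onU.
case/andP=> nb /IH hr; apply: supp_on_lin_in => a ha; apply: supp_on_lin hr _ => u nu.
apply/supp_onZ/supp_onU; rewrite /= nu andbT; apply: contra nb => /eqP ea.
by rewrite (comul_eq1 ha) ea /= eqxx.
Qed.

Lemma zip_comult_normal w : normal_word w -> supp_on (@normal_word k T) (zip_comult w).
Proof.
case: w => [|b r] //= nr; apply: supp_on_lin_in => a _.
by apply: supp_on_lin (zip_comult_nonunit nr) _ => u nu; apply/supp_onZ/supp_onU.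
Qed.

End WordCoproduct.

(** * Tensor products of abstract vector spaces *)

Section AbstractTensors.
Variable k : fieldType.
Implicit Types U V W : lmodType k.

Lemma linear_lin_of V W (T : choiceType) (f : V -> W) (g : T -> V) x :
  linear f -> f (lin g x) = \lin_(t <- x) f (g t).
Proof.
move=> fl; pose h : {linear V -> W} := HB.pack f (GRing.isLinear.Build k V W *:%R f fl).
exact: (@linear_lin _ _ _ _ h).
Qed.

Lemma tensorPl V W a (v v' : V) (w : W) :
  tensor (a *: v + v') w = a *: tensor v w + tensor v' w.
Proof.
rewrite /tensor -linearP /=; apply/(@qclassP k _ (@bilinear_pred k V W)).
by apply/asboolP/BRelL.
Qed.

Lemma tensorPr V W a (v : V) (w w' : W) :
  tensor v (a *: w + w') = a *: tensor v w + tensor v w'.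
Proof.
rewrite /tensor -linearP /=; apply/(@qclassP k _ (@bilinear_pred k V W)).
by apply/asboolP/BRelR.
Qed.

Lemma tensor_linl V W (T : choiceType) (f : T -> V) x (w : W) :
  tensor (lin f x) w = \lin_(t <- x) tensor (f t) w.
Proof.
apply: (@linear_lin_of V (tens V W) T (fun v => tensor v w)) => a v v'.
exact: tensorPl.
Qed.

Lemma tensor_linr V W (T : choiceType) (f : T -> W) x (v : V) :
  tensor v (lin f x) = \lin_(t <- x) tensor v (f t).
Proof.
apply: (@linear_lin_of W (tens V W) T (fun w => tensor v w)) => a w w'.
exact: tensorPr.
Qed.

Variables (V W U : lmodType k) (f : V -> W -> U).
Hypothesis fPl : forall w, linear (f^~ w).
Hypothesis fPr : forall v, linear (f v).

Lemma tliftE t : tlift f t = \lin_(vw <- repr t) f vw.1 vw.2.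
Proof. by rewrite /tlift lextE. Qed.

Lemma bilinear_rel_lin x : bilinear_rel x -> \lin_(vw <- x) f vw.1 vw.2 = 0.
Proof.
elim=> {x} [|a x y _ ex _ ey|a v v' w|a v w w'].
- exact: lin0.
- by rewrite linD linZ ex ey scaler0 addr0.
- by rewrite linB linD linZ !linU /= fPl subrr.
- by rewrite linB linD linZ !linU /= fPr subrr.
Qed.

Lemma tlift_qclass x :
  tlift f (qclass (@bilinear_pred k V W) x) = \lin_(vw <- x) f vw.1 vw.2.
Proof.
rewrite tliftE; apply/eqP; rewrite -subr_eq0 -linB; apply/eqP.
apply: bilinear_rel_lin; apply/asboolP.
apply/(@qclassP k _ (@bilinear_pred k V W)).
by rewrite reprK.
Qed.

Lemma tlift_tensor v w : tlift f (tensor v w) = f v w.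
Proof. by rewrite tlift_qclass linU. Qed.

Lemma tlift_linear : linear (tlift f).
Proof.
move=> a s t; rewrite -[s]reprK -[t]reprK.
rewrite -[\pi_(_) (repr s)]/(qclass (@bilinear_pred k V W) (repr s)).
rewrite -[\pi_(_) (repr t)]/(qclass (@bilinear_pred k V W) (repr t)).
by rewrite -linearP !tlift_qclass linD linZ.
Qed.

End AbstractTensors.

(** * Graded models and the comparison theorem *)

(** The last condition says that kcomul intertwines the action of A on K with
   its action, through the coproduct, on the tensor square of K. *)
Record graded_model (k : fieldType) (A : bcoalg k) (deg : A -> nat) (K : koszul A) :=
  GradedModel {
  kdeg : K -> nat;
  kcomul : K -> {malg k[(K * K)%type]};
  kdeg1 : kdeg kone = 0%N;
  kdegD : forall b l m, m \in msupp (kact b l) -> (kdeg m = deg b + kdeg l)%N;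
  kcomul1 : kcomul kone = << (kone, kone) >>;
  kcomul_act : forall b l, lin kcomul (kact b l)
    = \lin_(a <- bcomul b) \lin_(p <- kcomul l)
        (-1) ^+ (deg a.2 * kdeg p.1) *: @tens_act k A A K K a p }.

Section Comparison.
Variables (k : fieldType) (A : bcoalg k) (deg : A -> nat).
Hypothesis deg_sgn : forall b c, bsgn b c = (-1) ^+ (deg b * deg c).
Hypothesis degD : forall b a, a \in msupp (bcomul b) -> (deg a.1 + deg a.2 = deg b)%N.
Variables (K : koszul A) (M : graded_model deg K).
Implicit Types (b c : A) (u v w : seq A).

Local Notation C := (coalg_of deg).
Local Notation X := (coTHH C).
Local Notation chain := {malg k[seq A]}.
Local Notation T := (btens A A).
Local Notation hev := (@head_eval k A K).
Local Notation ev := (@eval k A K).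
Local Notation hev2 := (@head_eval k T (ktens K K)).
Local Notation ev2 := (@eval k T (ktens K K)).
Local Notation wdegA := (@wdeg k C).

Definition weight0_coalg : coalg k (nat * nat) :=
  @Coalg k (nat * nat) A (fun b => (0%N, deg b)) bcomul (fun b => (b == bone)%:R).

Definition model_coalg : coalg k (nat * nat) :=
  @Coalg k (nat * nat) K (fun l => (klen l, kdeg M l)) (kcomul M)
    (fun l => (l == kone)%:R).

Lemma wdeg_cons b w : wdegA (b :: w) = (deg b + wdegA w)%N.
Proof. exact: big_cons. Qed.

Lemma wdeg_rcons w b : wdegA (rcons w b) = (wdegA w + deg b)%N.
Proof. by rewrite /wdeg -cats1 big_cat big_seq1. Qed.

Lemma eval_deg w l : l \in msupp (ev w) -> kdeg M l = wdegA w.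
Proof.
have : supp_on (fun l => kdeg M l == wdegA w) (ev w).
  elim: w => [|b r IH] /=; first by apply: supp_onU; rewrite kdeg1 /wdeg big_nil.
  apply: supp_on_lin IH _ => m /eqP em; apply/supp_onP => n /(kdegD M) ->.
  by rewrite em wdeg_cons.
by move=> /supp_onP h /h /eqP.
Qed.

(** ** The coproduct *)

Lemma word_comultE w :
  lin (@zip_chain k A) (@word_comult k C w) = zip_comult w.
Proof.
elim: w => [|b r IH] /=; first by rewrite linU.
rewrite !lextE lin_lin; apply: eq_lin => a; rewrite lin_lin -IH lin_lin.
have hs : supp_on (fun t : seq A * seq A => size t.1 == size t.2) (@word_comult k C r).
  elim: (r) => [|c s IHs] /=; first exact: supp_onU.
  rewrite !lextE; apply: supp_on_lin_in => d _.
  by apply: supp_on_lin IHs _ => -[x y] /= e; apply/supp_onZ/supp_onU; rewrite /= eqSS.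
apply: eq_lin_on hs _ => -[u v] /= /eqP e; rewrite linZ !linU.
have eu : unzip1 (zip u v) = u by rewrite unzip1_zip ?e.
by rewrite (wsgn_deg deg_sgn) /zip_chain /zip_word /= eu; case: a.
Qed.

Lemma word_comult_size w :
  supp_on (fun t : seq A * seq A => (size t.1 == size w) && (size t.2 == size w))
    (@word_comult k C w).
Proof.
elim: w => [|c s IHs] /=; first exact: supp_onU.
rewrite !lextE; apply: supp_on_lin_in => d _.
by apply: supp_on_lin IHs _ => -[x y] /= e; apply/supp_onZ/supp_onU; rewrite /= !eqSS.
Qed.

Lemma word_comult_paired_normal w : normal_word w ->
  supp_on (@paired_normal k A) (@word_comult k C w).
Proof.
move=> nw; have hp : supp_on (@paired k A) (@word_comult k C w).
  apply: sub_supp_on (word_comult_size w) => -[u v] /= /andP[/eqP e /eqP e'].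
  by rewrite /paired /= e e' -size_eq0 e eqxx andbT; case: (w) nw.
rewrite -[word_comult _](unzip_zip_chain hp) word_comultE.
apply: supp_on_lin (zip_comult_normal nw) _ => s ns; apply: supp_onU.
rewrite /paired_normal /zip_word /= zip_unzip ns /paired /= !size_map eqxx.
by case: s ns.
Qed.

Lemma word_comult_cocycle (x : chain) : x \in @cocycle_pred k X ->
  lin (@word_comult k C) x \in @cocycle_pred k (diag X X).
Proof.
move=> /(cocycle_coTHH deg_sgn)[hx dx]; apply/(cocycle_diag deg_sgn); split.
  by apply: supp_on_lin hx _ => w; apply: word_comult_paired_normal.
have e : lin (@zip_chain k A) (lin (@word_comult k C) x) = lin (@zip_comult k A) x.
  by rewrite lin_lin; apply: eq_lin => w; apply: word_comultE.
transitivity (lin (@wdif k T) (lin (@zip_comult k A) x)); first by rewrite -e.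
rewrite lin_lin; under eq_lin do rewrite -zip_comult_wdif.
by rewrite -lin_lin dx lin0.
Qed.

(** The coproduct of the tensor product of A and K, with the factors grouped as in
   the model of the diagonal. *)
Definition total_comul (x : A * K) : {malg k[(T * ktens K K)%type]} :=
  \lin_(a <- bcomul x.1) \lin_(p <- kcomul M x.2)
    (-1) ^+ (deg a.2 * kdeg M p.1) *: << (a, p) >>.

Lemma deg1 : deg bone = 0%N.
Proof.
have h : (bone, bone) \in msupp (bcomul (bone : A)).
  by rewrite comul1 -mcoeff_neq0 mcoeff_basis eqxx oner_eq0.
by have /= := degD h; lia.
Qed.

Lemma eval_pair_deg (u : seq T) p : p \in msupp (ev2 u) ->
  kdeg M p.1 = wdegA (unzip1 u).
Proof.
have : supp_on (fun p => kdeg M p.1 == wdegA (unzip1 u)) (ev2 u).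
  elim: u {p} => [|a r IH] /=.
    by apply: supp_onU; rewrite /= kdeg1 /wdeg big_nil.
  apply: supp_on_lin IH _ => -[l l'] /= /eqP e.
  apply: supp_onD; case: eqP => ea; rewrite ?supp_on0 //.
    apply: supp_on_lin_in => m /(kdegD M) em; apply: supp_onU.
    by rewrite /= em e wdeg_cons.
  apply/supp_onZ/supp_on_lin_in => m _; apply: supp_onU.
  by rewrite /= e wdeg_cons ea deg1.
by move=> /supp_onP h /h /eqP.
Qed.

(** By induction on the word, one letter at a time, from kcomul_act. *)
Lemma eval_zip_comult w : lin ev2 (zip_comult w) = lin (kcomul M) (ev w).
Proof.
elim: w => [|b r IH]; first by rewrite /= !linU kcomul1.
rewrite /= !lin_lin; under [RHS]eq_lin do rewrite kcomul_act.
rewrite [RHS]exchange_lin; apply: eq_lin => a; rewrite lin_lin.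
under eq_lin do rewrite linZ linU /=.
transitivity (\lin_(u <- zip_comult r) \lin_(p <- ev2 u)
    (-1) ^+ (deg a.2 * kdeg M p.1) *: @tens_act k A A K K a p).
  apply: eq_lin => u; rewrite -linZf; apply: eq_in_lin => p hp.
  by rewrite (eval_pair_deg hp) -(wsgn_deg deg_sgn).
by rewrite -lin_lin IH lin_lin.
Qed.

Lemma head_eval_zip_comult w : normal_word w ->
  lin hev2 (zip_comult w) = lin total_comul (hev w).
Proof.
case: w => [|c v] // _; rewrite /= lin_pair_with /total_comul /= lin_lin.
rewrite exchange_lin; apply: eq_lin => a; rewrite lin_lin.
under eq_lin do rewrite linZ linU /=.
transitivity (\lin_(p <- lin ev2 (zip_comult v)) (-1) ^+ (deg a.2 * kdeg M p.1)
   *: << (a, p) >> : {malg k[(T * ktens K K)%type]}); last by rewrite eval_zip_comult lin_lin.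
rewrite lin_lin; apply: eq_lin => u; rewrite /pair_with -linZf.
apply: eq_in_lin => p hp; by rewrite (eval_pair_deg hp) -(wsgn_deg deg_sgn).
Qed.

(** ** The Kunneth map *)

Definition pair_up (x : {malg k[(A * K)%type]}) (y : {malg k[(A * K)%type]}) :
    {malg k[(T * ktens K K)%type]} :=
  \lin_(s <- x) \lin_(t <- y) << interleave s t >>.

Local Notation H := (cohomology X).
Local Notation f := (@model_map k A deg K).
Local Notation f2 := (@diag_map k A deg K).

Definition model_pairing (h h' : H) := pair_up (f h) (f h').

Lemma pairingPl h' : linear (model_pairing^~ h').
Proof.
by move=> a h1 h2; rewrite /model_pairing model_map_linear // /pair_up linD linZ.
Qed.

Lemma pairingPr h : linear (model_pairing h).
Proof.
move=> a h1 h2; rewrite /model_pairing model_map_linear // /pair_up.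
by under eq_lin do rewrite linD linZ; rewrite linDf linZf.
Qed.

Lemma last_cofaceE (x : chain) : supp_on (fun w => w != [::]) x ->
  @last_coface k X x = lin (@outer_coface k A) x.
Proof.
move=> hx; rewrite /last_coface lextE; apply: eq_lin_on hx _ => -[|b w]; first by [].
by move=> _; rewrite [coface _ _]/= (coTHH_cofaceE deg_sgn) /wcoface /= ltnn.
Qed.

Lemma first_cofaceE (x : chain) : supp_on (fun w => w != [::]) x ->
  @first_coface k X x = lin (@inner_coface k A 0) x.
Proof.
move=> hx; rewrite /first_coface lextE; apply: eq_lin_on hx _ => -[|b w]; first by [].
by move=> _; rewrite [coface _ _]/= (coTHH_cofaceE deg_sgn).
Qed.

Lemma aw_iterE w u : w != [::] -> u != [::] ->
  mtens (iter (size u).-1 (@last_coface k X) << w >>)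
        (iter (size w).-1 (@first_coface k X) << u >>) = aw w u.
Proof.
move=> nw nu; rewrite /aw; congr mtens.
  elim: (size u).-1 => [|n IH] //; rewrite !iterS IH last_cofaceE //.
  by apply: sub_supp_on (outer_tail n erefl nw) => s /and3P[].
elim: (size w).-1 => [|n IH] //; rewrite !iterS IH first_cofaceE //.
by apply: sub_supp_on (inner_tail n erefl nu) => s /and3P[].
Qed.

Lemma alexander_whitneyE (x y : chain) :
  supp_on (fun w => w != [::]) x -> supp_on (fun w => w != [::]) y ->
  @alexander_whitney k X X x y = \lin_(t <- x) \lin_(u <- y) aw t u.
Proof.
move=> hx hy; rewrite /alexander_whitney !lextE.
apply: eq_lin_on hx _ => t nt; apply: eq_lin_on hy _ => u nu.
exact: aw_iterE.
Qed.

Lemma aw_cocycle (x y : chain) :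
  x \in @cocycle_pred k X -> y \in @cocycle_pred k X ->
  @alexander_whitney k X X x y \in @cocycle_pred k (diag X X).
Proof.
move=> /(cocycle_coTHH deg_sgn)[hx dx] /(cocycle_coTHH deg_sgn)[hy dy].
have ne (z : chain) : supp_on (@normal_word k A) z -> supp_on (fun w => w != [::]) z.
  by apply: sub_supp_on => -[].
rewrite alexander_whitneyE ?ne //; apply/(cocycle_diag deg_sgn).
have hn : supp_on (@paired_normal k A) (\lin_(t <- x) \lin_(u <- y) aw t u).
  apply: supp_on_lin hx _ => t nt; apply: supp_on_lin hy _ => u nu.
  exact: paired_normal_aw.
split=> //; rewrite -zip_pair_dif ?paired_normal_paired //.
suff -> : lin (@pair_dif k A) (\lin_(t <- x) \lin_(u <- y) aw t u) = 0 by rewrite lin0.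
rewrite lin_lin; transitivity (\lin_(t <- x) \lin_(u <- y)
    (\lin_(t' <- wdif t) aw t' u
     + (-1) ^+ (size t).-1 *: \lin_(u' <- wdif u) aw t u')).
  apply: eq_lin_on (ne _ hx) _ => t nt; rewrite lin_lin.
  by apply: eq_lin_on (ne _ hy) _ => u nu; apply: pair_dif_aw.
under eq_lin do rewrite linDf; rewrite linDf.
have -> : \lin_(t <- x) \lin_(u <- y) \lin_(t' <- wdif t) aw t' u = 0.
  under eq_lin do rewrite exchange_lin.
  by rewrite -(lin_lin (fun t' => \lin_(u <- y) aw t' u)) dx lin0.
rewrite add0r -[RHS](lin0f _ x); apply: eq_lin => t.
by rewrite linZf -(lin_lin (fun u' => aw t u')) dy lin0 scaler0.
Qed.

Lemma pair_eval_AW (x y : chain) :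
  x \in @cocycle_pred k X -> y \in @cocycle_pred k X ->
  lin (@pair_eval k A K) (@alexander_whitney k X X x y)
  = pair_up (lin hev x) (lin hev y).
Proof.
move=> /(cocycle_coTHH deg_sgn)[hx _] /(cocycle_coTHH deg_sgn)[hy _].
have ne (z : chain) : supp_on (@normal_word k A) z -> supp_on (fun w => w != [::]) z.
  by apply: sub_supp_on => -[].
rewrite alexander_whitneyE ?ne // /pair_up !lin_lin.
apply: eq_lin_on hx _ => t nt; rewrite [LHS]lin_lin.
under [RHS]eq_lin do rewrite lin_lin.
rewrite [RHS]exchange_lin; apply: eq_lin_on hy _ => u nu.
exact: pair_eval_aw.
Qed.

Lemma diag_map_kunneth t : f2 (@kunneth k X X t) = tlift model_pairing t.
Proof.
rewrite /kunneth !tliftE linear_lin_of; last exact: diag_map_linear.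
apply: eq_lin => -[h h'] /=.
have [ch ch'] := (corepr_cocycle h, corepr_cocycle h').
by rewrite diag_map_coclass ?aw_cocycle // pair_eval_AW.
Qed.

(** Classes with arbitrary values exist on coTHH, and products of two of them have
   the values that determine a class on the diagonal; so the Kunneth map is
   surjective and its chosen preimage is one. *)
Lemma kunnethK (h : cohomology (diag X X)) : @kunneth k X X (@kunneth_inv k X X h) = h.
Proof.
have /choice[g gP] : forall s : A * K, exists h : H, f h = << s >>.
  by move=> s; apply: model_map_surj.
have [t0 tP] : exists t, @kunneth k X X t = h.
  pose t := \lin_(s <- f2 h) tensor (g (s.1.1, s.2.1)) (g (s.1.2, s.2.2)).
  exists t; apply: (@diag_map_inj k A deg deg_sgn K); rewrite diag_map_kunneth.
  rewrite /t linear_lin_of; last exact: tlift_linear pairingPl pairingPr.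
  rewrite -[RHS]lin_id; apply: eq_lin => -[[b b'] [l l']].
  rewrite (tlift_tensor pairingPl pairingPr) /model_pairing !gP /pair_up !linU.
  by [].
exact: (@xgetPex _ 0 [set t | @kunneth k X X t = h]%classic (ex_intro _ t0 tP)).
Qed.

Lemma diag_map_comult (h : H) :
  f2 (@cohomology_map k X (diag X X) (lin (@word_comult k C)) h)
  = lin total_comul (f h).
Proof.
have ch := word_comult_cocycle (corepr_cocycle h).
rewrite /cohomology_map (diag_map_coclass deg_sgn K ch).
have /(cocycle_coTHH deg_sgn)[hx _] := corepr_cocycle h.
rewrite /model_map /induced /= !lin_lin; apply: eq_lin_on hx _ => w nw.
by rewrite lin_pair_eval word_comultE head_eval_zip_comult.
Qed.

(** ** The comparison isomorphism *)

Lemma restrict_lin (S U : choiceType) (N P : pred S) (Q : pred U)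
    (D : S -> {malg k[U]}) x : supp_on N x ->
  (forall s, N s -> supp_on (fun t => Q t == P s) (D s)) ->
  restrict Q (lin D x) = lin D (restrict P x).
Proof.
move=> hx h; rewrite /restrict !lin_lin; apply: eq_lin_on hx _ => s Ns.
case: ifP => Ps; rewrite ?linU ?lin0.
  rewrite -[RHS]lin_id; apply: eq_lin_on (h s Ns) _ => t.
  by rewrite Ps => /eqP->.
rewrite -[RHS](lin0f _ (D s)); apply: eq_lin_on (h s Ns) _ => t.
by rewrite Ps => /eqP->.
Qed.

Lemma wdif_deg w : supp_on (fun u => wdegA u == wdegA w) (wdif w).
Proof.
apply: supp_on_sum => i _; apply: supp_onZ; rewrite /wcoface; case: ifP => _.
  move: (nat_of_ord i) => {i}; elim: w => [|b r IH] [|j] /=; rewrite ?supp_on0 //.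
    apply: supp_on_lin_in => a /degD e; apply: supp_onU.
    by rewrite !wdeg_cons addnA e.
  by apply: supp_on_lin (IH j) _ => u /eqP e; apply: supp_onU; rewrite !wdeg_cons e.
case: w {i} => [|b r]; first exact: supp_on0.
apply: supp_on_lin_in => a /degD e; apply/supp_onZ/supp_onU.
by rewrite wdeg_rcons !wdeg_cons -e; apply/eqP; lia.
Qed.

Lemma head_eval_homog w x : x \in msupp (hev w) -> w != [::] ->
  klen x.2 = (size w).-1 /\ (deg x.1 + kdeg M x.2 = wdegA w)%N.
Proof.
case: w => [|c v] // hx _.
have : supp_on (fun x => (klen x.2 == size v) && (deg x.1 + kdeg M x.2 == wdegA (c :: v))%N)
    (hev (c :: v)).
  apply: supp_on_lin_in => l hl; apply: supp_onU => /=.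
  by have [-> _] := eval_supp hl; rewrite (eval_deg hl) wdeg_cons !eqxx.
by move=> /supp_onP /(_ _ hx) /andP[/eqP-> /eqP->].
Qed.

(** The coboundary and the evaluation are bihomogeneous, so a representative may
   be restricted to one bidegree. *)
Lemma model_map_homog p s (h : H) :
  bhomog (b := bgcoalg_of (ctens weight0_coalg model_coalg)) p s (f h)
  <-> bhomog (b := coHH C) p s h.
Proof.
split=> [hom|[z [-> hz]] [c l]]; last first.
  rewrite -coclass_val model_map_coclass //; last exact: val_cocycle.
  have /(cocycle_coTHH deg_sgn)[nz _] := val_cocycle z.
  have : supp_on (fun x : A * K => (klen x.2 == p) && (deg x.1 + kdeg M x.2 == s)%N)
      (lin hev (val z)).
    apply: supp_on_lin_in => w wz; apply/supp_onP => x hx.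
    have nw : w != [::] by have := supp_onP _ _ nz w wz; case: (w).
    have [-> ->] := head_eval_homog hx nw.
    by have [/= -> ->] := hz w wz; rewrite !eqxx.
  by move=> /supp_onP hs /hs /andP[/eqP/= <- /eqP/= <-].
have ch := corepr_cocycle h; have /(cocycle_coTHH deg_sgn)[nz dz] := ch.
pose P w := ((size w).-1 == p) && (wdegA w == s).
pose z := restrict P (corepr h).
have hz : z \in @cocycle_pred k X.
  apply/(cocycle_coTHH deg_sgn); split; first exact: supp_on_restrict_of.
  rewrite /z -(@restrict_lin _ _ (@normal_word k A) P
    (fun w => ((size w).-2 == p) && (wdegA w == s))) //.
    by rewrite dz /restrict lin0.
  move=> w nw; apply: sub_supp_on (_ : supp_on (predI (has_size (size w).+1)
     (fun u => wdegA u == wdegA w)) (wdif w)) => [u /andP[/eqP e /eqP e']|].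
    by rewrite e e' /P /= eqxx.
  by rewrite supp_onI wdif_size wdif_deg.
have fz : f (@coclass k X z) = f h.
  rewrite model_map_coclass // /z.
  rewrite -(@restrict_lin _ _ (@normal_word k A) P
    (fun x => (klen x.2 == p) && (deg x.1 + kdeg M x.2 == s)%N)) //.
    apply: restrict_id; apply/supp_onP => -[c l] hx; have := hom (c, l) hx.
    by case=> /= <- <-; rewrite !eqxx.
  move=> w nw; apply/supp_onP => x hx; have nw' : w != [::] by case: (w) nw.
  by have [-> ->] := head_eval_homog hx nw'.
exists (insubd (0 : cocycle X) z); split.
  by rewrite -[LHS](model_map_inj deg_sgn fz).
move=> w; rewrite val_insubd_cocycle // => wz.
by have /andP[/eqP e /eqP e'] := supp_onP _ _ (supp_on_restrict P (corepr h)) w wz.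
Qed.

Definition split_pairs (z : {malg k[(T * ktens K K)%type]}) :
    tens {malg k[(A * K)%type]} {malg k[(A * K)%type]} :=
  \lin_(s <- z) tensor << (s.1.1, s.2.1) >> << (s.1.2, s.2.2) >>.

Lemma split_pair_up x y : split_pairs (pair_up x y) = tensor x y.
Proof.
rewrite /split_pairs /pair_up lin_lin -[in RHS](lin_id x) tensor_linl.
apply: eq_lin => s; rewrite lin_lin -[in RHS](lin_id y) tensor_linr.
by apply: eq_lin => t; rewrite linU; case: s t => ? ? [].
Qed.

Lemma model_bcomult (y : {malg k[(A * K)%type]}) :
  bcomult (b := bgcoalg_of (ctens weight0_coalg model_coalg)) y
  = split_pairs (lin total_comul y).
Proof.
rewrite /split_pairs lin_lin /= !lextE; apply: eq_lin => -[c l].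
rewrite /total_comul [LHS]lin_lin [RHS]lin_lin; apply: eq_lin => a.
rewrite [LHS]lin_lin [RHS]lin_lin; apply: eq_lin => p'.
by rewrite /bisign /= mul0n add0n !linZ !linU.
Qed.

Theorem coHH_model :
  bgcoalg_iso (coHH C) (bgcoalg_of (ctens weight0_coalg model_coalg)).
Proof.
have fl : linear f by apply: model_map_linear.
pose F : {linear H -> {malg k[(A * K)%type]}} :=
  HB.pack f (GRing.isLinear.Build k H {malg k[(A * K)%type]} *:%R f fl).
exists F; split.
- have /choice[g gP] : forall y, exists h : H, f h = y by move=> y; apply: model_map_surj.
  by exists g => [h|y]; [apply: (model_map_inj deg_sgn); apply: gP | apply: gP].
- by move=> p s h; apply: model_map_homog.
- move=> h.
  have tmapE t : tmap F F t = split_pairs (tlift model_pairing t).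
    rewrite /tmap !tliftE /split_pairs lin_lin; apply: eq_lin => -[h1 h2] /=.
    by rewrite -[RHS]/(split_pairs (pair_up (f h1) (f h2))) split_pair_up.
  rewrite tmapE.
  have <- : f2 (@cohomology_map k X (diag X X) (lin (@word_comult k C)) h)
          = tlift model_pairing (bcomult (b := coHH C) h).
    rewrite -diag_map_kunneth /= !lextE kunnethK //.
  by rewrite diag_map_comult -model_bcomult.
- move=> h; have /(cocycle_coTHH deg_sgn)[hx _] := corepr_cocycle h.
  rewrite /= /model_map /induced /= !lextE lin_lin.
  apply: (@eq_lin_on k (seq A) k^o _ _ _ (corepr h) hx) => -[|c [|b v]] // _.
    by rewrite /= /pair_with !linU /= eqxx mulr1.
  rewrite -[RHS](@lin0f k _ k^o (hev [:: c, b & v])); apply: eq_in_lin => -[d l] hw.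
  have [/= e _] := head_eval_homog hw isT.
  by case: (l =P kone) e => [->|_]; rewrite ?klen1 ?mulr0.
Qed.

End Comparison.

(** * Coalgebras dual to twisted partial monoids *)

(** The dual algebra has a basis in which the product of x and y is zero or, up to
   the scalar mtwist x y, the basis element mprod x y; mcomulE says that the
   coproduct is the transpose of this product. *)
Record twisted_monoid (k : fieldType) := TwistedMonoid {
  mbas :> choiceType;
  mone : mbas;
  mprod : mbas -> mbas -> option mbas;
  mtwist : mbas -> mbas -> k;
  mdg : mbas -> nat;
  mwt : mbas -> nat;
  mcomul : mbas -> {malg k[(mbas * mbas)%type]};
  mcomulE : forall b x y,
    (mcomul b)@_(x, y) = if mprod x y == Some b then mtwist x y else 0;
  mprodA : forall x y z,
    obind (fun u => mprod u z) (mprod x y) = obind (mprod x) (mprod y z);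
  mprodC : forall x y, mprod x y = mprod y x;
  mprod1 : forall x, mprod mone x = Some x;
  mtwistA : forall x y z u v, mprod x y = Some u -> mprod y z = Some v ->
    mtwist x y * mtwist u z = mtwist x v * mtwist y z;
  mtwistC : forall x y u, mprod x y = Some u ->
    mtwist x y = (-1) ^+ (mdg x * mdg y) * mtwist y x;
  mtwist1 : forall x, mtwist mone x = 1;
  mdgD : forall x y u, mprod x y = Some u -> (mdg x + mdg y = mdg u)%N;
  mwtD : forall x y u, mprod x y = Some u -> (mwt x + mwt y = mwt u)%N;
  mwt_eq0 : forall x, (mwt x == 0%N) = (x == mone) }.

Section TwistedCoalgebra.
Variables (k : fieldType) (B : twisted_monoid k).
Implicit Types (b c x y z : B).

Local Notation sgn b c := ((-1) ^+ (mdg b * mdg c) : k).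

Lemma mcomul_prod b a : a \in msupp (mcomul b) -> mprod a.1 a.2 = Some b.
Proof.
by case: a => x y; rewrite -mcoeff_neq0 mcomulE; case: (_ =P Some b) => //; rewrite eqxx.
Qed.

Lemma mdg1 : mdg (mone B) = 0%N.
Proof. by have := mdgD (mprod1 (mone B)); lia. Qed.

Lemma mtwist1r x : mtwist x (mone B) = 1.
Proof.
have h : mprod x (mone B) = Some x by rewrite mprodC mprod1.
by rewrite (mtwistC h) mdg1 muln0 mul1r mtwist1.
Qed.

Lemma twisted_coassoc b :
  \lin_(a <- mcomul b) \lin_(c <- mcomul a.1) << (c.1, (c.2, a.2)) >>
  = \lin_(a <- mcomul b) \lin_(c <- mcomul a.2) << (a.1, (c.1, c.2)) >>
    :> {malg k[(B * (B * B))%type]}.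
Proof.
apply/malgP => -[x [y z]].
have el (a : B * B) : (\lin_(c <- mcomul a.1) << (c.1, (c.2, a.2)) >>
    : {malg k[(B * (B * B))%type]})@_(x, (y, z))
    = if (mprod x y == Some a.1) && (a.2 == z) then mtwist x y else 0.
  rewrite (@mcoeff_linM _ _ _ _ _ _ (x, y)).
    rewrite mcomulE mcoeff_basis !xpair_eqE !eqxx /=.
    by case: eqP => _; case: eqP => _; rewrite ?mulr1 ?mulr0 ?mul0r.
  move=> [s t] _; rewrite mcoeff_basis !xpair_eqE /=.
  by rewrite andbA => /negPf->.
have er (a : B * B) : (\lin_(c <- mcomul a.2) << (a.1, (c.1, c.2)) >>
    : {malg k[(B * (B * B))%type]})@_(x, (y, z))
    = if (mprod y z == Some a.2) && (a.1 == x) then mtwist y z else 0.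
  rewrite (@mcoeff_linM _ _ _ _ _ _ (y, z)).
    rewrite mcomulE mcoeff_basis !xpair_eqE !eqxx /= andbT.
    by case: eqP => _; case: eqP => _; rewrite ?mulr1 ?mulr0 ?mul0r.
  move=> [s t] _; rewrite mcoeff_basis !xpair_eqE /=.
  by move=> /negPf->; rewrite andbF.
have A := mprodA x y z.
case exy : (mprod x y) A => [u|] /= A; last first.
  rewrite [LHS]mcoeff_lin big1 => [|a _]; last by rewrite el exy mulr0.
  case eyz : (mprod y z) A => [v|] /= A; last first.
    by rewrite mcoeff_lin big1 // => a _; rewrite er eyz mulr0.
  rewrite (@mcoeff_linM _ _ _ _ _ _ (x, v)).
    by rewrite mcomulE -A mul0r.
  move=> [s t] _; rewrite er eyz xpair_eqE /= andbC => ne.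
  by rewrite -[Some v == Some t]/(v == t) [v == t]eq_sym (negPf ne).
rewrite (@mcoeff_linM _ _ _ _ _ _ (u, z)); last first.
  move=> [s t] _; rewrite el exy xpair_eqE /= => ne.
  by rewrite -[Some u == Some s]/(u == s) [u == s]eq_sym (negPf ne).
rewrite mcomulE el exy !eqxx /=.
case eyz : (mprod y z) A => [v|] /= A; last first.
  rewrite A /= mul0r mcoeff_lin big1 // => a _; by rewrite er eyz mulr0.
rewrite (@mcoeff_linM _ _ _ _ _ _ (x, v)); last first.
  move=> [s t] _; rewrite er eyz xpair_eqE /= andbC => ne.
  by rewrite -[Some v == Some t]/(v == t) [v == t]eq_sym (negPf ne).
rewrite mcomulE er eyz !eqxx /= -A; case: eqP => _; last by rewrite !mul0r.
by rewrite mulrC (mtwistA exy eyz).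
Qed.

Lemma twisted_counitl b :
  \lin_(a <- mcomul b) (if a.1 == mone B then << a.2 >> else 0)
  = << b >> :> {malg k[B]}.
Proof.
apply/malgP => y; rewrite (@mcoeff_linM _ _ _ _ _ _ (mone B, y)).
  rewrite /= eqxx mcomulE mprod1 !mcoeff_basis eqxx mulr1 mtwist1 [b == y]eq_sym.
  by case: eqP => [[->]|ne]; rewrite ?eqxx //; case: eqP => // e; case: ne; rewrite e.
move=> [s t] _; rewrite xpair_eqE /=; case: eqP => //= _; last by rewrite mcoeff0.
by rewrite mcoeff_basis => /negPf->.
Qed.

Lemma twisted_counitr b :
  \lin_(a <- mcomul b) (if a.2 == mone B then << a.1 >> else 0)
  = << b >> :> {malg k[B]}.
Proof.
apply/malgP => y; rewrite (@mcoeff_linM _ _ _ _ _ _ (y, mone B)).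
  rewrite /= eqxx mcomulE mprodC mprod1 !mcoeff_basis eqxx mulr1 mtwist1r [b == y]eq_sym.
  by case: eqP => [[->]|ne]; rewrite ?eqxx //; case: eqP => // e; case: ne; rewrite e.
move=> [s t] _; rewrite xpair_eqE /= andbC; case: eqP => //= _; last by rewrite mcoeff0.
by rewrite mcoeff_basis => /negPf->.
Qed.

Lemma twisted_wtD b a : a \in msupp (mcomul b) -> (mwt a.1 + mwt a.2 = mwt b)%N.
Proof. by move=> /mcomul_prod; apply: mwtD. Qed.

Lemma twisted_dgD b a : a \in msupp (mcomul b) -> (mdg a.1 + mdg a.2 = mdg b)%N.
Proof. by move=> /mcomul_prod; apply: mdgD. Qed.

Lemma twisted_sgnC b c : sgn b c = sgn c b.
Proof. by rewrite mulnC. Qed.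

Lemma twisted_sgnDl b c a : a \in msupp (mcomul b) ->
  sgn b c = sgn a.1 c * sgn a.2 c.
Proof. by move=> /twisted_dgD <-; rewrite mulnDl exprD. Qed.

Lemma twisted_sgnK b c : sgn b c * sgn b c = 1.
Proof. by rewrite -expr2 sqrr_sign. Qed.

Lemma twisted_sgn1l b : sgn (mone B) b = 1.
Proof. by rewrite mdg1 mul0n. Qed.

Lemma twisted_cocomm b :
  \lin_(a <- mcomul b) sgn a.1 a.2 *: << (a.2, a.1) >> = mcomul b.
Proof.
apply/malgP => -[x y]; rewrite (@mcoeff_linM _ _ _ _ _ _ (y, x)).
  rewrite mcoeffZ mcoeff_basis eqxx mulr1 !mcomulE /= mprodC.
  case: eqP => [e|_]; last by rewrite mul0r.
  by rewrite (mtwistC e) mulrC [(mdg y * _)%N]mulnC.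
move=> [s t] _; rewrite mcoeffZ mcoeff_basis !xpair_eqE /= andbC => /negPf->.
by rewrite mulr0.
Qed.

Definition twisted_coalg : bcoalg k :=
  @BCoalg k B (mone B) (@mcomul k B) (fun b c => sgn b c) (@mwt k B)
    twisted_coassoc twisted_counitl twisted_counitr twisted_wtD (@mwt_eq0 k B)
    twisted_sgnC twisted_sgnDl twisted_sgnK twisted_sgn1l twisted_cocomm.

End TwistedCoalgebra.

(** A weight of one is not the sum of two positive weights. *)
Lemma comul_primitive (k : fieldType) (A : bcoalg k) (b : A) : bwt b = 1%N ->
  bcomul b = << (b, bone) >> + << (bone, b) >>.
Proof.
move=> wb; have nb : nonunit b by rewrite /nonunit -bwt_gt0 wb.
rewrite -[LHS]lin_id; transitivity (\lin_(a <- bcomul b) << (a.1, a.2) >>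
    : {malg k[(A * A)%type]}); first by apply: eq_lin => -[].
rewrite (comul_reduced (fun x y => << (x, y) >>) nb).
have -> : \lin_(a <- bcomul b) reduced (fun x y => << (x, y) >>) a
        = 0 :> {malg k[(A * A)%type]}.
  rewrite -[RHS](lin0f _ (bcomul b)); apply: eq_in_lin => a /bwtD e.
  rewrite /reduced; case: ifP => // /norP[]; rewrite -!bwt_gt0; lia.
by rewrite add0r addrC.
Qed.

(** The factorizations of c with a generator on the right are c = q i * gen i. *)
Lemma lin_generators (k : fieldType) (B : twisted_monoid k) (G : eqType)
    (gen : G -> B) (ungen : B -> option G) (c : B) (r : seq G) (q : G -> B)
    (V : lmodType k) (H : B -> G -> V) :
  (forall b i, ungen b = Some i -> b = gen i) ->
  (forall i, ungen (gen i) = Some i) -> uniq r ->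
  (forall x i, (mprod x (gen i) == Some c) = (i \in r) && (x == q i)) ->
  \lin_(a <- mcomul c) (if ungen a.2 is Some i then H a.1 i else 0)
  = \sum_(i <- r) mtwist (q i) (gen i) *: H (q i) i.
Proof.
move=> ungenP genK ur qP.
pose F (a : B * B) := if ungen a.2 is Some i then H a.1 i else 0.
pose y : {malg k[(B * B)%type]} := \sum_(i <- r) mtwist (q i) (gen i) *: << (q i, gen i) >>.
have -> : \sum_(i <- r) mtwist (q i) (gen i) *: H (q i) i = lin F y.
  by rewrite lin_sum; apply: eq_bigr => i _; rewrite linZ linU /F /= genK.
have -> : y = restrict (fun a => ungen a.2 != None) (mcomul c).
  apply/malgP => -[x z]; rewrite mcoeff_restrict mcomulE raddf_sum /=.
  under eq_bigr do rewrite mcoeffZ mcoeff_basis xpair_eqE.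
  case ez : (ungen z) => [j|] /=; last first.
    rewrite big1 // => i _; case: (gen i =P z) => [e|]; last by rewrite andbF mulr0.
    by move: ez; rewrite -e genK.
  rewrite (ungenP _ _ ez) qP; case: ifP => [/andP[jr /eqP->]|nx].
    rewrite (bigD1_seq j) //= !eqxx mulr1 big1 ?addr0 // => i ij.
    case: (gen i =P gen j) => [/(congr1 ungen)|]; last by rewrite andbF mulr0.
    by rewrite !genK => -[e]; rewrite e eqxx in ij.
  rewrite big_seq big1 // => i ir; case: eqP => [e|_]; last by rewrite mulr0.
  case: (gen i =P gen j) => [/(congr1 ungen)|]; last by rewrite mulr0.
  by rewrite !genK => -[ei]; move: nx; rewrite -ei ir -e eqxx.
rewrite /restrict lin_lin; apply: eq_lin => a; rewrite -/(F a).
by case: ifP => [_|]; rewrite ?linU // lin0 /F; case: (ungen _).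
Qed.

(** * Models generated by the primitive letters *)

Section Generators.
Variables (k : fieldType) (A : bcoalg k) (G : countType) (L : choiceType).
Variables (gen : G -> A) (ungen : A -> option G) (gmul : G -> L -> {malg k[L]}).
Hypothesis ungenP : forall b i, ungen b = Some i -> b = gen i.
Hypothesis gmulC : forall i j l,
  lin (gmul i) (gmul j l) = - bsgn (gen i) (gen j) *: lin (gmul j) (gmul i l).
Hypothesis gmul_square : forall b i l, (gen i, gen i) \in msupp (bcomul b) ->
  lin (gmul i) (gmul i l) = 0.

Definition gact b l : {malg k[L]} := if ungen b is Some i then gmul i l else 0.

Lemma lin_gact b x :
  lin (gact b) x = if ungen b is Some i then lin (gmul i) x else 0.
Proof. by rewrite /gact; case: (ungen b) => [i|] //; rewrite lin0f. Qed.

Lemma gactC b c l :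
  lin (gact b) (gact c l) = - bsgn b c *: lin (gact c) (gact b l).
Proof.
rewrite !lin_gact /gact; case eb : (ungen b) => [i|]; case ec : (ungen c) => [j|];
  rewrite ?lin0 ?scaler0 //.
by rewrite (ungenP eb) (ungenP ec) gmulC.
Qed.

Definition gen_lt (b c : A) : bool :=
  if (ungen b, ungen c) is (Some i, Some j)
  then (choice.pickle i < choice.pickle j)%N else false.

(** The relations between the generators are paired by cocommutativity: the
   terms with the larger generator first cancel those with the smaller one
   first, without dividing by two. *)
Lemma gact_quad b l : \lin_(a <- bcomul b) lin (gact a.1) (gact a.2 l) = 0.
Proof.
pose H x y := lin (gact x) (gact y l).
transitivity (\lin_(a <- bcomul b) (if gen_lt a.2 a.1 then H a.1 a.2 else 0)
            + \lin_(a <- bcomul b) (if gen_lt a.1 a.2 then H a.1 a.2 else 0)).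
  rewrite -linDf; apply: eq_in_lin => -[x y] hxy; rewrite -/(H x y) /gen_lt /=.
  have [ex|[i ex]] : ungen x = None \/ exists i, ungen x = Some i.
  - by case: (ungen x) => [i|]; [right; exists i | left].
  - rewrite ex /H lin_gact ex; by case: (ungen y) => [j|]; rewrite addr0.
  have [ey|[j ey]] : ungen y = None \/ exists i, ungen y = Some i.
  - by case: (ungen y) => [j|]; [right; exists j | left].
  - by rewrite ex ey /H [gact y l]/gact ey lin0 addr0.
  rewrite ex ey; case: ltngtP => [_|_|e]; rewrite ?addr0 ?add0r //.
  have eij : i = j by apply: (pcan_inj choice.pickleK).
  rewrite /H lin_gact ex /gact ey -eij; apply: (@gmul_square b).
  by move: hxy; rewrite (ungenP ex) (ungenP ey) eij.
rewrite (cocommE (fun x y => if gen_lt y x then H x y else 0)) -linDf.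
rewrite -[RHS](lin0f _ (bcomul b)); apply: eq_lin => a.
case: ifP => _; last by rewrite scaler0 addr0.
by rewrite /H gactC scalerA mulrN (bsgnC a.2) bsgnK scaleN1r addNr.
Qed.

End Generators.

(** * Signs of finite sets of generators *)

Lemma signr_eq (R : pzRingType) m n : odd m = odd n -> (-1) ^+ m = (-1) ^+ n :> R.
Proof. by move=> e; rewrite -signr_odd e signr_odd. Qed.

Section FiniteSets.
Variable I : countType.
Implicit Types (S P Q R : {fset I}) (i j : I).

Local Notation code := (@choice.pickle I).

Definition below i S : nat := (\sum_(l <- S) (code l < code i))%N.
Definition above i S : nat := (\sum_(l <- S) (code i < code l))%N.

Definition splits S P Q := ((P `&` Q == fset0) && (P `|` Q == S))%fset.

Lemma splitsP S P Q :
  reflect (forall x, ((x \in P) + (x \in Q) = (x \in S))%N) (splits S P Q).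
Proof.
apply: (iffP andP) => [[/eqP e /eqP <-] x|h].
  have := congr1 (fun X : {fset I} => x \in X) e; rewrite !in_fsetE.
  by case: (x \in P); case: (x \in Q).
split; apply/eqP/fsetP => x; rewrite !in_fsetE; have := h x;
  by case: (x \in P); case: (x \in Q); case: (x \in S).
Qed.

Lemma big_splits (R : Type) (idx : R) (op : Monoid.com_law idx) S P Q (F : I -> R) :
  splits S P Q ->
  \big[op/idx]_(i <- S) F i
  = op (\big[op/idx]_(i <- P) F i) (\big[op/idx]_(i <- Q) F i).
Proof.
move=> /splitsP h; rewrite -big_cat; apply: perm_big.
apply: uniq_perm; rewrite ?fset_uniq // ?cat_uniq ?fset_uniq ?andbT //=.
  by apply/hasPn => x xQ; apply/negP => xP; have := h x; rewrite xP xQ; case: (x \in S).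
by move=> x; rewrite mem_cat; have := h x;
  case: (x \in P); case: (x \in Q); case: (x \in S).
Qed.

Lemma splitsC S P Q : splits S P Q = splits S Q P.
Proof. by rewrite /splits fsetIC fsetUC. Qed.

Lemma splitsU1 i S : i \notin S -> splits (i |` S)%fset [fset i]%fset S.
Proof.
move=> ni; apply/splitsP => x; rewrite !in_fsetE.
by case: eqP => // ->; rewrite (negPf ni).
Qed.

Lemma splitsD1 i S : i \in S -> splits S [fset i]%fset (S `\ i)%fset.
Proof.
by move=> iS; apply/splitsP => x; rewrite !in_fsetE; case: eqP => [->|]; rewrite ?iS.
Qed.

Lemma inversions_splitl S P Q R : splits S P Q ->
  inversions S R = (inversions P R + inversions Q R)%N.
Proof. by move=> h; rewrite /inversions (big_splits _ _ h). Qed.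

Lemma inversions_splitr S P Q R : splits S P Q ->
  inversions R S = (inversions R P + inversions R Q)%N.
Proof.
move=> h; rewrite /inversions -big_split /=; apply: eq_bigr => i _.
by rewrite (big_splits _ _ h).
Qed.

Lemma below_split i S P Q : splits S P Q -> below i S = (below i P + below i Q)%N.
Proof. by move=> h; rewrite /below (big_splits _ _ h). Qed.

Lemma card_split S P Q : splits S P Q -> #|` S| = (#|` P| + #|` Q|)%N.
Proof.
move=> h; have e (X : {fset I}) : #|` X| = (\sum_(x <- X) 1)%N.
  by rewrite big_const_seq count_predT iter_addn mul1n addn0.
by rewrite !e (big_splits _ _ h).
Qed.

Lemma inversions1l i S : inversions [fset i]%fset S = below i S.
Proof. by rewrite /inversions big_seq_fset1. Qed.

Lemma inversions1r i S : inversions S [fset i]%fset = above i S.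
Proof. by rewrite /inversions; apply: eq_bigr => j _; rewrite big_seq_fset1. Qed.

Lemma inversions0l S : inversions fset0 S = 0%N.
Proof. by rewrite /inversions big_seq_fset0. Qed.

Lemma code_inj : injective code.
Proof. exact: (pcan_inj choice.pickleK). Qed.

Lemma below_above i S : i \notin S -> (below i S + above i S = #|` S|)%N.
Proof.
move=> ni; have -> : #|` S| = (\sum_(x <- S) 1)%N.
  by rewrite big_const_seq count_predT iter_addn mul1n addn0.
rewrite /below /above -big_split /= [LHS]big_seq [RHS]big_seq; apply: eq_bigr => x xS.
by case: (ltngtP (code x) (code i)) => // /code_inj e; rewrite -e xS in ni.
Qed.

(** Every pair of elements is an inversion in exactly one of the two orders. *)
Lemma inversionsC S P Q : splits S P Q ->
  (inversions P Q + inversions Q P = #|` P| * #|` Q|)%N.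
Proof.
move=> /splitsP h; rewrite /inversions [X in (_ + X)%N]exchange_big -big_split /=.
have e (X : {fset I}) : #|` X| = (\sum_(x <- X) 1)%N.
  by rewrite big_const_seq count_predT iter_addn mul1n addn0.
rewrite e big_distrl /= [LHS]big_seq [RHS]big_seq; apply: eq_bigr => i iP.
rewrite mul1n -(@below_above i Q) /below /above ?big_split //.
by apply/negP => iQ; have := h i; rewrite iP iQ; case: (i \in S).
Qed.

Lemma splits_addl i S P Q : i \in P -> i \notin Q ->
  splits S (P `\ i)%fset Q = (i \notin S) && splits (i |` S)%fset P Q.
Proof.
move=> iP iQ; apply/splitsP/andP => [h|[iS /splitsP h] x].
  have iS : i \notin S.
    by have := h i; rewrite !in_fsetE eqxx (negPf iQ) /=; case: (i \in S).
  split=> //; apply/splitsP => x; have := h x; rewrite !in_fsetE.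
  by case: (x =P i) => [->|_] //=; rewrite iP (negPf iQ).
have := h x; rewrite !in_fsetE.
by case: (x =P i) => [->|_] //=; rewrite (negPf iQ) (negPf iS).
Qed.

Lemma splits_swap i S P Q : i \in P -> i \in Q ->
  splits S (P `\ i)%fset Q = splits S P (Q `\ i)%fset.
Proof.
move=> iP iQ; apply/splitsP/splitsP => h x; have := h x; rewrite !in_fsetE;
  by case: (x =P i) => [->|_] //=; rewrite iP iQ.
Qed.

Variable k : fieldType.

Lemma ext_comultE S P Q : (@ext_comult k I S)@_(P, Q)
  = if splits S P Q then (-1) ^+ inversions P Q else 0.
Proof.
rewrite /ext_comult raddf_sum /=.
under eq_bigr do rewrite mcoeffZ mcoeff_basis xpair_eqE.
have [PS|nPS] := boolP (P `<=` S)%fset; last first.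
  rewrite big_seq big1 => [|A]; last first.
    rewrite fpowersetE => AS; case: (A =P P) => [e|_]; last by rewrite mulr0.
    by rewrite -e AS in nPS.
  case: ifP => // /andP[_ /eqP e]; case/negP: nPS; rewrite -e; exact: fsubsetUl.
rewrite (bigD1_seq P) ?fset_uniq ?fpowersetE //= eqxx /= big1 ?addr0; last first.
  by move=> A /negPf->; rewrite mulr0.
have -> : splits S P Q = ((S `\` P)%fset == Q).
  apply/splitsP/eqP => [h|<- x].
    apply/fsetP => x; have := h x; rewrite !in_fsetE.
    by case: (x \in P); case: (x \in Q); case: (x \in S).
  have := fsubsetP PS x; rewrite !in_fsetE.
  by case: (x \in P); case: (x \in S) => // /(_ isT).
by case: eqP => [->|_]; rewrite ?mulr1 ?mulr0.
Qed.

(** ** The exterior algebra *)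

Definition zmul i S : {malg k[{fset I}]} :=
  if i \in S then 0 else (-1) ^+ below i S *: << (i |` S)%fset >>.

Lemma zmul_len i S T : T \in msupp (zmul i S) -> #|` T| = #|` S|.+1.
Proof.
rewrite /zmul; case: ifP => iS; first by rewrite msupp0.
have h : supp_on (fun U : {fset I} => #|` U| == #|` S|.+1)
    ((-1) ^+ below i S *: << (i |` S)%fset >> : {malg k[{fset I}]}).
  by apply/supp_onZ/supp_onU; rewrite cardfsU1 iS.
by move=> hT; have /supp_onP/(_ _ hT)/eqP := h.
Qed.

Lemma zmul_zmul i S : lin (zmul i) (zmul i S) = 0.
Proof.
rewrite {2}/zmul; case: ifP => iS; first by rewrite lin0.
by rewrite linZ linU /zmul in_fsetE in_fset1 eqxx scaler0.
Qed.

Lemma zmul_notin i S : i \notin S -> zmul i S = (-1) ^+ below i S *: << (i |` S)%fset >>.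
Proof. by rewrite /zmul => /negPf->. Qed.

Lemma zmul_zmulE i j S : lin (zmul i) (zmul j S) =
  if [|| i == j, i \in S | j \in S] then 0
  else (-1) ^+ (below j S + ((code j < code i) + below i S))
         *: << (i |` (j |` S))%fset >>.
Proof.
have [->|ij] := eqVneq i j; first exact: zmul_zmul.
have [jS|jS] := boolP (j \in S); first by rewrite {2}/zmul jS lin0 orbT.
rewrite orbF (zmul_notin jS) linZ linU /zmul in_fsetE in_fset1 (negPf ij) /=.
case: (i \in S); first exact: scaler0.
by rewrite (below_split _ (splitsU1 jS)) scalerA -exprD /below big_seq_fset1.
Qed.

Lemma zmulC i j S : lin (zmul i) (zmul j S) = - lin (zmul j) (zmul i S).
Proof.
apply: etrans (zmul_zmulE i j S) (etrans _ (congr1 -%R (esym (zmul_zmulE j i S)))).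
rewrite [j == i]eq_sym [(j \in S) || (i \in S)]orbC.
case: (boolP [|| i == j, i \in S | j \in S]) => [_|/norP[ij _]];
  first exact: esym (oppr0 _).
rewrite fsetUCA -scaleNr; apply: f_equal2 => //.
rewrite -[RHS]mulN1r -exprS; apply: signr_eq; rewrite /= !oddD.
case: (ltngtP (code i) (code j)) => [_|_|/code_inj e] /=;
  last by rewrite e eqxx in ij.
all: by case: (odd _); case: (odd _).
Qed.

(** The coproduct is multiplicative and the generator i is primitive.  In the
   coefficient of (P, Q), i belongs to exactly one of P and Q on the left; when
   it belongs to both, the two terms on the right cancel. *)
Lemma ext_comult_zmul i S : lin (@ext_comult k I) (zmul i S)
  = \lin_(p <- @ext_comult k I S)
      (\lin_(m <- zmul i p.1) << (m, p.2) >>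
       + (-1) ^+ #|` p.1| *: \lin_(m <- zmul i p.2) << (p.1, m) >>).
Proof.
apply/malgP => -[P Q]; rewrite linDf mcoeffD.
have el : (\lin_(p <- @ext_comult k I S) \lin_(m <- zmul i p.1) << (m, p.2) >>
    : {malg k[({fset I} * {fset I})%type]})@_(P, Q)
  = if (i \in P) && splits S (P `\ i)%fset Q
    then (-1) ^+ (inversions (P `\ i)%fset Q + below i (P `\ i)%fset) else 0.
  rewrite (@mcoeff_linM _ _ _ _ _ _ (P `\ i, Q)%fset).
    rewrite ext_comultE /zmul /= in_fsetE in_fset1 eqxx /= linZ linU mcoeffZ mcoeff_basis.
    rewrite xpair_eqE eqxx andbT exprD; have [iP|iP] := boolP (i \in P).
      by rewrite fsetD1K // eqxx mulr1; case: ifP; rewrite ?mul0r.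
    case: eqP => [e|_]; last by rewrite !mulr0.
    by move: iP; rewrite -e in_fsetE in_fset1 eqxx.
  move=> [P' Q'] _; rewrite /zmul /=; case: ifP => iP'; first by rewrite lin0 mcoeff0.
  rewrite linZ linU mcoeffZ mcoeff_basis !xpair_eqE => ne.
  case: ((i |` P')%fset =P P) => [e|]; last by rewrite mulr0.
  by move: ne; rewrite -e fsetU1K ?iP' // eqxx /= => /negPf->; rewrite mulr0.
have er : (lin (fun p : {fset I} * {fset I} =>
      (-1) ^+ #|` p.1| *: \lin_(m <- zmul i p.2) << (p.1, m) >>) (@ext_comult k I S)
    : {malg k[({fset I} * {fset I})%type]})@_(P, Q)
  = if (i \in Q) && splits S P (Q `\ i)%fset
    then (-1) ^+ (inversions P (Q `\ i)%fset + #|` P| + below i (Q `\ i)%fset) else 0.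
  rewrite (@mcoeff_linM _ _ _ _ _ _ (P, Q `\ i)%fset).
    rewrite ext_comultE /zmul /= in_fsetE in_fset1 eqxx /= linZ linU !mcoeffZ mcoeff_basis.
    rewrite xpair_eqE eqxx !exprD; have [iQ|iQ] := boolP (i \in Q).
      by rewrite fsetD1K // eqxx mulr1; case: ifP; rewrite ?mul0r // mulrA.
    case: eqP => [e|_]; last by rewrite !mulr0.
    by move: iQ; rewrite -e in_fsetE in_fset1 eqxx.
  move=> [P' Q'] _; rewrite /zmul /=; case: ifP => iQ'; first by rewrite lin0 scaler0 mcoeff0.
  rewrite linZ linU !mcoeffZ mcoeff_basis !xpair_eqE => ne.
  case: ((i |` Q')%fset =P Q) => [e|]; last by rewrite andbF !mulr0.
  by move: ne; rewrite -e fsetU1K ?iQ' // eqxx andbT => /negPf->; rewrite !mulr0.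
rewrite el er {el er}.
have -> : (lin (@ext_comult k I) (zmul i S))@_(P, Q)
  = if (i \notin S) && splits (i |` S)%fset P Q
    then (-1) ^+ (below i S + inversions P Q) else 0.
  rewrite /zmul; case: ifP => iS /=; first by rewrite lin0 mcoeff0.
  rewrite linZ linU mcoeffZ ext_comultE exprD; case: ifP; by rewrite ?mulr0.
have [iP|iP] := boolP (i \in P); have [iQ|iQ] := boolP (i \in Q) => /=.
- have -> : splits (i |` S)%fset P Q = false.
    apply/negP => /splitsP/(_ i); rewrite iP iQ; by case: (_ \in _).
  rewrite andbF (splits_swap _ iP iQ); case: ifP => h; last by rewrite addr0.
  apply/esym/eqP; rewrite addr_eq0 -[X in _ == X]mulN1r -exprS; apply/eqP/signr_eq.
  have sP := splitsD1 iP; have sQ := splitsD1 iQ.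
  rewrite (inversions_splitr _ sQ) inversions1r (inversions_splitl _ sP) inversions1l.
  have nP : i \notin (P `\ i)%fset by rewrite in_fsetE in_fset1 eqxx.
  rewrite (card_split sP) -(below_above nP) cardfs1 /= !oddD.
  by case: (odd _); case: (odd _); case: (odd _); case: (odd _).
- rewrite addr0 (splits_addl _ iP iQ); case: ifP => // /andP[iS h].
  apply: signr_eq; have hS : splits S (P `\ i)%fset Q.
    by rewrite (splits_addl _ iP iQ) iS.
  rewrite (below_split _ hS) (inversions_splitl _ (splitsD1 iP)) inversions1l !oddD.
  by case: (odd _); case: (odd _); case: (odd _).
- rewrite add0r splitsC (splitsC S) (splits_addl _ iQ iP).
  case: ifP => // /andP[iS h].
  have hS : splits S (Q `\ i)%fset P by rewrite (splits_addl _ iQ iP) iS.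
  apply: signr_eq; rewrite (below_split _ hS) (inversions_splitr _ (splitsD1 iQ)).
  rewrite inversions1r -(below_above iP) !oddD.
  by case: (odd _); case: (odd _); case: (odd _); case: (odd _).
- rewrite addr0; case: ifP => // /andP[_ /splitsP/(_ i)].
  by rewrite (negPf iP) (negPf iQ) in_fsetE in_fset1 eqxx.
Qed.

End FiniteSets.

(** * Multisets of generators *)

Section Multisets.
Variable I : countType.
Implicit Types (m x y z : {mset I}%mset) (i j : I).

Lemma enum_msetD_perm x y : perm_eq (x `+` y)%mset (x ++ y).
Proof. by apply/allP => i _ /=; rewrite count_cat !count_mem_mset msetE2. Qed.

Lemma size_msetD x y : size (x `+` y)%mset = (size x + size y)%N.
Proof. by rewrite (perm_size (enum_msetD_perm x y)) size_cat. Qed.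

Lemma size_mset_eq0 x : (size x == 0%N) = (x == mset0).
Proof.
apply/nilP/eqP => [e|->]; last exact: enum_mset0.
by apply/msetP => i; rewrite -count_mem_mset e mset0E.
Qed.

Lemma enum_mset1 i : [mset i]%mset = [:: i] :> seq I.
Proof. exact: enum_msetn. Qed.

Lemma enum_mset_inj x y : x = y :> seq I -> x = y.
Proof. by move=> e; apply/msetP => i; rewrite -!count_mem_mset e. Qed.

Lemma msetD_cancel x y z : (x `+` z = y `+` z)%mset -> x = y.
Proof. by move=> /(congr1 (fun m => (m `\` z)%mset)); rewrite !msetDKBC. Qed.

Lemma mset_split1 x i m : i \in m -> ((i +` x == m) = (x == m `\ i))%mset.
Proof.
move=> im; apply/eqP/eqP => [<-|->]; last exact: msetB1K.
by rewrite msetD1K.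
Qed.

Section Degree.
Variables (G : nmodType) (d : I -> G).

Lemma mdeg_enum m : Defs.mdeg d m = \sum_(i <- m) d i.
Proof. by rewrite big_mset; apply: eq_bigr. Qed.

End Degree.

Lemma finite_submsets m : finite_set [set a : {mset I}%mset | (a `<=` m)%mset]%classic.
Proof.
pose f (b : (size m).-tuple bool) := seq_mset (mask b m).
apply: (@sub_finite_set _ _ [set f b | b in setT]%classic); last first.
  by apply: finite_image; apply: finite_finset.
move=> a /= /msubsetP le.
have /count_subseqP[s /subseqP[b sb ->] e] : forall i, (count_mem i a <= count_mem i m)%N.
  by move=> i; rewrite !count_mem_mset.
have sb' : size b == size m by rewrite sb.
by exists (Tuple sb') => //; rewrite /f /= -[RHS]seq_mset_id; apply/esym/eq_seq_msetP.
Qed.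

Variable k : fieldType.

(** The complement of x in m is y exactly when the sum of x and y is m. *)
Lemma sum_submsetsE (c : {mset I}%mset -> k) m x y :
  (\sum_(a \in [set a : {mset I}%mset | (a `<=` m)%mset]%classic)
      c a *: << (a, (m `\` a)%mset : {mset I}%mset) >>
    : {malg k[({mset I}%mset * {mset I}%mset)%type]})@_(x, y)
  = if (x `+` y == m)%mset then c x else 0.
Proof.
rewrite fsbig_finite ?raddf_sum /=; last exact: finite_submsets.
under eq_bigr do rewrite mcoeffZ mcoeff_basis xpair_eqE.
have [le|nle] := boolP (x `<=` m)%mset; last first.
  rewrite ifF; last by apply: contraNF nle => /eqP <-; apply/msubsetP => i; rewrite msetE2 leq_addr.
  rewrite big_seq big1 // => a; rewrite in_fset_set ?inE; last exact: finite_submsets.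
  by case: (a =P x) => [-> /= h|_ _]; [rewrite h in nle | rewrite mulr0].
rewrite (bigD1_seq x) ?fset_uniq //=; last first.
  by rewrite in_fset_set ?inE //; apply: finite_submsets.
rewrite big1 ?addr0 => [|a /negPf->]; last by rewrite mulr0.
rewrite eqxx /=; have -> : (x `+` y == m)%mset = (m `\` x == y)%mset.
  apply/eqP/eqP => <-; [exact: msetDKB | exact: msetBDKC].
by case: eqP; rewrite ?mulr1 ?mulr0.
Qed.

Lemma divpow_comultE m x y :
  (@divpow_comult k I m)@_(x, y) = if (x `+` y == m)%mset then 1 else 0.
Proof.
rewrite -(sum_submsetsE (fun=> 1)) /divpow_comult; congr (_@__).
by apply: eq_fsbigr => a _; rewrite scale1r.
Qed.

(** The number of ways to distribute the factors of the monomial x + y, all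
   distinguished, into the monomials x and y. *)
Definition binomials x y : nat := \prod_(i <- finsupp (x `+` y)%mset) 'C(x i + y i, x i).

Lemma poly_comultE m x y :
  (@poly_comult k I m)@_(x, y) = if (x `+` y == m)%mset then (binomials x y)%:R else 0.
Proof.
rewrite /poly_comult sum_submsetsE; case: eqP => // <-; congr (_%:R).
by apply: eq_bigr => i _; rewrite msetE2.
Qed.

Lemma binomialsE (D : {fset I}) x y : (finsupp (x `+` y)%mset `<=` D)%fset ->
  binomials x y = (\prod_(i <- D) 'C(x i + y i, x i))%N.
Proof.
move=> sD; rewrite /binomials; apply: (big_fset_incl _ sD) => i _.
by rewrite -[_ \in _]/(i \in _) msuppE -mset_eq0 msetE2 addn_eq0 => /andP[/eqP-> /eqP->].
Qed.

(** Only the binomial coefficient at i changes. *)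
Lemma binomials_pascal i x y : i \in (x `+` y)%mset ->
  binomials x y = ((if i \in x then binomials (x `\ i)%mset y else 0)
                 + (if i \in y then binomials x (y `\ i)%mset else 0))%N.
Proof.
set D := finsupp (x `+` y)%mset => ixy.
have iD : i \in D by rewrite msuppE.
have sub (u v : {mset I}%mset) : (u `<=` x)%mset -> (v `<=` y)%mset ->
    (finsupp (u `+` v)%mset `<=` D)%fset.
  move=> ux vy; apply/fsubsetP => j; rewrite !msuppE !in_msetD.
  by case/orP => [/(msubset_subset ux)|/(msubset_subset vy)] ->; rewrite ?orbT.
have le1 (u : {mset I}%mset) : (u `\ i `<=` u)%mset.
  by apply/msubsetP => j; rewrite msetB1E leq_subr.
rewrite !(@binomialsE D) ?sub ?msubset_refl ?le1 //.
rewrite !(bigD1_seq i iD (fset_uniq _)) /= !msetB1E eqxx.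
set P := (\prod_(_ <- _ | _) _)%N.
have -> : (\prod_(j <- D | j != i) 'C((x `\ i)%mset j + y j, (x `\ i)%mset j) = P)%N.
  by apply: eq_bigr => j /negPf ji; rewrite msetB1E ji subn0.
have -> : (\prod_(j <- D | j != i) 'C(x j + (y `\ i)%mset j, x j) = P)%N.
  by apply: eq_bigr => j /negPf ji; rewrite msetB1E ji subn0.
move: ixy; rewrite in_msetD !in_mset.
case: (x i) => [|a]; case: (y i) => [|b] //= _; rewrite ?subn1 /=.
- by rewrite !bin0.
- by rewrite !addn0 !binn.
- by rewrite addSn binS addSnnS -mulnDl [('C(_, a) + _)%N]addnC.
Qed.

End Multisets.

(** * Contractions by moving the extreme generator *)

Section ExtremeElement.
Variables (I : countType) (R : rel nat).
Hypotheses (Rtot : total R) (Rtr : transitive R).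

Definition extreme (D : {fset I}) : option I :=
  ohead (sort (relpre (@choice.pickle I) R) D).

Lemma extremeP D i : extreme D = Some i ->
  i \in D /\ (forall j, j \in D -> R (choice.pickle i) (choice.pickle j)).
Proof.
rewrite /extreme => e; have ms j : (j \in D) = (j \in sort (relpre (@choice.pickle I) R) D).
  by rewrite mem_sort.
have : sorted (relpre (@choice.pickle I) R) (sort (relpre (@choice.pickle I) R) D).
  by apply: sort_sorted => a b; apply: Rtot.
move: e ms; case: (sort _ D) => [|a s] // -[->] ms /= ps; split=> [|j].
  by rewrite ms mem_head.
rewrite ms inE => /predU1P[->|js]; first by have := Rtot (choice.pickle i) (choice.pickle i); rewrite orbb.
by move/(order_path_min (fun a b c => @Rtr _ _ _))/allP: ps => /(_ _ js).
Qed.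

Lemma extreme_None D : extreme D = None -> D = fset0.
Proof.
rewrite /extreme => e; apply/fsetP => j; rewrite in_fset0.
have : (j \in D) = (j \in sort (relpre (@choice.pickle I) R) D) by rewrite mem_sort.
by case: (sort _ D) e => // _ ->.
Qed.

End ExtremeElement.

Section MoveContraction.
Variables (k : fieldType) (I X : choiceType).
Variables (dom : X -> {fset I}) (lead : X -> option I) (can : I -> X -> bool).
Variables (push back : I -> X -> X) (sg : I -> X -> k).

(** The common form of both Koszul complexes: a basis element distributes
   generators over two factors, push moves one of them from the coalgebra to the
   model, and back moves it from the model to the coalgebra. *)
Definition move_dif x : {malg k[X]} :=
  \sum_(j <- dom x) (if can j x then sg j x *: << push j x >> else 0).

Definition move_htp x : {malg k[X]} :=
  if lead x is Some i then if can i x then 0 else << back i x >> else 0.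

Hypothesis lead_dom : forall x i, lead x = Some i -> i \in dom x.
Hypothesis lead_push : forall x j, can j x -> lead (push j x) = lead x.
Hypothesis dom_back : forall x i, lead x = Some i -> ~~ can i x -> dom (back i x) = dom x.
Hypothesis back_can : forall x i, lead x = Some i -> ~~ can i x ->
  [/\ can i (back i x), sg i (back i x) = 1 & push i (back i x) = x].
Hypothesis push_can : forall x i, lead x = Some i -> can i x ->
  [/\ ~~ can i (push i x), sg i x = 1 & back i (push i x) = x].
Hypothesis can_push : forall x i j, lead x = Some i -> j != i -> can j x ->
  can i (push j x) = can i x.
Hypothesis can_back : forall x i j, lead x = Some i -> j != i -> ~~ can i x ->
  can j (back i x) = can j x.
Hypothesis back_push : forall x i j, lead x = Some i -> j != i -> ~~ can i x -> can j x ->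
  sg j (back i x) = - sg j x /\ push j (back i x) = back i (push j x).

(** The leading generator is moved back whenever possible.  In the homotopy
   formula for x the moves of all the other generators cancel, and exactly
   one of the two compositions moves the leading generator there and back. *)
Lemma move_contraction x i : lead x = Some i ->
  lin move_dif (move_htp x) + lin move_htp (move_dif x) = << x >>.
Proof.
move=> li; have iD := lead_dom li.
have hpush j : can j x ->
    move_htp (push j x) = if can i (push j x) then 0 else << back i (push j x) >>.
  by move=> cj; rewrite /move_htp (lead_push cj) li.
have ->: lin move_htp (move_dif x)
    = \sum_(j <- dom x) (if can j x then sg j x *: move_htp (push j x) else 0).
  rewrite lin_sum; apply: eq_bigr => j _; case: ifP => _; last by rewrite lin0.
  by rewrite linZ linU.
rewrite (bigD1_seq i iD (fset_uniq _)) /= {1}/move_htp li.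
have [ci|ci] := boolP (can i x).
  have [cp e b] := push_can li ci.
  rewrite lin0 add0r e (hpush _ ci) (negPf cp) b scale1r big1 ?addr0 // => j ji.
  case: ifP => // cj; rewrite (hpush _ cj) (can_push li ji cj) ci; exact: scaler0.
have [cb e p] := back_can li ci.
rewrite linU {1}/move_dif (dom_back li ci) (bigD1_seq i iD (fset_uniq _)) /=.
rewrite cb e p scale1r add0r -addrA -big_split /= big1 ?addr0 // => j ji.
rewrite (can_back li ji ci); case: ifP => cj; last exact: addr0.
rewrite (hpush _ cj) (can_push li ji cj) (negPf ci).
have [-> ->] := back_push li ji ci cj.
by rewrite scaleNr addNr.
Qed.

End MoveContraction.

Section GeneratedModels.
Variables (k : fieldType) (A : bcoalg k) (K : koszul A).
Variables (deg : A -> nat) (dK : K -> nat).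
Hypothesis deg1 : deg bone = 0%N.

(** Only the two trivial splittings of b contribute. *)
Lemma sum_tens_act b (y : {malg k[(K * K)%type]}) : bwt b = 1%N ->
  \lin_(a <- bcomul b) \lin_(p <- y)
     (-1) ^+ (deg a.2 * dK p.1) *: @tens_act k A A K K a p
  = \lin_(p <- y) (\lin_(m <- kact b p.1) << (m, p.2) >>
      + (-1) ^+ (deg b * dK p.1 + klen p.1) *: \lin_(m <- kact b p.2) << (p.1, m) >>).
Proof.
move=> wb; have nb : (b == bone) = false by rewrite -bwt_eq0 wb.
rewrite (comul_primitive wb) linD !linU -linDf; apply: eq_lin => p.
rewrite /tens_act /lact /ract /= eqxx nb add0r addr0 deg1 mul0n scale1r.
by rewrite scalerA -exprD.
Qed.

Lemma sum_tens_act_wt b (y : {malg k[(K * K)%type]}) : bwt b != 1%N ->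
  \lin_(a <- bcomul b) \lin_(p <- y)
     (-1) ^+ (deg a.2 * dK p.1) *: @tens_act k A A K K a p = 0.
Proof.
move=> wb; rewrite -[RHS](lin0f _ (bcomul b)); apply: eq_in_lin => a ha.
rewrite -[RHS](lin0f _ y); apply: eq_lin => p.
by rewrite tens_act_wt ?scaler0 // /= /tens_wt (bwtD ha).
Qed.

End GeneratedModels.

(** * The divided power coalgebra and its model *)

Section DividedPowers.
Variables (k : fieldType) (I : countType) (dx : I -> nat).
Hypothesis dx_even : forall i, ~~ odd (dx i).

Local Notation mon := ({mset I}%mset).
Local Notation deg := (Defs.mdeg dx).
Implicit Types (c x y z : mon) (S T : {fset I}) (i j : I).

Lemma degE c : deg c = (\sum_(i <- c) dx i)%N.
Proof. exact: mdeg_enum. Qed.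

Lemma degD x y : deg (x `+` y)%mset = (deg x + deg y)%N.
Proof. by rewrite !degE (perm_big _ (enum_msetD_perm x y)) big_cat. Qed.

Lemma deg_even c : odd (deg c) = false.
Proof.
rewrite degE; elim/big_rec: _ => // i n _ e.
by rewrite oddD e (negPf (dx_even i)).
Qed.

Lemma divpow_mcomulE c x y : (@divpow_comult k I c)@_(x, y)
  = if Some (x `+` y)%mset == Some c then 1 else 0.
Proof. exact: divpow_comultE. Qed.

Lemma even_sign m n : odd m = false -> (-1) ^+ (m * n) = 1 :> k.
Proof. by move=> e; rewrite -signr_odd oddM e expr0. Qed.

Definition divpow_monoid : twisted_monoid k.
Proof.
refine (@TwistedMonoid k mon mset0 (fun x y => Some (x `+` y)%mset) (fun _ _ => 1)
  deg (fun c : mon => size c) (@divpow_comult k I) divpow_mcomulE _ _ _ _ _ _ _ _ _).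
- by move=> x y z /=; rewrite msetDA.
- by move=> x y; rewrite msetDC.
- by move=> x; rewrite mset0D.
- by [].
- by move=> x y _ _; rewrite even_sign ?deg_even ?mulr1.
- by [].
- by move=> x y u [<-]; rewrite degD.
- by move=> x y u [<-]; rewrite size_msetD.
- exact: size_mset_eq0.
Defined.

Local Notation A := (twisted_coalg divpow_monoid).

Definition gamma1 i : A := [mset i]%mset.

Definition ungamma (b : A) : option I :=
  if enum_mset (b : mon) is [:: i] then Some i else None.

Lemma ungammaP b i : ungamma b = Some i -> b = gamma1 i.
Proof.
rewrite /ungamma; case e : (enum_mset _) => [|j []] // -[<-].
by apply: enum_mset_inj; rewrite e enum_mset1.
Qed.

Lemma gamma1K i : ungamma (gamma1 i) = Some i.
Proof. by rewrite /ungamma enum_mset1. Qed.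

Lemma ungamma_wt (b : A) : bwt b != 1%N -> ungamma b = None.
Proof. by rewrite /= /ungamma; case: (enum_mset _) => [|j []]. Qed.

Local Notation act := (@gact k A I {fset I} ungamma (@zmul I k)).

Lemma gamma_act_len b S T : T \in msupp (act b S) -> #|` T| = #|` S|.+1.
Proof.
by rewrite /gact; case: (ungamma b) => [i|]; [apply: zmul_len | rewrite msupp0].
Qed.

Lemma gamma_zmulC i j S : lin (@zmul I k i) (zmul k j S)
  = - bsgn (gamma1 i) (gamma1 j) *: lin (@zmul I k j) (zmul k i S).
Proof. by apply: etrans (zmulC k i j S) _; rewrite /= even_sign ?deg_even // scaleN1r. Qed.

Lemma gamma_square (b : A) i S : (gamma1 i, gamma1 i) \in msupp (bcomul b) ->
  lin (@zmul I k i) (zmul k i S) = 0.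
Proof. by move=> _; apply: zmul_zmul. Qed.

Local Notation X := (mon * {fset I})%type.

(** A multiset and a finite set.  The smallest generator occurring in either is
   the leading one, as multiplication by it has sign +1. *)
Definition gamma_dom (x : X) : {fset I} := (finsupp x.1 `|` x.2)%fset.
Definition gamma_lead (x : X) := extreme leq (gamma_dom x).
Definition gamma_can i (x : X) := (i \in x.1) && (i \notin x.2).
Definition gamma_push i (x : X) : X := ((x.1 `\ i)%mset, (i |` x.2)%fset).
Definition gamma_back i (x : X) : X := ((i +` x.1)%mset, (x.2 `\ i)%fset).
Definition gamma_sg i (x : X) : k := (-1) ^+ below i x.2.

Lemma gamma_difE (x : X) : koszul_dif act x
  = move_dif gamma_dom gamma_can gamma_push gamma_sg x.
Proof.
case: x => c S; rewrite /koszul_dif /=.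
pose H (x : mon) j : {malg k[X]} := \lin_(T <- zmul k j S) << (x, T) >>.
transitivity (\lin_(a <- mcomul (c : divpow_monoid))
    (if ungamma a.2 is Some i then H a.1 i else 0)).
  by apply: eq_lin => a; rewrite /gact; case: (ungamma _) => //; rewrite lin0.
rewrite (@lin_generators _ divpow_monoid _ gamma1 ungamma c (finsupp c)
   (fun j => (c `\ j)%mset)) ?fset_uniq //; first last.
- move=> x i /=; rewrite msuppE; have [ic|ic] := boolP (i \in c).
    rewrite -(@mset_split1 _ x i c ic) msetDC.
    exact.
  apply/eqP => -[e]; rewrite -e in_msetD /gamma1 in_mset1 eqxx orbT in ic.
  by [].
- exact: gamma1K.
- exact: ungammaP.
have sD : (finsupp c `<=` gamma_dom (c, S))%fset by apply: fsubsetUl.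
rewrite /move_dif -(big_fset_incl _ sD) /=; last first.
  by move=> j _; rewrite msuppE /gamma_can /= => /negPf->.
apply: eq_big_seq => j; rewrite msuppE /gamma_can /= scale1r => ->.
rewrite /H /zmul; case: (j \in S) => /=; first by rewrite lin0.
by rewrite linZ linU.
Qed.

Definition gamma_htp : X -> {malg k[X]} := move_htp k gamma_lead gamma_can gamma_back.

Lemma gamma_leadP (x : X) i : gamma_lead x = Some i ->
  i \in gamma_dom x /\ (forall j, j \in gamma_dom x -> (choice.pickle i <= choice.pickle j)%N).
Proof. by exact: (extremeP leq_total leq_trans). Qed.

Lemma in_gamma_dom (x : X) i : (i \in gamma_dom x) = (i \in x.1) || (i \in x.2).
Proof. by rewrite in_fsetE msuppE. Qed.

Lemma not_can_lead (x : X) i : gamma_lead x = Some i -> ~~ gamma_can i x -> i \in x.2.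
Proof.
move=> /gamma_leadP[]; rewrite in_gamma_dom /gamma_can => + _.
by case: (i \in x.2); rewrite ?orbF ?andbT // => ->.
Qed.

Lemma below_lead (x : X) i S : gamma_lead x = Some i -> {subset S <= x.2} ->
  below i S = 0%N.
Proof.
move=> /gamma_leadP[_ h] sS; rewrite /below big_seq big1 // => j /sS jS.
by rewrite ltnNge h // in_gamma_dom jS orbT.
Qed.

Lemma below_lead_notin (x : X) i j : gamma_lead x = Some i -> i \in x.2 -> j != i ->
  j \in gamma_dom x -> below j x.2 = (below j (x.2 `\ i)%fset).+1.
Proof.
move=> /gamma_leadP[_ h] iS ji /h; rewrite (below_split _ (splitsD1 iS)).
rewrite {1}/below big_seq_fset1 leq_eqVlt => /orP[/eqP/code_inj e|->//].
by rewrite e eqxx in ji.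
Qed.

Lemma gamma_contraction (x : X) : x != (mset0, fset0) ->
  lin (koszul_dif act) (gamma_htp x) + lin gamma_htp (koszul_dif act x) = << x >>.
Proof.
move=> nx; have [i li] : exists i, gamma_lead x = Some i.
  case e : (gamma_lead x) => [i|]; first by exists i.
  have e0 := extreme_None e; case/eqP: nx; case: x e0 {e} => c S /=.
  move=> /fsetP h; congr (_, _).
    by apply/msetP => j; rewrite mset0E; apply/eqP; have := h j;
       rewrite in_gamma_dom in_fset0 mset_eq0 => /= /norP[].
  by apply/fsetP => j; have := h j; rewrite in_gamma_dom in_fset0 => /norP[_ /negPf].
transitivity (lin (move_dif gamma_dom gamma_can gamma_push gamma_sg) (gamma_htp x)
   + lin gamma_htp (move_dif gamma_dom gamma_can gamma_push gamma_sg x)).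
  by rewrite gamma_difE; apply: f_equal2 => //; apply: eq_lin => y; apply: gamma_difE.
have domP (y z : X) : (forall j, (j \in y.1) || (j \in y.2) = (j \in z.1) || (j \in z.2)) ->
    gamma_dom y = gamma_dom z.
  by move=> h; apply/fsetP => j; rewrite !in_gamma_dom.
have dom_push (y : X) j : gamma_can j y -> gamma_dom (gamma_push j y) = gamma_dom y.
  case: y => c S /andP[/= jc jS]; apply: domP => l /=; rewrite in_msetB1 !in_fsetE.
  by case: (l =P j) => [->|_] /=; rewrite ?jc ?orbT.
apply: (move_contraction _ _ _ _ _ _ _ _ li) => {x nx i li} x i.
- by move=> /gamma_leadP[].
- by move=> ci; rewrite /gamma_lead dom_push.
- move=> li ci; have iS := not_can_lead li ci; apply: domP => l /=.
  rewrite in_mset1D !in_fsetE.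
  by case: (l =P i) => [->|_] /=; rewrite ?iS ?orbT.
- move=> li ci; have iS := not_can_lead li ci; case: x li {ci} iS => c S li /= iS.
  rewrite /gamma_can /gamma_sg /gamma_push /gamma_back /= !in_fsetE in_mset1D eqxx.
  rewrite msetD1K fsetD1K // (below_lead li) ?expr0 // => j.
  by rewrite !in_fsetE => /andP[].
- case: x => c S li /andP[/= ic iS].
  rewrite /gamma_can /gamma_sg /gamma_push /gamma_back /= !in_fsetE eqxx andbF.
  by rewrite msetB1K // fsetU1K // (below_lead li) ?expr0.
- move=> j li ji _; rewrite /gamma_can /gamma_push /= in_msetB1 !in_fsetE.
  by rewrite eq_sym (negPf ji).
- move=> j li ji ci; rewrite /gamma_can /gamma_back /= in_mset1D !in_fsetE.
  by rewrite (negPf ji).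
- move=> j li ji ci /andP[jc jS]; have iS := not_can_lead li ci.
  have jD : j \in gamma_dom x by rewrite in_gamma_dom jc.
  rewrite /gamma_sg /gamma_push /gamma_back /= (below_lead_notin li iS ji jD) exprS.
  split; first by rewrite mulN1r opprK.
  congr (_, _); last first.
    apply/fsetP => l; rewrite !in_fsetE.
    by case: (l =P i) => [->|_] //=; rewrite eq_sym (negPf ji).
  apply/msetP => l; rewrite msetB1E !mset1DE msetB1E.
  case: (l =P j) => [->|_]; last by rewrite !subn0.
  by rewrite (negPf ji).
Qed.

Lemma gamma_htp_supp (x y : X) : y \in msupp (gamma_htp x) ->
  size y.1 = (size x.1).+1 /\ #|` x.2| = (#|` y.2|).+1.
Proof.
have : supp_on (fun y : X => (size y.1 == (size x.1).+1) && (#|` x.2| == (#|` y.2|).+1))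
    (gamma_htp x).
  rewrite /gamma_htp /move_htp; case li : (gamma_lead x) => [i|]; rewrite ?supp_on0 //.
  case: ifPn => ci; rewrite ?supp_on0 //; apply: supp_onU.
  rewrite /gamma_back /= size_msetD enum_mset1 eqxx /=.
  by rewrite (cardfsD1 i) (not_can_lead li ci).
by move=> /supp_onP h /h /andP[/eqP-> /eqP->].
Qed.

Definition divpow_koszul : koszul A.
Proof.
refine (@Koszul k A {fset I} fset0 (fun S : {fset I} => #|` S|) act gamma_htp
  _ _ gamma_act_len _ _ gamma_htp_supp gamma_contraction).
- by rewrite cardfs0.
- by move=> b S wb; rewrite /gact ungamma_wt.
- exact: (gactC ungammaP gamma_zmulC).
- exact: (gact_quad ungammaP gamma_zmulC gamma_square).
Defined.

Definition ext_deg S : nat := (\sum_(i <- S) dx i)%N.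

Lemma ext_comult0 : @ext_comult k I fset0 = << (fset0, fset0) >>.
Proof.
apply/malgP => -[P Q]; rewrite ext_comultE mcoeff_basis xpair_eqE.
have -> : splits fset0 P Q = (fset0 == P) && (fset0 == Q).
  rewrite /splits fsetU_eq0 ![fset0 == _]eq_sym.
  by case: (P =P fset0) => [->|_]; rewrite ?andbF // fset0I eqxx.
by case: (fset0 =P P) => [<-|] //=; case: (fset0 =P Q) => [<-|] //=; rewrite inversions0l.
Qed.

Definition divpow_model : graded_model (A := A) deg divpow_koszul.
Proof.
refine (@GradedModel k A deg divpow_koszul ext_deg (@ext_comult k I) _ _ ext_comult0 _).
- by rewrite /ext_deg big_seq_fset0.
- move=> b S T; rewrite /= /gact; case eb : (ungamma b) => [i|]; last by rewrite msupp0.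
  have -> : deg b = dx i by rewrite (ungammaP eb) degE enum_mset1 big_seq1.
  rewrite /zmul; case: ifP => iS; first by rewrite msupp0.
  have h : supp_on (fun U : {fset I} => ext_deg U == dx i + ext_deg S)%N
      ((-1) ^+ below i S *: << (i |` S)%fset >> : {malg k[{fset I}]}).
    by apply/supp_onZ/supp_onU; rewrite /ext_deg big_fsetU1 ?iS.
  by move=> hT; have /supp_onP/(_ _ hT)/eqP := h.
- move=> b S; have [wb|wb] := eqVneq (bwt b) 1%N; last first.
    by rewrite sum_tens_act_wt // kact_wt // lin0.
  rewrite sum_tens_act //; last by rewrite degE enum_mset0 big_nil.
  have [i eb] : exists i, b = gamma1 i.
    move: wb; rewrite /=; case e : (enum_mset _) => [|i []] // _; exists i.
    by apply: enum_mset_inj; rewrite e enum_mset1.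
  rewrite eb /= /gact gamma1K ext_comult_zmul; apply: eq_lin => p.
  rewrite exprD even_sign ?mul1r //; exact: deg_even.
Defined.

End DividedPowers.

(** * The exterior coalgebra and its model *)

Section ExteriorCoalgebra.
Variables (k : fieldType) (J : countType) (dy : J -> nat).
Hypothesis dy_odd : forall j, odd (dy j).

Local Notation mon := ({mset J}%mset).
Local Notation deg := (ext_deg dy).
Local Notation mdeg := (Defs.mdeg dy).
Implicit Types (m n : mon) (S T P Q : {fset J}) (i j : J).

Definition disjoint_union P Q : option {fset J} :=
  if (P `&` Q == fset0)%fset then Some (P `|` Q)%fset else None.

Lemma disjoint_unionE P Q S : (disjoint_union P Q == Some S) = splits S P Q.
Proof. by rewrite /disjoint_union /splits; case: ifP. Qed.

Lemma disjoint_union_splits P Q S : disjoint_union P Q = Some S -> splits S P Q.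
Proof. by rewrite -disjoint_unionE => ->. Qed.

Lemma ext_mcomulE S P Q : (@ext_comult k J S)@_(P, Q)
  = if disjoint_union P Q == Some S then (-1) ^+ inversions P Q else 0.
Proof. by rewrite ext_comultE disjoint_unionE. Qed.

Lemma deg_split S P Q : splits S P Q -> deg S = (deg P + deg Q)%N.
Proof. exact: big_splits. Qed.

Lemma odd_ext_deg S : odd (deg S) = odd #|` S|.
Proof.
have -> : #|` S| = (\sum_(x <- S) 1)%N.
  by rewrite big_const_seq count_predT iter_addn mul1n addn0.
rewrite /ext_deg; elim/big_rec2: _ => // j a b _ e.
by rewrite !oddD e dy_odd.
Qed.

Lemma odd_mdeg m : odd (mdeg m) = odd (size m).
Proof.
rewrite mdeg_enum; elim: (enum_mset m) => [|j s IH]; first by rewrite big_nil.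
by rewrite big_cons oddD IH dy_odd.
Qed.

Definition ext_monoid : twisted_monoid k.
Proof.
refine (@TwistedMonoid k {fset J} fset0 disjoint_union (fun P Q => (-1) ^+ inversions P Q)
  deg (fun S : {fset J} => #|` S|) (@ext_comult k J) ext_mcomulE _ _ _ _ _ _ _ _ _).
- move=> P Q S; rewrite /disjoint_union.
  case: (boolP (P `&` Q == fset0)%fset) => h1; case: (boolP (Q `&` S == fset0)%fset) => h2;
    rewrite /= ?fsetIUl ?fsetIUr ?fsetU_eq0 ?(negPf h1) ?(negPf h2) ?andbF ?h1 ?h2 ?andbT //=.
  by rewrite fsetUA.
- by move=> P Q; rewrite /disjoint_union fsetIC fsetUC.
- by move=> P; rewrite /disjoint_union fset0I eqxx fset0U.
- move=> P Q S U V /disjoint_union_splits hU /disjoint_union_splits hV.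
  rewrite -!exprD (inversions_splitl _ hU) (inversions_splitr _ hV).
  by apply: f_equal2 => //; lia.
- move=> P Q S /disjoint_union_splits h.
  rewrite -exprD; apply: signr_eq; rewrite oddD oddM !odd_ext_deg -oddM -(inversionsC h).
  by rewrite oddD -addbA addbb addbF.
- by move=> P; rewrite inversions0l.
- by move=> P Q S /disjoint_union_splits/deg_split ->.
- by move=> P Q S /disjoint_union_splits/card_split ->.
- exact: cardfs_eq0.
Defined.

Local Notation A := (twisted_coalg ext_monoid).

Definition letter j : A := [fset j]%fset.

Definition unletter (b : A) : option J :=
  if enum_fset (b : {fset J}) is [:: j] then Some j else None.

Lemma card1_letter S : #|` S| = 1%N -> exists2 j, S = [fset j]%fset & unletter S = Some j.
Proof.
rewrite /unletter; case e : (enum_fset S) => [|j []] // _; exists j => //.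
by apply/fsetP => l; rewrite -[l \in S]/(l \in enum_fset S) e in_fset1 inE.
Qed.

Lemma unletterP b j : unletter b = Some j -> b = letter j.
Proof.
move=> e; have [|l eb el] := @card1_letter b.
  by move: e; rewrite /unletter; case: (enum_fset _) => [|l []].
by move: e; rewrite el => -[<-].
Qed.

Lemma letterK j : unletter (letter j) = Some j.
Proof.
have [|l e el] := @card1_letter [fset j]%fset; first exact: cardfs1.
by rewrite [LHS]el (fset1_inj e).
Qed.

Lemma unletter_wt (b : A) : bwt b != 1%N -> unletter b = None.
Proof. by rewrite /= /unletter; case: (enum_fset _) => [|j []]. Qed.

Definition pmul j m : {malg k[mon]} := << (j +` m)%mset >>.

Local Notation act := (@gact k A J mon unletter pmul).

Lemma lin_pmul i j m : lin (pmul i) (pmul j m) = << (i +` (j +` m))%mset >>.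
Proof. by rewrite linU. Qed.

Lemma letter_sgn i j : bsgn (letter i) (letter j) = -1.
Proof.
rewrite /= -[RHS]expr1; apply: signr_eq.
by rewrite oddM /ext_deg !big_seq_fset1 !dy_odd.
Qed.

Lemma pmulC i j m : lin (pmul i) (pmul j m)
  = - bsgn (letter i) (letter j) *: lin (pmul j) (pmul i m).
Proof.
rewrite letter_sgn opprK scale1r.
refine (etrans (lin_pmul i j m) (etrans _ (esym (lin_pmul j i m)))).
exact: (congr1 (fun n : mon => << n >> : {malg k[mon]}) (msetDCA _ _ _)).
Qed.

Lemma pmul_square (b : A) i m : (letter i, letter i) \in msupp (bcomul b) ->
  lin (pmul i) (pmul i m) = 0.
Proof.
move=> /(@mcomul_prod _ ext_monoid)/disjoint_union_splits/splitsP/(_ i).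
by rewrite in_fset1 eqxx; case: (_ \in _).
Qed.

Lemma pmul_len b m n : n \in msupp (act b m) -> size n = (size m).+1.
Proof.
rewrite /gact; case: (unletter b) => [i|]; last by rewrite msupp0.
have h : supp_on (fun n : mon => size n == (size m).+1) (pmul i m).
  by apply: supp_onU; rewrite size_msetD enum_mset1.
by move=> hT; have /supp_onP/(_ _ hT)/eqP := h.
Qed.

Local Notation X := ({fset J} * mon)%type.

(** The leading generator is now the largest one occurring, as it is split off on
   the right with sign +1. *)
Definition ext_dom (x : X) : {fset J} := (x.1 `|` finsupp x.2)%fset.
Definition ext_lead (x : X) := extreme geq (ext_dom x).
Definition ext_can j (x : X) := j \in x.1.
Definition ext_push j (x : X) : X := ((x.1 `\ j)%fset, (j +` x.2)%mset).
Definition ext_back j (x : X) : X := ((j |` x.1)%fset, (x.2 `\ j)%mset).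
Definition ext_sg j (x : X) : k := (-1) ^+ above j (x.1 `\ j)%fset.

Lemma in_ext_dom (x : X) i : (i \in ext_dom x) = (i \in x.1) || (i \in x.2).
Proof. by rewrite in_fsetE msuppE. Qed.

Lemma ext_difE (x : X) : koszul_dif act x
  = move_dif ext_dom ext_can ext_push ext_sg x.
Proof.
case: x => S m; rewrite /koszul_dif /=.
pose H (P : {fset J}) j : {malg k[X]} := \lin_(n <- pmul j m) << (P, n) >>.
transitivity (\lin_(a <- mcomul (S : ext_monoid))
    (if unletter a.2 is Some i then H a.1 i else 0)).
  by apply: eq_lin => a; rewrite /gact; case: (unletter _) => //; rewrite lin0.
rewrite (@lin_generators _ ext_monoid _ letter unletter S S
   (fun j => (S `\ j)%fset)) ?fset_uniq //; first last.
- move=> P j; rewrite [_ == _]disjoint_unionE splitsC /letter.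
  apply/idP/andP => [h|[jS /eqP->]]; last exact: splitsD1.
  have jS : j \in S by have := card_split h; have /splitsP/(_ j) := h;
    rewrite in_fset1 eqxx; case: (j \in S).
  split=> //; apply/eqP/fsetP => l; have /splitsP/(_ l) := h.
  rewrite !in_fsetE; case: (l =P j) => [->|_] /=; rewrite ?jS; first by case: (_ \in _).
  by case: (l \in P); case: (l \in S).
- exact: letterK.
- exact: unletterP.
have sD : (S `<=` ext_dom (S, m))%fset by apply: fsubsetUl.
rewrite /move_dif -(big_fset_incl _ sD) /=; last first.
  by move=> j _; rewrite /ext_can /= => /negPf->.
apply: eq_big_seq => j jS; rewrite /ext_can /= jS.
by rewrite /H linU inversions1r.
Qed.

Definition ext_htp : X -> {malg k[X]} := move_htp k ext_lead ext_can ext_back.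

Lemma ext_leadP (x : X) i : ext_lead x = Some i ->
  i \in ext_dom x /\ (forall j, j \in ext_dom x -> (choice.pickle j <= choice.pickle i)%N).
Proof.
apply: extremeP => [a b|a b c /= ba ac]; first exact: leq_total.
exact: leq_trans ac ba.
Qed.

Lemma not_can_ext_lead (x : X) i : ext_lead x = Some i -> ~~ ext_can i x -> i \in x.2.
Proof. by move=> /ext_leadP[]; rewrite in_ext_dom /ext_can => /orP[->|]. Qed.

Lemma above_lead (x : X) i S : ext_lead x = Some i -> {subset S <= x.1} ->
  above i S = 0%N.
Proof.
move=> /ext_leadP[_ h] sS; rewrite /above big_seq big1 // => j /sS jS.
by rewrite ltnNge h // in_ext_dom jS.
Qed.

Lemma above_lead_notin (x : X) i j : ext_lead x = Some i -> i \notin x.1 -> j != i ->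
  j \in ext_dom x ->
  above j ((i |` x.1) `\ j)%fset = (above j (x.1 `\ j)%fset).+1.
Proof.
move=> /ext_leadP[_ h] iS ji /h.
have iS' : i \notin (x.1 `\ j)%fset by rewrite in_fsetE negb_and iS orbT.
have -> : ((i |` x.1) `\ j = i |` (x.1 `\ j))%fset.
  apply/fsetP => l; rewrite !in_fsetE.
  by case: (l =P i) => [->|_] //=; rewrite eq_sym ji.
rewrite {1}/above big_fsetU1 //= leq_eqVlt => /orP[/eqP/code_inj e|->//].
by rewrite e eqxx in ji.
Qed.

Lemma ext_contraction (x : X) : x != (fset0, mset0) ->
  lin (koszul_dif act) (ext_htp x) + lin ext_htp (koszul_dif act x) = << x >>.
Proof.
move=> nx; have [i li] : exists i, ext_lead x = Some i.
  case e : (ext_lead x) => [i|]; first by exists i.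
  have e0 := extreme_None e; case/eqP: nx; case: x e0 {e} => S m /=.
  move=> /fsetP h; congr (_, _).
    by apply/fsetP => j; have := h j; rewrite in_ext_dom in_fset0 => /norP[/negPf].
  by apply/msetP => j; rewrite mset0E; apply/eqP; have := h j;
       rewrite in_ext_dom in_fset0 mset_eq0 => /= /norP[].
transitivity (lin (move_dif ext_dom ext_can ext_push ext_sg) (ext_htp x)
   + lin ext_htp (move_dif ext_dom ext_can ext_push ext_sg x)).
  by rewrite ext_difE; apply: f_equal2 => //; apply: eq_lin => y; apply: ext_difE.
have domP (y z : X) : (forall j, (j \in y.1) || (j \in y.2) = (j \in z.1) || (j \in z.2)) ->
    ext_dom y = ext_dom z.
  by move=> h; apply/fsetP => j; rewrite !in_ext_dom.
have dom_push (y : X) j : ext_can j y -> ext_dom (ext_push j y) = ext_dom y.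
  case: y => S m /= jS; apply: domP => l /=; rewrite in_mset1D !in_fsetE.
  by case: (l =P j) => [->|_] //=; rewrite [j \in S]jS.
apply: (move_contraction _ _ _ _ _ _ _ _ li) => {x nx i li} x i.
- by move=> /ext_leadP[].
- by move=> ci; rewrite /ext_lead dom_push.
- move=> li ci; have im := not_can_ext_lead li ci; apply: domP => l /=.
  rewrite in_msetB1 !in_fsetE.
  by case: (l =P i) => [->|_] //=; rewrite im orbT.
- move=> li ci; have im := not_can_ext_lead li ci; case: x li ci im => S m li iS /= im.
  rewrite /ext_can /ext_sg /ext_push /ext_back /= !in_fsetE eqxx.
  by rewrite msetB1K // fsetU1K // (above_lead li) ?expr0.
- case: x => S m li iS; rewrite /ext_can /ext_sg /ext_push /ext_back /= !in_fsetE eqxx.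
  rewrite msetD1K fsetD1K // (above_lead li) ?expr0 // => j.
  by rewrite !in_fsetE => /andP[].
- by move=> j li ji _; rewrite /ext_can /ext_push /= !in_fsetE eq_sym (negPf ji).
- by move=> j li ji ci; rewrite /ext_can /ext_back /= !in_fsetE (negPf ji).
- move=> j li ji iS jS; have im := not_can_ext_lead li iS.
  have jD : j \in ext_dom x by rewrite in_ext_dom [j \in x.1]jS.
  rewrite /ext_sg /ext_push /ext_back /= (above_lead_notin li iS ji jD) exprS.
  split; first by rewrite mulN1r.
  congr (_, _).
    apply/fsetP => l; rewrite !in_fsetE.
    by case: (l =P i) => [->|_] //=; rewrite eq_sym ji.
  apply/msetP => l; rewrite msetB1E !mset1DE msetB1E.
  case: (l =P i) => [->|_]; last by rewrite !subn0.
  by rewrite eq_sym (negPf ji).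
Qed.

Lemma ext_htp_supp (x y : X) : y \in msupp (ext_htp x) ->
  #|` y.1| = (#|` x.1|).+1 /\ size x.2 = (size y.2).+1.
Proof.
have : supp_on (fun y : X => (#|` y.1| == (#|` x.1|).+1) && (size x.2 == (size y.2).+1))
    (ext_htp x).
  rewrite /ext_htp /move_htp; case li : (ext_lead x) => [i|]; rewrite ?supp_on0 //.
  case: ifPn => ci; rewrite ?supp_on0 //; apply: supp_onU.
  have e : size x.2 = (size (x.2 `\ i)%mset).+1.
    by rewrite -{1}(msetB1K (not_can_ext_lead li ci)) size_msetD enum_mset1.
  by rewrite /ext_back /= cardfsU1 [i \in _](negPf ci) e !eqxx.
by move=> /supp_onP h /h /andP[/eqP-> /eqP->].
Qed.

Definition ext_koszul : koszul A.
Proof.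
refine (@Koszul k A mon mset0 (fun m : mon => size m) act ext_htp
  _ _ pmul_len _ _ ext_htp_supp ext_contraction).
- by rewrite enum_mset0.
- by move=> b m wb; rewrite /gact unletter_wt.
- exact: (gactC unletterP pmulC).
- exact: (gact_quad unletterP pmulC pmul_square).
Defined.

Lemma poly_comult0 : @poly_comult k J mset0 = << (mset0, mset0) >>.
Proof.
apply/malgP => -[x y]; rewrite poly_comultE mcoeff_basis xpair_eqE.
have -> : (x `+` y == mset0)%mset = (mset0 == x) && (mset0 == y).
  by rewrite -!size_mset_eq0 size_msetD addn_eq0 !size_mset_eq0 ![mset0 == _]eq_sym.
case: (mset0 =P x) => [<-|] //=; case: (mset0 =P y) => [<-|] //=.
rewrite (@binomialsE _ fset0) ?big_seq_fset0 // mset0D.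
by apply/fsubsetP => j; rewrite msuppE in_mset0.
Qed.

(** The generator j is primitive; the coefficients are compared by Pascal's
   rule. *)
Lemma poly_comult_pmul j m : lin (@poly_comult k J) (pmul j m)
  = \lin_(p <- @poly_comult k J m)
      (<< ((j +` p.1)%mset, p.2) >> + << (p.1, (j +` p.2)%mset) >>
       : {malg k[(mon * mon)%type]}).
Proof.
apply/malgP => -[x y]; rewrite linU linDf mcoeffD.
move: (x : mon) (y : mon) => {}x {}y.
have el : (\lin_(p <- @poly_comult k J m) << ((j +` p.1)%mset, p.2) >>
    : {malg k[(mon * mon)%type]})@_(x, y)
  = if (j \in x) && (j +` m == x `+` y)%mset then (binomials (x `\ j)%mset y)%:R else 0.
  have [jx|jx] /= := boolP (j \in x).
    rewrite (@mcoeff_linM _ _ _ _ _ _ ((x `\ j)%mset : mon, y)).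
      rewrite mcoeff_basis poly_comultE /= msetB1K // eqxx mulr1.
      have -> : (x `\ j `+` y == m)%mset = (j +` m == x `+` y)%mset.
        rewrite -{2}(msetB1K jx) -msetDA; apply/eqP/eqP => [<-//|].
        by rewrite ![(j +` _)%mset]msetDC => /msetD_cancel.
      by case: ifP.
    move=> [u v] _; rewrite mcoeff_basis !xpair_eqE /=.
    by rewrite -(mset_split1 _ jx) => /negPf->.
  rewrite mcoeff_lin big1 // => -[u v] _; rewrite mcoeff_basis xpair_eqE /=.
  case: (_ =P x) => [e|]; last by rewrite mulr0.
  by rewrite -e in_mset1D eqxx in jx.
have er : (\lin_(p <- @poly_comult k J m) << (p.1, (j +` p.2)%mset) >>
    : {malg k[(mon * mon)%type]})@_(x, y)
  = if (j \in y) && (j +` m == x `+` y)%mset then (binomials x (y `\ j)%mset)%:R else 0.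
  have [jy|jy] /= := boolP (j \in y).
    rewrite (@mcoeff_linM _ _ _ _ _ _ (x, (y `\ j)%mset : mon)).
      rewrite mcoeff_basis poly_comultE /= msetB1K // eqxx mulr1.
      have -> : (x `+` (y `\ j) == m)%mset = (j +` m == x `+` y)%mset.
        rewrite -{2}(msetB1K jy) msetDCA; apply/eqP/eqP => [<-//|].
        by rewrite ![(j +` _)%mset]msetDC => /msetD_cancel.
      by case: ifP.
    move=> [u v] _; rewrite mcoeff_basis !xpair_eqE /=.
    by rewrite -(mset_split1 _ jy) => /negPf->.
  rewrite mcoeff_lin big1 // => -[u v] _; rewrite mcoeff_basis xpair_eqE /= andbC.
  case: (_ =P y) => [e|]; last by rewrite mulr0.
  by rewrite -e in_mset1D eqxx in jy.
apply: etrans (esym (f_equal2 +%R el er)); rewrite {el er} poly_comultE eq_sym.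
case: (_ =P (x `+` y)%mset) => [e|_]; last by rewrite !andbF addr0.
have jxy : j \in (x `+` y)%mset by rewrite -e in_mset1D eqxx.
rewrite !andbT (binomials_pascal jxy) natrD.
by congr (_ + _); case: ifP.
Qed.

Definition ext_model : graded_model (A := A) deg ext_koszul.
Proof.
refine (@GradedModel k A deg ext_koszul (fun m : mon => mdeg m) (@poly_comult k J)
  _ _ poly_comult0 _).
- by rewrite mdeg_enum enum_mset0 big_nil.
- move=> b m n; rewrite /= /gact; case eb : (unletter b) => [j|]; last by rewrite msupp0.
  have h : supp_on (fun n : mon => mdeg n == deg b + mdeg m)%N (pmul j m).
    apply: supp_onU; rewrite (unletterP eb) /ext_deg big_seq_fset1 !mdeg_enum.
    by rewrite (perm_big _ (enum_msetD_perm _ _)) big_cat enum_mset1 big_seq1.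
  by move=> hT; have /supp_onP/(_ _ hT)/eqP := h.
- move=> b m; have [wb|wb] := eqVneq (bwt b) 1%N; last first.
    by rewrite sum_tens_act_wt // kact_wt // lin0.
  rewrite sum_tens_act //; last by rewrite /ext_deg big_seq_fset0.
  have [j ej eb] := card1_letter wb.
  rewrite /= /gact eb poly_comult_pmul; apply: eq_lin => p.
  have -> : (-1) ^+ (deg b * mdeg p.1 + size (p.1 : mon)) = 1 :> k.
    rewrite -[RHS](expr0 (-1)); apply: signr_eq.
    by rewrite oddD oddM odd_ext_deg [#|` b|]wb odd_mdeg addbb.
  rewrite scale1r.
  exact: (esym (f_equal2 +%R (linU (fun n : mon => << (n, p.2) >> : {malg k[(mon * mon)%type]}) _)
                             (linU (fun n : mon => << (p.1, n) >> : {malg k[(mon * mon)%type]}) _))).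
Defined.

End ExteriorCoalgebra.

(** * Bidegrees and the two isomorphisms *)

Lemma mdeg_weighted (I : countType) (w : nat) (d : I -> nat) (m : {mset I}%mset) :
  Defs.mdeg (fun i => (w, d i)) m = ((w * size m)%N, Defs.mdeg d m).
Proof.
rewrite !mdeg_enum; elim: (enum_mset m) => [|i s IH]; first by rewrite !big_nil muln0.
by rewrite !big_cons IH /= mulnS.
Qed.

Lemma ext_deg_weighted (I : countType) (d : I -> nat) (S : {fset I}) (w : nat) :
  \sum_(i <- S) (w, d i) = ((w * #|` S|)%N, ext_deg d S).
Proof.
rewrite /ext_deg; elim: (enum_fset S) => [|i s IH]; first by rewrite !big_nil muln0.
by rewrite !big_cons IH /= mulnS.
Qed.

Section Bidegrees.
Variables (k : fieldType) (I : countType) (d : I -> nat).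

Lemma divpow_weight0 (d_even : forall i, ~~ odd (d i)) :
  divpow_coalg k (fun i => (0%N, d i))
  = weight0_coalg (A := twisted_coalg (divpow_monoid k d_even)) (Defs.mdeg d).
Proof.
rewrite /divpow_coalg /weight0_coalg; congr Coalg; apply/funext => m.
exact: (mdeg_weighted 0).
Qed.

Lemma ext_weight1 (d_even : forall i, ~~ odd (d i)) :
  ext_coalg k (fun i => (1%N, d i)) = model_coalg (divpow_model k d_even).
Proof.
rewrite /ext_coalg /model_coalg; congr Coalg; apply/funext => S.
by rewrite ext_deg_weighted mul1n.
Qed.

Lemma ext_weight0 (d_odd : forall i, odd (d i)) :
  ext_coalg k (fun i => (0%N, d i))
  = weight0_coalg (A := twisted_coalg (ext_monoid k d_odd)) (ext_deg d).
Proof.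
rewrite /ext_coalg /weight0_coalg; congr Coalg; apply/funext => S.
exact: (ext_deg_weighted _ _ 0).
Qed.

Lemma poly_weight1 (d_odd : forall i, odd (d i)) :
  poly_coalg k (fun i => (1%N, d i)) = model_coalg (ext_model k d_odd).
Proof.
rewrite /poly_coalg /model_coalg; congr Coalg; apply/funext => m.
by rewrite mdeg_weighted mul1n.
Qed.

End Bidegrees.

Theorem proposition5p1 (k : fieldType)
    (I : countType) (dx : I -> nat)
    (dx_even : forall i, ~~ odd (dx i))
    (dx_fin : forall n, finite_set [set i | dx i = n]%classic)
    (J : countType) (dy : J -> nat)
    (dy_odd : forall j, odd (dy j))
    (dy_fin : forall n, finite_set [set j | dy j = n]%classic) :
  bgcoalg_iso
    (coHH (divpow_coalg k dx))
    (bgcoalg_of (ctens (divpow_coalg k (fun i => (0%N, dx i)))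
                       (ext_coalg k (fun i => (1%N, dx i))))) /\
  bgcoalg_iso
    (coHH (ext_coalg k dy))
    (bgcoalg_of (ctens (ext_coalg k (fun j => (0%N, dy j)))
                       (poly_coalg k (fun j => (1%N, dy j))))).
Proof.
rewrite (divpow_weight0 k dx_even) (ext_weight1 k dx_even).
rewrite (ext_weight0 k dy_odd) (poly_weight1 k dy_odd); split.
- exact: (@coHH_model k (twisted_coalg (divpow_monoid k dx_even)) (Defs.mdeg dx)
    (fun b c => erefl) (@twisted_dgD k (divpow_monoid k dx_even)) _ (divpow_model k dx_even)).
- exact: (@coHH_model k (twisted_coalg (ext_monoid k dy_odd)) (ext_deg dy)
    (fun b c => erefl) (@twisted_dgD k (ext_monoid k dy_odd)) _ (ext_model k dy_odd)).
Qed.
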